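(* Let $1<p<\infty$ be fixed, let $q$ satisfy $\frac1p+\frac1q=1$, and let $Z\subset\mathbb{R}^n$ be an asymmetric $L_p$-zonotope that is the $L_p$-sum of exactly $n+1$ segments of the form $[0,u_i]$ with $u_i\in\mathbb{R}^n$. Then $$c_{q,n+1}|Z|\le|Z\oplus_p-Z|\le2^n|Z| ,$$ where $$c_{q,n+1}:=\frac{2^n\,|P_{\theta^\perp}B_q^{n+1}|_n}{\sqrt{n+1}\,|B_q^n|},\qquad\theta=\left(\tfrac1{\sqrt{n+1}},\dots,\tfrac1{\sqrt{n+1}}\right)\in\mathbb{R}^{n+1}.$$ Equality holds in the right-hand bound if and only if $Z$ is contained in a hyperplane or is the $L_p$-sum of $n$ segments each having the origin as an endpoint. The left inequality is sharp (the constant $c_{q,n+1}$ cannot be replaced by a larger one).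
   Context: $|\cdot|$ and $|\cdot|_n$ denote $n$-dimensional Lebesgue measure; $h_K(x)=\sup_{k\in K}\langle x,k\rangle$. For compact convex sets $K,L$ containing the origin, $K\oplus_pL$ is the compact convex set with $h_{K\oplus_pL}=(h_K^p+h_L^p)^{1/p}$; $-Z=\{-z:z\in Z\}$ and $Z\oplus_p-Z$ means $Z\oplus_p(-Z)$. An asymmetric $L_p$-zonotope is an $L_p$-sum of finitely many segments containing the origin. $B_q^d=\{x\in\mathbb{R}^d:\sum_i|x_i|^q\le1\}$; $P_{\theta^\perp}$ is the orthogonal projection onto the hyperplane of $\mathbb{R}^{n+1}$ orthogonal to $\theta$. *)

(* Defs.v *)
From HB Require Import structures.
From mathcomp Require Import all_boot all_order all_algebra.
From mathcomp Require Import all_classical all_reals all_analysis.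
From mathcomp Require Import ring lra.

Set Implicit Arguments.
Unset Strict Implicit.
Unset Printing Implicit Defensive.
Import Order.TTheory GRing.Theory Num.Theory.
Import numFieldNormedType.Exports.

Local Open Scope classical_set_scope.
Local Open Scope ring_scope.

Section Lebesgue.
Context {R : realType}.
Local Notation mR := (measurableTypeR R).

Definition cons_pair n (z : mR * n.-tuple mR) : n.+1.-tuple mR :=
  [tuple of z.1 :: z.2].

Lemma measurable_cons_pair n : measurable_fun [set: mR * n.-tuple mR] (@cons_pair n).
Proof. exact: measurable_cons. Qed.

Lemma measurable_preimage_cons n (A : set (n.+1.-tuple mR)) :
  measurable A -> measurable (@cons_pair n @^-1` A).
Proof.
by move=> mA; rewrite -[X in measurable X]setTI; exact: measurable_cons_pair.
Qed.

(* Product of the one-dimensional Lebesgue measure with [m], carried over to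
   tuples. *)
Definition cons_measure n (m : {sigma_finite_measure set (n.-tuple mR) -> \bar R}) :
    set (n.+1.-tuple mR) -> \bar R :=
  pushforward (lebesgue_measure \x m)%E (@cons_pair n).

Section cons_measure.
Context n (m : {sigma_finite_measure set (n.-tuple mR) -> \bar R}).

Let cons_measure0 : cons_measure m set0 = 0%E.
Proof. by rewrite /cons_measure /pushforward preimage_set0 measure0. Qed.

Let cons_measure_ge0 A : (0 <= cons_measure m A)%E.
Proof. by rewrite /cons_measure /pushforward; exact: measure_ge0. Qed.

Let cons_measure_sigma_additive : semi_sigma_additive (cons_measure m).
Proof.
move=> F mF tF mUF; rewrite /cons_measure /pushforward preimage_bigcup.
apply: measure_semi_sigma_additive.
- by move=> i; exact: measurable_preimage_cons.
- apply/trivIsetP => /= i j _ _ ij; rewrite -preimage_setI.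
  by move/trivIsetP : tF => /(_ _ _ _ _ ij) ->//; rewrite preimage_set0.
- by rewrite -preimage_bigcup; exact: measurable_preimage_cons.
Qed.

HB.instance Definition _ := isMeasure.Build _ _ _ (cons_measure m)
  cons_measure0 cons_measure_ge0 cons_measure_sigma_additive.

Let cons_measure_sigma_finite : sigma_finite setT (cons_measure m).
Proof.
have /sigma_finiteP[F [TF ndF Foo]] := sigma_finiteT (@lebesgue_measure R).
have /sigma_finiteP[G [TG ndG Goo]] := sigma_finiteT m.
pose box k := [set t : n.+1.-tuple mR | F k (thead t) /\ G k [tuple of behead t]].
have boxE k : @cons_pair n @^-1` box k = F k `*` G k.
  apply/funext => -[x t]; rewrite /preimage /box /setX /mkset.
  have -> : [tuple of behead (cons_pair (x, t))] = t by exact: val_inj.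
  by [].
exists box.
  apply/seteqP; split=> // t _.
  have [i _ Fi] : (\bigcup_k F k) (thead t) by rewrite -TF.
  have [j _ Gj] : (\bigcup_k G k) [tuple of behead t] by rewrite -TG.
  exists (maxn i j) => //; split.
    by move: (thead t) Fi; exact/subsetPset/ndF/leq_maxl.
  by move: [tuple of behead t] Gj; exact/subsetPset/ndG/leq_maxr.
move=> k; have [mF Ffin] := Foo k; have [mG Gfin] := Goo k; split.
  apply: measurableI.
    by rewrite -[X in measurable X]setTI; apply: measurable_tnth.
  by rewrite -[X in measurable X]setTI; apply: measurable_behead.
rewrite /cons_measure /pushforward boxE product_measure1E//.
by rewrite lte_mul_pinfty// ge0_fin_numE.
Qed.

HB.instance Definition _ := Measure_isSigmaFinite.Build _ _ _ (cons_measure m)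
  cons_measure_sigma_finite.

End cons_measure.

Fixpoint lebesgue_tuple n : {sigma_finite_measure set (n.-tuple mR) -> \bar R} :=
  match n with
  | 0%N => \d_[tuple]
  | k.+1 => cons_measure (lebesgue_tuple k)
  end.

Lemma lebesgue_tuple_box n (A : 'I_n -> set mR) :
  (forall i, measurable (A i)) ->
  lebesgue_tuple n [set t | forall i, A i (tnth t i)] =
  (\prod_i lebesgue_measure (A i))%E.
Proof.
elim: n A => [|n IHn] A mA.
  rewrite big_ord0 /= (_ : [set t | _] = setT) ?diracT//.
  by apply/seteqP; split=> // t _ [].
rewrite big_ord_recl /= /cons_measure /pushforward.
rewrite (_ : _ @^-1` _ = A ord0 `*`
    [set t : n.-tuple mR | forall i, A (lift ord0 i) (tnth t i)]); last first.
  apply/seteqP; split => [[x t] /= h|[x t] /= [hx h] i].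
    split=> [|i]; first exact: (h ord0).
    by move: (h (lift ord0 i)); rewrite /cons_pair tnthS.
  by case: (unliftP ord0 i) => [j ->|->//]; rewrite /cons_pair tnthS.
rewrite product_measure1E//; first by congr (_ * _)%E; exact: IHn.
rewrite (_ : [set t | _] = \bigcap_(i in [set: 'I_n])
    ((fun t : n.-tuple mR => tnth t i) @^-1` A (lift ord0 i))); last first.
  by apply/seteqP; split => t h i; [move=> _; exact: h|exact: (h i)].
apply: fin_bigcap_measurable => // i _.
by rewrite -[X in measurable X]setTI; apply: measurable_tnth.
Qed.

(* Vectors are row matrices, and [volume] is n-dimensional Lebesgue measure on
   Borel sets. *)
Definition volume n (A : set 'rV[R]_n) : \bar R :=
  lebesgue_tuple n [set t | A (\row_i tnth t i)].

End Lebesgue.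

Section Euclidean.
Context {R : realType}.

Definition dot n (x y : 'rV[R]_n) : R := \sum_i x 0 i * y 0 i.

Lemma dotC n (x y : 'rV[R]_n) : dot x y = dot y x.
Proof. by apply: eq_bigr => i _; rewrite mulrC. Qed.

Lemma dotDl n (x y z : 'rV[R]_n) : dot (x + y) z = dot x z + dot y z.
Proof. by rewrite -big_split; apply: eq_bigr => i _; rewrite mxE mulrDl. Qed.

Lemma dotZl n (t : R) (x y : 'rV[R]_n) : dot (t *: x) y = t * dot x y.
Proof. by rewrite mulr_sumr; apply: eq_bigr => i _; rewrite mxE mulrA. Qed.

Lemma dotNl n (x y : 'rV[R]_n) : dot (- x) y = - dot x y.
Proof. by rewrite -scaleN1r dotZl mulN1r. Qed.

Lemma dotBl n (x y z : 'rV[R]_n) : dot (x - y) z = dot x z - dot y z.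
Proof. by rewrite dotDl dotNl. Qed.

Lemma dotDr n (x y z : 'rV[R]_n) : dot x (y + z) = dot x y + dot x z.
Proof. by rewrite dotC dotDl !(dotC _ x). Qed.

Lemma dotZr n (t : R) (x y : 'rV[R]_n) : dot x (t *: y) = t * dot x y.
Proof. by rewrite dotC dotZl dotC. Qed.

Lemma dotNr n (x y : 'rV[R]_n) : dot x (- y) = - dot x y.
Proof. by rewrite dotC dotNl dotC. Qed.

Lemma dot0r n (x : 'rV[R]_n) : dot x 0 = 0.
Proof. by rewrite -(scale0r 0) dotZr mul0r. Qed.

Lemma dot_ge0 n (x : 'rV[R]_n) : 0 <= dot x x.
Proof. by apply: sumr_ge0 => i _; rewrite -expr2 sqr_ge0. Qed.

Lemma dot_eq0 n (x : 'rV[R]_n) : dot x x = 0 -> x = 0.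
Proof.
move=> /eqP; rewrite psumr_eq0 => [|i _]; last by rewrite -expr2 sqr_ge0.
move=> /allP x0; apply/rowP => i; rewrite mxE; apply/eqP.
by have := x0 i (mem_index_enum i); rewrite /= mulf_eq0 orbb.
Qed.

Lemma dot_sqB n (y d : 'rV[R]_n) (t : R) : dot (y - t *: d) (y - t *: d) =
  dot y y - 2 * t * dot y d + t ^+ 2 * dot d d.
Proof. by rewrite dotBl !dotDr !dotNr !dotZl !dotZr (dotC d y); ring. Qed.

Lemma dot_delta n (x : 'rV[R]_n) i : dot x (delta_mx 0 i) = x 0 i.
Proof.
rewrite /dot (bigD1 i)//= mxE !eqxx mulr1 big1 ?addr0// => j ji.
by rewrite mxE (negbTE ji) andbF mulr0.
Qed.

Lemma continuous_sum n (T : topologicalType) (F : 'I_n -> T -> R) :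
  (forall i, continuous (F i)) -> continuous (fun x => \sum_i F i x).
Proof.
elim: n F => [|n IHn] F cF x.
  rewrite (_ : (fun y => _) = cst 0); first exact: cvg_cst.
  by apply/funext => y; rewrite big_ord0.
rewrite (_ : (fun y => _) =
    fun y => F ord0 y + \sum_(i < n) F (lift ord0 i) y); last first.
  by apply/funext => y; rewrite big_ord_recl.
apply: cvgD; first exact: cF.
by apply: (IHn (fun i => F (lift ord0 i))) => i; exact: cF.
Qed.

Lemma continuous_dot n (x : 'rV[R]_n) : continuous (dot x).
Proof.
apply: (@continuous_sum n 'rV[R]_n (fun i y => x 0 i * y 0 i)) => i y.
by apply: continuousM; [exact: cst_continuous|exact: (@coord_continuous R 1 n 0 i y)].
Qed.

Definition support n (K : set 'rV[R]_n) (x : 'rV[R]_n) : R :=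
  sup [set dot x k | k in K].

Definition convex_body0 n (K : set 'rV[R]_n) : Prop :=
  [/\ compact K, convex_set K & K 0].

Definition is_Lp_sum n (p : R) (K L M : set 'rV[R]_n) : Prop :=
  convex_body0 M /\
  forall x, support M x = (support K x `^ p + support L x `^ p) `^ p^-1.

(* For 1 < p and arguments satisfying [convex_body0], such a set exists and is
   unique: see [is_Lp_sum_exists] and [is_Lp_sum_unique]. *)
Definition Lp_sum n (p : R) (K L : set 'rV[R]_n) : set 'rV[R]_n :=
  xget set0 (is_Lp_sum p K L).

Definition segment0 n (u : 'rV[R]_n) : set 'rV[R]_n :=
  [set t *: u | t in `[0, 1]].

Section support.
Context {n : nat}.
Implicit Types (K L M : set 'rV[R]_n) (x y : 'rV[R]_n).

Lemma support_attained K x : compact K -> K !=set0 ->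
  exists k, [/\ K k, support K x = dot x k & forall l, K l -> dot x l <= dot x k].
Proof.
move=> cK K0.
have cf : {within K, continuous (dot x)}.
  by apply: continuous_subspaceT; exact: continuous_dot.
have [k Kk kmax] := compact_EVT_max K0 cK cf.
have ub l : K l -> dot x l <= dot x k by move=> Kl; apply: kmax; rewrite inE.
exists k; split => //; first exact: set_mem.
apply/eqP; rewrite eq_le; apply/andP; split.
  apply: ge_sup; first by exists (dot x k), k => //; exact: set_mem.
  by move=> _ [l Kl <-]; exact: ub.
apply: ub_le_sup; first by exists (dot x k) => _ [l Kl <-]; exact: ub.
by exists k => //; exact: set_mem.
Qed.

Lemma dot_le_support K x k : compact K -> K k -> dot x k <= support K x.
Proof.
move=> cK Kk.
have [|l [_ -> lmax]] := support_attained x cK; first by exists k.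
exact: lmax.
Qed.

Lemma support_ge0 K x : compact K -> K 0 -> 0 <= support K x.
Proof. by move=> cK K0; rewrite -(dot0r x); exact: dot_le_support. Qed.

Lemma convE (V : lmodType R) (t : {i01 R}) (a b : convex_lmodType V) :
  conv t a b = t%:num *: (a : V) + (1 - t%:num) *: (b : V).
Proof. by []. Qed.

Lemma convex_comb K x y (t : R) : convex_set K -> K x -> K y ->
  0 <= t -> t <= 1 -> K (t *: x + (1 - t) *: y).
Proof.
move=> cvK Kx Ky t0 t1.
pose t' : {i01 R} := Itv01 t0 t1.
have := cvK x y t'; rewrite !inE => /(_ Kx Ky).
by rewrite convE.
Qed.

Lemma support_sub K x : compact K -> convex_set K -> K !=set0 ->
  (forall y, dot y x <= support K y) -> K x.
Proof.
move=> cK cvK K0 xK.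
pose f z := dot (x - z) (x - z).
have cf : {within K, continuous f}.
  apply: continuous_subspaceT.
  apply: (@continuous_sum n 'rV[R]_n (fun i z => (x - z) 0 i * (x - z) 0 i)) => i z.
  have cc : {for z, continuous (fun u : 'rV[R]_n => (x - u) 0 i)}.
    rewrite (_ : (fun u => _) = fun u : 'rV[R]_n => x 0 i - u 0 i); last first.
      by apply/funext => u; rewrite !mxE.
    by apply: continuousB; [exact: cst_continuous|exact: (@coord_continuous R 1 n 0 i z)].
  by apply: continuousM; exact: cc.
have [m /set_mem Km mmin] := compact_EVT_min K0 cK cf.
set y := x - m.
have key l : K l -> dot y l <= dot y m.
  move=> Kl; rewrite leNgt; apply/negP => lt_ml.
  pose d := l - m.
  have yd : 0 < dot y d by rewrite /d dotDr dotNr subr_gt0.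
  have sq t : 0 <= t -> t <= 1 -> 2 * t * dot y d <= t ^+ 2 * dot d d.
    move=> t0 t1.
    have : f m <= f (t *: l + (1 - t) *: m).
      by apply: mmin; rewrite inE; exact: convex_comb.
    have -> : f (t *: l + (1 - t) *: m) = dot (y - t *: d) (y - t *: d).
      rewrite /f; congr dot; rewrite /y /d; apply/rowP => i; rewrite !mxE; ring.
    have -> : f m = dot y y by [].
    rewrite dot_sqB; lra.
  have dd : 0 < dot d d.
    rewrite lt_neqAle dot_ge0 andbT eq_sym; apply/eqP => /dot_eq0 d0.
    by move: yd; rewrite d0 dot0r ltxx.
  have [le_dd|lt_dd] := leP (dot d d) (dot y d).
    have := sq 1 ler01 (lexx _); lra.
  have := sq (dot y d / dot d d).
  have -> : (dot y d / dot d d) ^+ 2 * dot d d = dot y d / dot d d * dot y d.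
    by field; rewrite gt_eqF.
  have q0 : 0 < dot y d / dot d d by rewrite divr_gt0.
  have q1 : dot y d / dot d d <= 1 by rewrite ler_pdivrMr// mul1r ltW.
  move=> /(_ (ltW q0) q1); nra.
have [k [Kk hk _]] := support_attained y cK K0.
have := xK y; rewrite hk => xk.
have := key k Kk => kk.
have y0 : dot y y <= 0.
  by rewrite {2}/y dotDr dotNr subr_le0 (le_trans xk).
have /dot_eq0 /eqP : dot y y = 0 by apply/eqP; rewrite eq_le y0 dot_ge0.
by rewrite subr_eq0 => /eqP ->.
Qed.

Lemma support_inj K L : compact K -> convex_set K -> K !=set0 ->
  compact L -> convex_set L -> L !=set0 -> support K = support L -> K = L.
Proof.
move=> cK vK K0 cL vL L0 KL; apply/seteqP; split => x Kx; apply: support_sub => // y.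
- by rewrite -KL; exact: dot_le_support.
- by rewrite KL; exact: dot_le_support.
Qed.

End support.

Lemma mul_powR_div (p a c : R) : 1 < p -> 0 <= a -> 0 < c ->
  a * (a / c) `^ (p - 1) = c * (a `^ p / c `^ p).
Proof.
move=> p1 a0 c0.
have ac0 : 0 <= a / c by rewrite divr_ge0// ltW.
have <- : (a / c) `^ p = a `^ p / c `^ p.
  by rewrite powRM ?invr_ge0 ?(ltW c0)// -powR_inv1 ?(ltW c0)// powRAC powR_inv1 ?powR_ge0.
have -> : (a / c) `^ p = a / c * (a / c) `^ (p - 1).
  have [->|acn0] := eqVneq (a / c) 0.
    by rewrite mul0r powR0// gt_eqF// (lt_trans ltr01).
  by rewrite -{2}(powRr1 ac0) -powRD ?acn0 ?implybT// addrC subrK.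
by rewrite mulrA mulrCA divff ?gt_eqF// mulr1.
Qed.

Section Lp_sum.
Context {n : nat} (p : R) (p1 : 1 < p).
Implicit Types (K L M : set 'rV[R]_n) (x y : 'rV[R]_n).

Lemma is_Lp_sum_unique K L M M' : is_Lp_sum p K L M -> is_Lp_sum p K L M' -> M = M'.
Proof.
move=> [[cM vM M0] hM] [[cM' vM' M'0] hM']; apply: support_inj => //.
- by exists 0.
- by exists 0.
- by apply/funext => x; rewrite hM hM'.
Qed.

Lemma is_Lp_sum_exists K L : convex_body0 K -> convex_body0 L ->
  exists M, is_Lp_sum p K L M.
Proof.
move=> [cK vK K0] [cL vL L0].
have p0 : 0 < p by rewrite (lt_trans ltr01).
have pn0 : p != 0 by rewrite gt_eqF.
have pm1 : 0 < p - 1 by rewrite subr_gt0.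
pose q := p / (p - 1).
have q0 : 0 < q by rewrite divr_gt0.
have pq : p^-1 + q^-1 = 1 by rewrite /q; field; rewrite pn0 gt_eqF.
pose f x := (support K x `^ p + support L x `^ p) `^ p^-1.
have f0 x : 0 <= f x by rewrite powR_ge0.
pose M := [set x | forall y, dot y x <= f y].
have MP x : M x <-> forall y, dot y x <= f y by [].
have M0 : M 0 by apply/MP => y; rewrite dot0r.
have vM : convex_set M.
  move=> x y t; rewrite !inE => /MP Mx /MP My; apply/MP => z.
  rewrite convE dotDr !dotZr.
  have t0 : 0 <= t%:num by [].
  have t1 : t%:num <= 1 by [].
  move: (t%:num) t0 t1 => {}t t0; rewrite -subr_ge0 => t1.
  have := ler_wpM2l t0 (Mx z); have := ler_wpM2l t1 (My z); lra.
have cM : compact M.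
  apply: bounded_closed_compact.
    pose B := \sum_i (f (delta_mx 0 i) + f (- delta_mx 0 i)).
    have B0 : 0 <= B by apply: sumr_ge0 => i _; apply: addr_ge0; exact: f0.
    exists B; split; first exact: num_real.
    move=> c Bc x /MP Mx.
    change (`|x| <= c); rewrite [leLHS]/Num.norm/= mx_normrE; apply: bigmax_le => [|[i j] _ /=].
      by rewrite (le_trans B0)// ltW.
    rewrite (ord1 i) (le_trans _ (ltW Bc))// /B (bigD1 j)//=.
    have h1 := Mx (delta_mx 0 j); have h2 := Mx (- delta_mx 0 j).
    rewrite dotC dot_delta in h1; rewrite dotNl dotC dot_delta in h2.
    have h3 : 0 <= \sum_(k < n | k != j) (f (delta_mx 0 k) + f (- delta_mx 0 k)).
      by apply: sumr_ge0 => k _; apply: addr_ge0; exact: f0.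
    have g1 := f0 (delta_mx 0 j); have g2 := f0 (- delta_mx 0 j).
    rewrite ler_norml; move: h1 h2 h3 g1 g2.
    move: (f _) (f _) (\sum_(k < n | k != j) _) (x 0 j) => F1 F2 F3 xj.
    by move=> h1 h2 h3 g1 g2; apply/andP; split; lra.
  have -> : M = \bigcap_(y in setT) (dot y @^-1` [set r | r <= f y]).
    by apply/seteqP; split => x Mx y; [move=> _; exact: (Mx y)|exact: (Mx y I)].
  apply: closed_bigI => y _; apply: preimage_closed; last exact: closed_le.
  by move=> x _; exact: continuous_dot.
exists M; split=> // y; rewrite -/(f y).
have [m [Mm -> mmax]] : exists m, [/\ M m, support M y = dot y m &
    forall l, M l -> dot y l <= dot y m].
  by apply: support_attained => //; exists 0.
apply/eqP; rewrite eq_le Mm/=.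
have [k [Kk hk _]] := support_attained y cK (ex_intro _ _ K0).
have [l [Ll hl _]] := support_attained y cL (ex_intro _ _ L0).
set a := support K y in hk *; set b := support L y in hl *.
have a0 : 0 <= a by exact: support_ge0.
have b0 : 0 <= b by exact: support_ge0.
pose S := a `^ p + b `^ p.
have S0 : 0 <= S by rewrite addr_ge0 ?powR_ge0.
have fyS : f y = S `^ p^-1 by [].
have [S_eq0|Sn0] := eqVneq S 0.
  rewrite fyS S_eq0 powR0 ?invr_eq0// -(dot0r y).
  exact: mmax.
have Sp : 0 < S by rewrite lt_neqAle eq_sym Sn0.
have fy0 : 0 < f y by rewrite fyS powR_gt0.
pose s := (a / f y) `^ (p - 1); pose t := (b / f y) `^ (p - 1).
have pq1 : (p - 1) * q = p by rewrite /q; field; rewrite gt_eqF.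
have fyp : f y `^ p = S by rewrite fyS -powRrM mulVf// powRr1.
have sq : s `^ q = a `^ p / S.
  rewrite -powRrM pq1 powRM ?invr_ge0//; congr (_ * _).
  by rewrite -[(f y)^-1]powR_inv1 // -powRrM mulrC powRrM fyp powR_inv1.
have tq : t `^ q = b `^ p / S.
  rewrite -powRrM pq1 powRM ?invr_ge0//; congr (_ * _).
  by rewrite -[(f y)^-1]powR_inv1 // -powRrM mulrC powRrM fyp powR_inv1.
have st1 : s `^ q + t `^ q = 1 by rewrite sq tq -mulrDl divff.
have Mst : M (s *: k + t *: l).
  apply/MP => z; rewrite dotDr !dotZr.
  have zk : dot z k <= support K z by exact: dot_le_support.
  have zl : dot z l <= support L z by exact: dot_le_support.
  have sup0 : 0 <= support K z by exact: support_ge0.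
  have slp0 : 0 <= support L z by exact: support_ge0.
  have := hoelder2 sup0 slp0 (powR_ge0 _ _ : 0 <= s) (powR_ge0 _ _ : 0 <= t) p0 q0 pq.
  rewrite st1 powR1 mulr1 -/(f z); apply: le_trans.
  by rewrite !(mulrC (support _ _)) lerD// ler_wpM2l// powR_ge0.
have aE : a * s = f y * (a `^ p / S) by rewrite -fyp mul_powR_div.
have bE : b * t = f y * (b `^ p / S) by rewrite -fyp mul_powR_div.
apply: le_trans (mmax _ Mst).
rewrite dotDr !dotZr -hk -hl mulrC aE (mulrC t) bE -mulrDr -mulrDl divff// mulr1.
by rewrite lexx.
Qed.

Lemma Lp_sumP K L : convex_body0 K -> convex_body0 L ->
  is_Lp_sum p K L (Lp_sum p K L).
Proof. by move=> bK bL; have /(xgetPex set0) := is_Lp_sum_exists bK bL. Qed.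

End Lp_sum.

Lemma convex_body0_set1 n : convex_body0 [set (0 : 'rV[R]_n)].
Proof.
split=> //; first exact: compact_set1.
move=> x y t; rewrite !inE /= => -> ->.
by rewrite convE !scaler0 addr0.
Qed.

Lemma convex_body0_segment0 n (u : 'rV[R]_n) : convex_body0 (segment0 u).
Proof.
split.
- apply: continuous_compact; last exact: segment_compact.
  by apply: continuous_subspaceT => t; apply: cvgZ; [exact: cvg_id|exact: cvg_cst].
- move=> x y t; rewrite !inE => -[a /= + <-] [b /= + <-].
  rewrite !in_itv/= => /andP[a0 a1] /andP[b0 b1].
  exists (t%:num * a + (1 - t%:num) * b); last by rewrite convE !scalerA -scalerDl.
  have t0 : 0 <= t%:num by [].
  have t1 : t%:num <= 1 by [].
  move: (t%:num) t0 t1 => {}t t0 t1.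
  rewrite /= in_itv/=; apply/andP; split; nra.
- by exists 0; rewrite ?scale0r//= in_itv/= lexx ler01.
Qed.

Lemma convex_body0_opp n (K : set 'rV[R]_n) : convex_body0 K ->
  convex_body0 (-%R @` K).
Proof.
move=> [cK vK K0]; split.
- apply: continuous_compact => //.
  by apply: continuous_subspaceT => x; exact: oppr_continuous.
- move=> x y t; rewrite !inE => -[a Ka <-] [b Kb <-].
  exists (t%:num *: a + (1 - t%:num) *: b); last by rewrite convE !scalerN opprD.
  exact: convex_comb.
- by exists 0; rewrite ?oppr0.
Qed.

(* The set {0} is neutral for the L_p-sum. *)
Definition Lp_sum_segments n m (p : R) (u : 'I_m -> 'rV[R]_n) : set 'rV[R]_n :=
  \big[Lp_sum p / [set 0]]_(i < m) segment0 (u i).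

Lemma convex_body0_Lp_sum_segments n m (p : R) (u : 'I_m -> 'rV[R]_n) :
  1 < p -> convex_body0 (Lp_sum_segments p u).
Proof.
move=> p1; rewrite /Lp_sum_segments.
elim/big_rec: _ => [|i K _ bK]; first exact: convex_body0_set1.
by have [] := Lp_sumP p1 (convex_body0_segment0 (u i)) bK.
Qed.

Definition in_hyperplane n (Z : set 'rV[R]_n) : Prop :=
  exists a : 'rV[R]_n, exists b : R, a != 0 /\ Z `<=` [set x | dot a x = b].

Definition lq_ball n (q : R) : set 'rV[R]_n :=
  [set x | \sum_i `|x 0 i| `^ q <= 1].
Arguments lq_ball n q : clear implicits.

Definition orth_proj n (theta : 'rV[R]_n) (x : 'rV[R]_n) : 'rV[R]_n :=
  x - (dot x theta / dot theta theta) *: theta.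

(* The rows of [Q] form an orthonormal basis of the hyperplane orthogonal to
   [theta]. *)
Definition orthonormal_frame n (theta : 'rV[R]_n.+1) (Q : 'M[R]_(n, n.+1)) : Prop :=
  Q *m Q^T = 1%:M /\ Q *m theta^T = 0.

Lemma mulmx_trE n (x y : 'rV[R]_n) : x *m y^T = (dot x y)%:M.
Proof.
apply/matrixP => i j; rewrite !ord1 !mxE eqxx mulr1n /dot.
by apply: eq_bigr => k _; rewrite mxE.
Qed.

(* Householder reflection exchanging [theta] and the last basis vector. *)
Lemma orthonormal_frame_exists n (theta : 'rV[R]_n.+1) :
  dot theta theta = 1 -> exists Q, orthonormal_frame theta Q.
Proof.
move=> theta1.
have [H [Hsym HH Htheta]] : exists H : 'M[R]_n.+1,
    [/\ H^T = H, H *m H = 1%:M & H *m theta^T = (delta_mx 0 ord_max)^T].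
  set e : 'rV[R]_n.+1 := delta_mx 0 ord_max.
  have e1 : dot e e = 1 by rewrite dot_delta mxE !eqxx.
  pose w := theta - e.
  have [w0|wn0] := eqVneq w 0.
    exists 1%:M; rewrite trmx1 !mul1mx; split=> //.
    by move/eqP: w0; rewrite subr_eq0 => /eqP ->.
  pose k := dot w w.
  have kE : k = 2 - 2 * dot theta e.
    rewrite /k /w dotBl !dotDr !dotNr theta1 e1 (dotC e); ring.
  have k0 : k != 0 by apply/eqP => /dot_eq0 /eqP; apply/negP.
  have wt : dot w theta = k / 2.
    by rewrite /w dotBl theta1 (dotC e) kE; field.
  exists (1%:M - (2 / k) *: (w^T *m w)); split.
  - by rewrite linearB /= linearZ /= trmx1 trmx_mul trmxK.
  - have PP : w^T *m w *m (w^T *m w) = k *: (w^T *m w).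
      by rewrite mulmxA -(mulmxA w^T) mulmx_trE -/k mul_mx_scalar scalemxAl.
    move: (w^T *m w) PP => P PP.
    rewrite mulmxBl !mulmxBr !mulmx1 mul1mx -!scalemxAl -scalemxAr PP !scalerA.
    have -> : 2 / k * (2 / k) * k = 2 / k + 2 / k by field.
    by rewrite scalerDl opprB addrK subrK.
  - rewrite mulmxBl mul1mx -scalemxAl -mulmxA mulmx_trE wt mul_mx_scalar scalerA.
    have -> : 2 / k * (k / 2) = 1 by field.
    by rewrite scale1r /w linearB /= opprB addrC subrK.
exists (rowsub (widen_ord (leqnSn n)) H); split.
  apply/matrixP => i j.
  have : (H *m H) (widen_ord (leqnSn n) i) (widen_ord (leqnSn n) j) = (i == j)%:R.
    by rewrite HH mxE.
  rewrite !mxE => <-; apply: eq_bigr => l _; rewrite !mxE; congr (_ * _).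
  by rewrite -{1}Hsym mxE.
apply/matrixP => i j; rewrite ord1 !mxE.
have : (H *m theta^T) (widen_ord (leqnSn n) i) 0 = 0.
  by rewrite Htheta !mxE eqxx /= -val_eqE /= ltn_eqF.
by rewrite mxE => {2}<-; apply: eq_bigr => l _; rewrite !mxE.
Qed.

(* [n]-dimensional Lebesgue measure on the hyperplane orthogonal to [theta],
   which is identified isometrically with R^n by means of an orthonormal
   basis; orthogonal invariance makes the choice of the basis irrelevant. *)
Definition hyperplane_volume n (theta : 'rV[R]_n.+1) (S : set 'rV[R]_n.+1) : \bar R :=
  let Q := xget 0 (orthonormal_frame theta) in
  volume [set v : 'rV[R]_n | S (v *m Q)].

Definition diagonal_dir n : 'rV[R]_n.+1 := const_mx (Num.sqrt n.+1%:R)^-1.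

Lemma dot_diagonal_dir n : dot (diagonal_dir n) (diagonal_dir n) = 1.
Proof.
rewrite /dot (eq_bigr (fun=> n.+1%:R^-1)) => [|i _]; last first.
  by rewrite !mxE -invfM -expr2 sqr_sqrtr.
by rewrite sumr_const card_ord -[X in X *+ _]mul1r -mulrnAr -mulr_natl divff ?mul1r ?pnatr_eq0.
Qed.

(* Both sets are bounded, so that [fine] loses nothing. *)
Definition left_constant n (q : R) : R :=
  2 ^+ n *
  fine (hyperplane_volume (diagonal_dir n)
          (orth_proj (diagonal_dir n) @` lq_ball n.+1 q)) /
  (Num.sqrt n.+1%:R * fine (volume (lq_ball n q))).

End Euclidean.
Arguments diagonal_dir {R} n.

(* Main.v *)
From HB Require Import structures.
Require Import Defs.
From mathcomp Require Import all_boot all_order all_algebra.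
From mathcomp Require Import all_classical all_reals all_analysis.
From mathcomp Require Import measurable_realfun.
From mathcomp Require fingroup perm.
From mathcomp Require Import ring lra.

Set Implicit Arguments.
Unset Strict Implicit.
Unset Printing Implicit Defensive.
Import Order.TTheory GRing.Theory Num.Theory.
Import numFieldNormedType.Exports.

Local Open Scope classical_set_scope.
Local Open Scope ring_scope.

(** The matrix [U] with rows [u i] maps [R^(n+1)] to [R^n]. Hoelder's inequality
    and its equality case give the support functions of the images under
    [x |-> x *m U] of the unit ball [B] of [l_q] and of its part [B+] with
    nonnegative coordinates, so that [Z] is the image of [B+] and
    [Z (+)_p -Z] the image of [B] ([Lp_sum_segmentsE], [Lp_sum_oppE]).
    The rows of [U] are dependent. If the relation between them leaves [n]
    independent rows, a linear change of variables in the target turns the map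
    into [(t, x) |-> x - t w], the projection along the line spanned by
    [W := (1, w)]; otherwise everything lies in a hyperplane
    ([zonotope_cases]). Thus the theorem compares the shadows of [B] and [B+]
    along a line.

    The volume of a shadow is read off from the derivative [D_W g] of
    [g x = \sum_i |x_i|^q] in the direction [W]. On every line parallel to [W]
    the function [g] is convex, so its total variation on [g <= 1] is
    [2 (1 - min g)^+]; integrating over the lines, the homogeneity of [g] yields
    [\int_(g <= 1) |D_W g| = 2 kappa |shadow of B|] with a constant [kappa]
    depending on [n] and [q] only ([crofton]). The same holds if [g] is made
    asymmetric by dividing the negative coordinates by [r] in (0, 1], which
    interpolates between [B] for [r = 1] and [B+] for [r -> 0].
    Splitting the integral into orthants and rescaling the negative coordinates
    expresses it by the norm [N c := \int |\sum_i c_i q x_i^(q-1)|] over the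
    positive part of the ball ([flux_decomposition]). For [r = 1] this gives
      [2 kappa |shadow of B| = M W := \sum_eps N (eps W)],
    with [eps] running over all choices of signs; in the limit [r -> 0] only the
    choices with at most one minus sign survive, whence
      [2 kappa |shadow of B+| = N W + \sum_i |W_i| N e_i]
    ([vol_sym_zono], [vol_zono]).

    The upper bound is now pointwise: [2 \sum_eps |\sum_i eps_i a_i|] is at most
    [2^(n+1) (|\sum_i a_i| + \sum_i |a_i|)] ([sum_signed_le]), strictly so on a
    box of points when two of the [W_i] have the same sign
    ([sign_norm_lt]). As [W_0 = 1], equality forces [w] to be nonpositive with
    at most one nonzero entry, that is, the remaining segment is a multiple of
    one of the [n] others and merges with it ([Lp_sum_segments_merge]).

    For the lower bound, [N W <= \sum_i |W_i| N e_i], while [M] is a norm that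
    is invariant under permutations and changes of signs; averaging [W] over the
    cyclic shifts gives [M W >= (\sum_i |W_i|) / (n+1) * M (1, ..., 1)]
    ([sign_norm_average]). So the quotient of the two volumes is smallest
    for [W = (1, ..., 1)], where both estimates are equalities. The shadow along
    the diagonal is, up to a factor, the orthogonal projection of [B]
    ([vol_proj_lq_ball]); this identifies the constant and shows that it is
    optimal. *)

(** * Lebesgue measure on row vectors *)

Section Borel.
Context {R : realType}.

Definition matrix_display : measure_display. Proof. exact: default_measure_display. Qed.

(** The Borel sigma-algebra. It makes row vectors available as the carrier of
    measures and of products, where the tuples of the definition of [volume]
    are not a vector space. *)
HB.instance Definition _ m n := @isMeasurable.Build matrix_display 'M[R]_(m, n)
  <<s @open 'M[R]_(m, n) >> (@sigma_algebra0 _ _ _) (@sigma_algebraC _ _) (@sigma_algebra_bigcup _ _ _).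

Lemma open_measurable_mx m n (A : set 'M[R]_(m, n)) : open A -> measurable A.
Proof. by move=> oA; exact: sub_sigma_algebra. Qed.

Lemma closed_measurable_mx m n (A : set 'M[R]_(m, n)) : closed A -> measurable A.
Proof. by move/closed_openC/open_measurable_mx/measurableC; rewrite setCK. Qed.

Lemma compact_measurable_mx m n (A : set 'M[R]_(m, n)) : compact A -> measurable A.
Proof. by move=> /compact_closed cA; apply: closed_measurable_mx; apply: cA; exact: norm_hausdorff. Qed.

(** Second countability in explicit form: an open set is the union of the
    rational cubes contained in it. The cubes are indexed by a countable type,
    which is what measurability needs. *)
Lemma open_ratball m n (A : set 'M[R]_(m, n)) : open A ->
  A = \bigcup_(c : 'M[rat]_(m, n) * rat)
        [set x : 'M[R]_(m, n) | (forall i j, `|ratr (c.1 i j) - x i j| < ratr c.2 :> R) /\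
           (forall y : 'M[R]_(m, n), (forall i j, `|ratr (c.1 i j) - y i j| < ratr c.2) -> A y)].
Proof.
move=> oA; apply/seteqP; split; last by move=> x [c _ [/= h]]; apply.
move=> x Ax; have /nbhs_ballP[e /= e0 xeA] : nbhs x A by exact: open_nbhs_nbhs.
have [q] := rat_in_itvoo (divr_gt0 e0 (ltr0n R 2)); rewrite in_itv/= => /andP[q0 qe].
have /choice[f fP] : forall ij : 'I_m * 'I_n, exists c : rat,
    ratr c \in `]x ij.1 ij.2 - ratr q, x ij.1 ij.2 + ratr q[.
  by move=> ij; apply: rat_in_itvoo; rewrite ltrD2l; lra.
exists (\matrix_(i, j) f (i, j), q) => //=.
have xc i j : `|ratr ((\matrix_(i, j) f (i, j)) i j) - x i j| < ratr q.
  by rewrite mxE; have := fP (i, j); rewrite in_itv/= ltr_norml => /andP[? ?]; apply/andP; split; lra.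
split => [//|y yc]; apply: xeA; split => // i j.
have := xc i j; have := yc i j; rewrite /ball/= !ltr_norml => /andP[? ?] /andP[? ?].
apply/andP; split; lra.
Qed.

(** By [open_ratball] the preimage of an open set is a countable union of finite
    intersections of preimages of intervals under the coordinates. *)
Lemma measurable_fun_mx d (X : measurableType d) m n (f : X -> 'M[R]_(m, n)) :
  (forall i j, measurable_fun [set: X] (fun x => f x i j)) ->
  measurable_fun [set: X] f.
Proof.
move=> mf; apply: (@measurability _ _ _ _ _ _ (@open 'M[R]_(m, n)) erefl).
move=> _ [U oU <-].
rewrite setTI (open_ratball oU) preimage_bigcup.
apply: countable_bigcupT_measurable => // c.
have [cU|cU] := pselect (forall y : 'M[R]_(m, n), (forall i j, `|ratr (c.1 i j) - y i j| < ratr c.2) -> U y); last first.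
  rewrite (_ : _ @^-1` _ = set0)//; apply/seteqP; split => // x [] //.
rewrite (_ : _ @^-1` _ = \bigcap_(ij in [set: 'I_m * 'I_n])
    ((fun x => f x ij.1 ij.2) @^-1` [set r | `|ratr (c.1 ij.1 ij.2) - r| < ratr c.2])); last first.
  apply/seteqP; split => x /=.
    by move=> [h _] ij _; exact: h.
  by move=> h; split => // i j; exact: (h (i, j)).
apply: fin_bigcap_measurable => // ij _; rewrite -[X in measurable X]setTI; apply: mf => //.
rewrite (_ : [set r | _] = ball (ratr (c.1 ij.1 ij.2) : R) (ratr c.2))//.
by rewrite ball_itv; exact: measurable_itv.
Qed.

Lemma measurable_coord m n i j : measurable_fun [set: 'M[R]_(m, n)] (fun x => x i j).
Proof.
apply: (measurability _ (RGenOpens.measurableE R)).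
move=> _ [_ [a [b ->] <-]].
rewrite setTI; apply: open_measurable_mx; apply: open_comp => [x _|]; last exact: interval_open.
exact: coord_continuous.
Qed.

Definition rvec n (t : n.-tuple (measurableTypeR R)) : 'rV[R]_n := \row_i tnth t i.

Lemma measurable_rvec n : measurable_fun setT (@rvec n).
Proof.
apply: measurable_fun_mx => i j; under eq_fun do rewrite mxE; exact: measurable_tnth.
Qed.

Definition leb n : set 'rV[R]_n -> \bar R := pushforward (lebesgue_tuple n) (@rvec n).
Arguments leb : clear implicits.

Lemma volumeE n (A : set 'rV[R]_n) : volume A = leb n A.
Proof. by []. Qed.

Lemma leb_preimage n (A : set 'rV[R]_n) : measurable A -> measurable (@rvec n @^-1` A).
Proof. by move=> mA; rewrite -[X in measurable X]setTI; exact: measurable_rvec. Qed.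

Lemma leb0 n : leb n set0 = 0%E.
Proof. by rewrite /leb /pushforward preimage_set0 measure0. Qed.

Lemma leb_ge0 n A : (0 <= leb n A)%E.
Proof. by rewrite /leb /pushforward; exact: measure_ge0. Qed.

Lemma leb_sigma_additive n : semi_sigma_additive (leb n).
Proof.
move=> F mF tF mUF; rewrite /leb /pushforward preimage_bigcup.
apply: measure_semi_sigma_additive.
- by move=> i; exact: leb_preimage.
- apply/trivIsetP => /= i j _ _ ij; rewrite -preimage_setI.
  by move/trivIsetP : tF => /(_ _ _ _ _ ij) ->//; rewrite preimage_set0.
- by rewrite -preimage_bigcup; exact: leb_preimage.
Qed.

HB.instance Definition _ n := isMeasure.Build _ 'rV[R]_n R (leb n)
  (leb0 n) (@leb_ge0 n) (@leb_sigma_additive n).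

Lemma leb_box n (A : 'I_n -> set R) : (forall i, measurable (A i)) ->
  leb n [set x | forall i, A i (x 0 i)] = (\prod_i lebesgue_measure (A i))%E.
Proof.
move=> mA; rewrite -lebesgue_tuple_box// /leb /pushforward; congr (lebesgue_tuple _ _).
by apply/seteqP; split => t /= h i; have := h i; rewrite mxE.
Qed.

Lemma leb_sigma_finite n : sigma_finite setT (leb n).
Proof.
exists (fun k => [set x : 'rV[R]_n | forall i, `[- k%:R, k%:R]%classic (x 0 i)]).
  apply/esym/seteqP; split => // x _.
  exists (Num.bound (\sum_i `|x 0 i|)) => //= i; rewrite in_itv/= -ler_norml.
  apply: le_trans (ltW (archi_boundP _)); last exact: sumr_ge0.
  by rewrite (bigD1 i)//= lerDl sumr_ge0.
move=> k; split.
  rewrite (_ : [set x | _] = \bigcap_(i in [set: 'I_n])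
    ((fun x : 'rV[R]_n => x 0 i) @^-1` `[- k%:R, k%:R])); last first.
    by apply/seteqP; split => x /= h i; [move=> _; exact: h|exact: (h i)].
  apply: fin_bigcap_measurable => // i _; rewrite -[X in measurable X]setTI.
  exact: measurable_coord.
rewrite (leb_box (A := fun=> `[- k%:R, k%:R]%classic))//.
rewrite -ge0_fin_numE; last exact: prode_ge0.
elim/big_ind: _ => // [x y x0 y0|i _]; first exact: fin_numM.
by rewrite lebesgue_measure_itv/=; case: ifP.
Qed.

HB.instance Definition _ n := Measure_isSigmaFinite.Build _ _ _ (leb n)
  (@leb_sigma_finite n).

Local Notation mu := (@lebesgue_measure R).

Definition cons_rv n (x : R) (v : 'rV[R]_n) : 'rV[R]_n.+1 := row_mx (x%:M : 'M[R]_1) v.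

Lemma measurable_cons_rv n :
  measurable_fun [set: R * 'rV[R]_n] (fun z => cons_rv z.1 z.2).
Proof.
apply: measurable_fun_mx => i j; rewrite ord1 {i} /cons_rv.
under eq_fun do rewrite mxE.
case: (@fintype.split 1 n j) => k.
  under eq_fun do rewrite mxE ord1 eqxx mulr1n.
  exact: measurable_fst.
exact: (measurableT_comp (measurable_coord _ _) measurable_snd).
Qed.

Lemma rvec_cons n x (t : n.-tuple R) : rvec [tuple of x :: t] = cons_rv x (rvec t).
Proof.
apply/rowP => j; rewrite /cons_rv !mxE.
case: splitP => k jk; rewrite !mxE.
  rewrite !ord1 eqxx mulr1n (_ : j = ord0) ?tnth0//; apply: val_inj => /=.
  by rewrite jk ord1.
rewrite (_ : j = lift ord0 k) ?tnthS//; exact: val_inj.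
Qed.

Local Open Scope ereal_scope.

(** Tonelli on the tuple side, where the measure is a product by definition,
    transported to row vectors through [rvec]. *)
Lemma integral_leb_pair n (F : 'rV[R]_n.+1 -> \bar R) :
  measurable_fun setT F -> (forall x, 0 <= F x) ->
  \int[leb n.+1]_x F x = \int[mu \x leb n]_z F (cons_rv z.1 z.2).
Proof.
move=> mF F0.
rewrite (@ge0_integral_pushforward _ _ _ _ R (@rvec n.+1) (@measurable_rvec n.+1))//.
rewrite preimage_setT/=.
rewrite (@ge0_integral_pushforward _ _ _ _ R (@cons_pair R n) (@measurable_cons_pair R n))//; last first.
  by apply: measurableT_comp mF _; exact: measurable_rvec.
rewrite preimage_setT.
rewrite fubini_tonelli1//=; last first.
  apply: measurableT_comp (measurableT_comp mF _) _; [exact: measurable_rvec|exact: measurable_cons_pair].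
rewrite fubini_tonelli1//=; last first.
  by apply: (measurableT_comp mF); exact: measurable_cons_rv.
apply: eq_integral => x _; rewrite /fubini_F/=.
rewrite [RHS](@ge0_integral_pushforward _ _ _ _ R (@rvec n) (@measurable_rvec n))//=; last first.
  exact: (measurableT_comp mF (measurableT_comp (@measurable_cons_rv n) (measurable_pair1 x))).
by rewrite preimage_setT; apply: eq_integral => t _ /=; rewrite /cons_pair/= rvec_cons.
Qed.

Lemma measurable_cons_r n (F : 'rV[R]_n.+1 -> \bar R) x : measurable_fun setT F ->
  measurable_fun setT (fun v => F (cons_rv x v)).
Proof.
move=> mF; apply: (measurableT_comp mF).
exact: (measurableT_comp (@measurable_cons_rv n) (measurable_pair1 x)).
Qed.

Lemma measurable_cons_l n (F : 'rV[R]_n.+1 -> \bar R) v : measurable_fun setT F ->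
  measurable_fun setT (fun x => F (cons_rv x v)).
Proof.
move=> mF; apply: (measurableT_comp mF).
exact: (measurableT_comp (@measurable_cons_rv n) (measurable_pair2 v)).
Qed.

Lemma integral_leb_cons n (F : 'rV[R]_n.+1 -> \bar R) :
  measurable_fun setT F -> (forall x, 0 <= F x) ->
  \int[leb n.+1]_x F x = \int[mu]_x \int[leb n]_v F (cons_rv x v).
Proof.
move=> mF F0; rewrite integral_leb_pair// fubini_tonelli1//.
by apply: (measurableT_comp mF); exact: measurable_cons_rv.
Qed.

Lemma integral_leb_cons2 n (F : 'rV[R]_n.+1 -> \bar R) :
  measurable_fun setT F -> (forall x, 0 <= F x) ->
  \int[leb n.+1]_x F x = \int[leb n]_v \int[mu]_x F (cons_rv x v).
Proof.
move=> mF F0; rewrite integral_leb_pair// fubini_tonelli2//.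
by apply: (measurableT_comp mF); exact: measurable_cons_rv.
Qed.

End Borel.
Arguments leb {R} n _.

(** * Linear change of variables *)

Section Linear.
Context {R : realType}.
Local Notation mu := (@lebesgue_measure R).
Local Open Scope ereal_scope.

(** Half-open intervals determine the measure; a negative factor is reduced to a
    positive one by the reflection invariance of Lebesgue measure. *)
Lemma lebesgue_measure_affine (a b : R) (A : set R) : a != 0%R -> measurable A ->
  mu A = `|a|%:E * mu [set x | A (a * x + b)%R].
Proof.
move=> a0 mA.
wlog a_gt0 : a b a0 A mA / (0 < a)%R => [hw|].
  have [|a_lt0] := ltrP 0%R a; first exact: hw.
  have na : (0 < - a)%R by rewrite oppr_gt0 lt_neqAle a0.
  rewrite (hw (- a)%R b) ?gt_eqF// normrN; congr (_ * _).
  rewrite -lebesgue_measureN//; last first.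
    rewrite -[X in measurable X]setTI.
    have : measurable_fun setT (fun x : R => - a * x + b)%R.
      by apply: measurable_funD => //; exact: measurable_funM.
    exact.
  by rewrite /pushforward; congr (mu _); apply/seteqP; split => x /=; rewrite mulrNN.
rewrite gtr0_norm//.
have mf : measurable_fun [set: R] (fun x : R => a * x + b : measurableTypeR R)%R.
  by apply: measurable_funD => //; exact: measurable_funM.
unshelve epose (m := mscale (NngNum (ltW a_gt0)) (pushforward mu (fun x : R => a * x + b : measurableTypeR R)%R) : {measure set (measurableTypeR R) -> \bar R}); first exact: mf.
rewrite (@lebesgue_measure_unique R m)// => _ [[x y] _ <-].
change (mu `]x, y]%classic = a%:E * mu ((fun z : R => a * z + b)%R @^-1` `]x, y])).
rewrite (_ : _ @^-1` _ = `](x - b) / a, (y - b) / a]%classic)%R; last first.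
  apply/seteqP; split => z /=; rewrite !in_itv/= ltr_pdivrMr// ler_pdivlMr// => /andP[? ?]; apply/andP; lra.
rewrite !lebesgue_measure_itv/= !lte_fin ltr_pM2r ?invr_gt0// ltrD2r.
case: ifPn => _; rewrite ?mule0// -!EFinD -EFinM; congr (_%:E); field.
by rewrite gt_eqF.
Qed.

Lemma integral_affine (a b : R) (F : R -> \bar R) : a != 0%R ->
  measurable_fun setT F -> (forall x, 0 <= F x) ->
  \int[mu]_x F x = `|a|%:E * \int[mu]_x F (a * x + b)%R.
Proof.
move=> a0 mF F0.
have mf : measurable_fun [set: R] (fun x : R => a * x + b : measurableTypeR R)%R.
  by apply: measurable_funD => //; exact: measurable_funM.
unshelve epose (pm := pushforward mu (fun x : R => a * x + b : measurableTypeR R)%R : {measure set (measurableTypeR R) -> \bar R}); first exact: mf.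
transitivity (\int[mscale (NngNum (normr_ge0 a)) pm]_x F x).
  apply: eq_measure_integral => //= A mA _; rewrite /mscale/= /pushforward.
  exact: lebesgue_measure_affine.
rewrite ge0_integral_mscale//=; congr (_ * _).
by rewrite ge0_integral_pushforward.
Qed.

Lemma cons_rv0 n (x : R) (v : 'rV[R]_n) : (cons_rv x v) 0%R 0%R = x.
Proof. by rewrite /cons_rv mxE; case: splitP => // k _; rewrite ord1 mxE eqxx. Qed.

Lemma cons_rvS n (x : R) (v : 'rV[R]_n) i : (cons_rv x v) 0%R (lift ord0 i) = v 0%R i.
Proof.
rewrite /cons_rv mxE; case: splitP => k /=; first by rewrite ord1.
by rewrite /bump => /eqP; rewrite eqSS => /eqP/val_inj ->.
Qed.

Lemma measurable_inner n (F : 'rV[R]_n.+1 -> \bar R) : measurable_fun setT F ->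
  (forall x, 0 <= F x) -> measurable_fun setT (fun x : R => \int[leb n]_v F (cons_rv x v)).
Proof.
move=> mF F0.
apply: (@measurable_fun_fubini_tonelli_F _ _ (measurableTypeR R) 'rV[R]_n R (leb n)
    (fun z => F (cons_rv z.1 z.2))) => //.
exact: (measurableT_comp mF (@measurable_cons_rv R n)).
Qed.

Definition behead_rv n (x : 'rV[R]_n.+1) : 'rV[R]_n := \row_i x 0%R (lift ord0 i).

Lemma cons_rvP n (x : 'rV[R]_n.+1) : x = cons_rv (x 0%R 0%R) (behead_rv x).
Proof.
apply/rowP => i; case: (unliftP ord0 i) => [j ->|->]; first by rewrite cons_rvS mxE.
by rewrite cons_rv0.
Qed.

Lemma rV0E (x : 'rV[R]_0) : x = 0%R.
Proof. exact: thinmx0. Qed.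

Lemma cons_rvD n (x y : R) (u v : 'rV[R]_n) :
  (cons_rv x u + cons_rv y v = cons_rv (x + y) (u + v))%R.
Proof.
apply/rowP => i; rewrite mxE; case: (unliftP ord0 i) => [j ->|->].
  by rewrite !cons_rvS mxE.
by rewrite !cons_rv0.
Qed.

Lemma measurable_addr m n (v : 'M[R]_(m, n)) : measurable_fun setT (fun x : 'M[R]_(m, n) => x + v)%R.
Proof.
apply: measurable_fun_mx => i j; under eq_fun do rewrite mxE.
by apply: measurable_funD => //; exact: measurable_coord.
Qed.

Lemma measurable_mulmx m n p (M : 'M[R]_(n, p)) :
  measurable_fun setT (fun x : 'M[R]_(m, n) => x *m M)%R.
Proof.
apply: measurable_fun_mx => i j; under eq_fun do rewrite mxE.
by apply: measurable_sum => k; apply: measurable_funM => //; exact: measurable_coord.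
Qed.

Lemma integral_leb_translate n (v : 'rV[R]_n) (F : 'rV[R]_n -> \bar R) :
  measurable_fun setT F -> (forall x, 0 <= F x) ->
  \int[leb n]_x F (x + v)%R = \int[leb n]_x F x.
Proof.
elim: n v F => [|n IHn] v F mF F0.
  by apply: eq_integral => x _; rewrite (rV0E v) addr0.
rewrite (cons_rvP v); move: (v _ _) (behead_rv v) => y w.
have mFv : measurable_fun setT (fun z : 'rV[R]_n.+1 => F (z + cons_rv y w)%R).
  exact: (measurableT_comp mF (measurable_addr _)).
rewrite (integral_leb_cons mFv (fun z => F0 _)) (integral_leb_cons mF F0).
under eq_integral => x _.
  under eq_integral do rewrite cons_rvD.
  rewrite (IHn w (fun z => F (cons_rv (x + y)%R z)))//; last exact: measurable_cons_r.
  over.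
rewrite [RHS](@integral_affine 1 y) ?oner_neq0//; last 2 first.
- exact: measurable_inner.
- by move=> x; exact: integral_ge0.
rewrite normr1 mul1e; apply: eq_integral => x _.
by rewrite mul1r.
Qed.

(** The set of matrices for which the change of variables formula holds is
    closed under products, which reduces the formula to triangular matrices. *)
Definition lin_change n (M : 'M[R]_n) := forall F : 'rV[R]_n -> \bar R,
  measurable_fun setT F -> (forall x, 0 <= F x) ->
  \int[leb n]_x F x = `|\det M|%:E * \int[leb n]_x F (x *m M)%R.

Lemma lin_change1 n : lin_change (1%:M : 'M[R]_n).
Proof.
move=> F mF F0; rewrite det1 normr1 mul1e.
by apply: eq_integral => x _; rewrite mulmx1.
Qed.

Lemma lin_changeM n (M N : 'M[R]_n) : lin_change M -> lin_change N -> lin_change (M *m N)%R.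
Proof.
move=> hM hN F mF F0; rewrite det_mulmx normrM mulrC EFinM -muleA.
rewrite hN//; congr (_ * _); rewrite hM//; last exact: (measurableT_comp mF (measurable_mulmx _)).
by under eq_integral do rewrite -mulmxA.
Qed.

(** Integrate first over the last [n] coordinates: for a fixed first coordinate
    the matrix acts on them by [T] followed by a translation. *)
Lemma lin_change_upper n (a : R) (v : 'rV[R]_n) (T : 'M[R]_n) : a != 0%R -> lin_change T ->
  lin_change (block_mx (a%:M : 'M[R]_1) v 0%R T : 'M[R]_n.+1).
Proof.
move=> a0 hT F mF F0.
rewrite [\det _](det_ublock (a%:M : 'M[R]_1) v T) det_scalar1.
set M := block_mx _ _ _ _.
have mFM : measurable_fun setT (fun z => F (z *m M)%R).
  exact: (measurableT_comp mF (measurable_mulmx _)).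
rewrite (integral_leb_cons mFM (fun z => F0 _)) (integral_leb_cons mF F0) /M => {mFM}.
have E x (w : 'rV[R]_n) : (cons_rv x w *m (block_mx (a%:M : 'M[R]_1) v 0 T : 'M[R]_n.+1) =
    cons_rv (a * x + 0) (w *m T + x *: v))%R.
  rewrite /cons_rv [LHS](@mul_row_block _ 1 1 n 1 n) mulmx0 addr0 -scalar_mxM mul_scalar_mx.
  by rewrite addr0 mulrC addrC.
under [X in _ = _ * X]eq_integral => x _ do under eq_integral do rewrite E.
rewrite (@integral_affine a 0 _ a0 (measurable_inner mF F0)); last first.
  by move=> x; exact: integral_ge0.
rewrite normrM EFinM -muleA; congr (_ * _).
rewrite -ge0_integralZl//; last 2 first.
- apply: (@measurable_fun_fubini_tonelli_F _ _ (measurableTypeR R) 'rV[R]_n R (leb n)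
    (fun z => F (cons_rv (a * z.1 + 0) (z.2 *m T + z.1 *: v))%R)) => //.
  apply: (measurableT_comp mF).
  rewrite (_ : (fun z => _) = (fun z => cons_rv z.1 z.2 *m (block_mx (a%:M : 'M[R]_1) v 0 T : 'M[R]_n.+1))%R).
    exact: (measurableT_comp (measurable_mulmx _) (@measurable_cons_rv R n)).
  by apply/funext => z; rewrite E.
- by move=> x _; exact: integral_ge0.
apply: eq_integral => x _.
rewrite -(integral_leb_translate (x *: v)%R)//; last exact: measurable_cons_r.
rewrite hT//; exact: (measurableT_comp (measurable_cons_r _ mF) (measurable_addr _)).
Qed.

(** Integrate first over the first coordinate, on which the shear acts by a
    translation. *)
Lemma lin_change_lower n (c : 'cV[R]_n) :
  lin_change (block_mx (1%:M : 'M[R]_1) 0%R c 1%:M : 'M[R]_n.+1).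
Proof.
move=> F mF F0.
rewrite [\det _](det_lblock (1%:M : 'M[R]_1) c 1%:M) !det1 mulr1 normr1 mul1e.
set M := block_mx _ _ _ _.
have mFM : measurable_fun setT (fun z => F (z *m M)%R).
  exact: (measurableT_comp mF (measurable_mulmx _)).
rewrite (integral_leb_cons2 mFM (fun z => F0 _)) (integral_leb_cons2 mF F0) /M => {mFM}.
have E x (w : 'rV[R]_n) : (cons_rv x w *m (block_mx (1%:M : 'M[R]_1) 0 c 1%:M : 'M[R]_n.+1) =
    cons_rv (1 * x + (w *m c) 0 0) w)%R.
  rewrite /cons_rv [LHS](@mul_row_block _ 1 1 n 1 n) mulmx0 add0r !mulmx1 mul1r.
  congr (@row_mx _ 1 1 n _ _); rewrite [RHS]raddfD; congr (_ + _)%R; exact: mx11_scalar.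
apply: eq_integral => w _; under [RHS]eq_integral do rewrite E.
rewrite (@integral_affine 1 ((w *m c) 0 0)%R) ?oner_neq0//; last exact: measurable_cons_l.
by rewrite normr1 mul1e.
Qed.

(** Gaussian elimination: a unit whose corner entry is nonzero is a lower shear
    times a block upper triangular matrix with an invertible block, and a shear
    makes the corner entry nonzero. *)
Lemma lin_change_unit n (M : 'M[R]_n) : M \in unitmx -> lin_change M.
Proof.
elim: n M => [|n IHn] M uM.
  by rewrite (_ : M = 1%:M)%R; [exact: lin_change1|apply/matrixP => -[]].
(* Schur complement of the corner entry. *)
have key (N : 'M[R]_n.+1) : N \in unitmx -> N 0%R 0%R != 0%R -> lin_change N.
  move=> uN; rewrite -[N](@submxK _ 1 n 1 n).
  set a := ulsubmx _; set v := ursubmx _; set c := dlsubmx _; set T := drsubmx _ => N0.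
  have {}N0 : a 0%R 0%R != 0%R.
    rewrite -(@block_mxEul _ 1 n 1 n a v c T); move: N0; congr (is_true (block_mx a v c T _ _ != 0%R)); exact: val_inj.
  pose b := (a 0 0)%R.
  pose S := (T - b^-1 *: (c *m v))%R.
  have NE : (N = block_mx (1%:M : 'M[R]_1) 0 (b^-1 *: c) 1%:M *m block_mx (b%:M : 'M[R]_1) v 0 S :> 'M[R]_(1 + n))%R.
    rewrite -[N](@submxK _ 1 n 1 n) -/a -/v -/c -/T mulmx_block !mul1mx !mulmx0 !mul0mx !addr0.
    rewrite mul_mx_scalar scalerA divff// scale1r -scalemxAl /S (addrC (b^-1 *: (c *m v))%R) subrK.
    congr (@block_mx _ 1 n 1 n _ _ _ _); exact: mx11_scalar.
  rewrite (_ : block_mx a v c T = N); last by rewrite -[N](@submxK _ 1 n 1 n).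
  rewrite NE; apply: lin_changeM; first exact: lin_change_lower.
  apply: lin_change_upper => //; apply: IHn.
  move: uN; rewrite NE unitmx_mul => /andP[_].
  by rewrite unitmxE [\det _](det_ublock (b%:M : 'M[R]_1) v S) unitrM -unitmxE => /andP[].
have [M0|] := eqVneq (M 0%R 0%R) 0%R; last exact: key.
have [i Mi] : exists i, M i 0%R != 0%R.
  apply/existsP; rewrite -negb_forall; apply/negP => /forallP h.
  move: uM; rewrite unitmxE unitfE (expand_det_col _ 0%R) big1 ?eqxx// => i _.
  by rewrite (eqP (h i)) mul0r.
have [j ij] : exists j, i = rshift 1 j.
  have := splitP (i : 'I_(1 + n)%N); case=> k ik; last by exists k; exact: val_inj.
  by move: Mi; rewrite (_ : i = 0%R) ?M0 ?eqxx//; apply: val_inj; rewrite /= ik ord1.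
(* Add a row with nonzero first entry to the first row. *)
pose sh (s : R) : 'M[R]_n.+1 := (block_mx (1%:M : 'M[R]_1) (s *: delta_mx 0 j) 0 1%:M)%R.
have shK : (sh (-1) *m sh 1 = 1%:M)%R.
  rewrite /sh (@mulmx_block _ 1 n 1 n 1 n) !mul1mx !mulmx1 !mulmx0 !mul0mx !addr0 add0r -scalerDl subrr scale0r.
  by rewrite -(@scalar_mx_block _ 1 n).
rewrite -[M]mul1mx -shK -mulmxA; apply: lin_changeM.
  by apply: lin_change_upper; [exact: oner_neq0|exact: lin_change1].
apply: key; first by rewrite unitmx_mul uM andbT; have := mulmx1_unit shK => -[].
have shE k : (sh 1 0 (lift ord0 k) = (k == j)%:R)%R.
  transitivity (sh 1%R (@lshift 1 n 0%R) (@rshift 1 n k)); first by congr (sh _ _ _); exact: val_inj.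
  by rewrite /sh (@block_mxEur _ 1 n 1 n) scale1r !mxE eqxx.
rewrite mxE (@big_ord_recl _ _ _ n) M0 mulr0 add0r (bigD1 j)//= big1 ?addr0 => [|k kj].
  rewrite shE eqxx mul1r (_ : lift ord0 j = i)//; rewrite ij; exact: val_inj.
by rewrite shE (negbTE kj) mul0r.
Qed.

End Linear.

(** * Linear images and hyperplanes *)

Section LinearSets.
Context {R : realType}.
Local Notation mu := (@lebesgue_measure R).
Local Open Scope ereal_scope.

Lemma eq_indic (S T : Type) (A : set S) (B : set T) x y : (A x <-> B y) ->
  (\1_A x = \1_B y :> R)%R.
Proof. by move=> AB; rewrite !indicE; congr (nat_of_bool _)%:R; apply/idP/idP; rewrite !inE => /AB. Qed.

Lemma integral_leb_indic n (A : set 'rV[R]_n) : measurable A ->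
  leb n A = \int[leb n]_x (\1_A x)%:E.
Proof. by move=> mA; rewrite integral_indic// setIT. Qed.

Lemma measurable_EFin_indic d (X : measurableType d) (A : set X) : measurable A ->
  measurable_fun setT (fun x => (\1_A x)%:E : \bar R).
Proof. by move=> mA; apply/measurable_EFinP; exact: measurable_indic. Qed.

Lemma leb_image_lin n (T : 'M[R]_n) (A : set 'rV[R]_n) : T \in unitmx -> measurable A ->
  leb n [set x *m T | x in A]%R = `|\det T|%:E * leb n A.
Proof.
move=> uT mA.
have E : [set x *m T | x in A]%R = (fun x => x *m invmx T)%R @^-1` A.
  apply/seteqP; split => [_ [x Ax <-]|x Ax] /=; first by rewrite mulmxK.
  by exists (x *m invmx T)%R => //; rewrite mulmxKV.
have mE : measurable [set x *m T | x in A]%R.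
  by rewrite E -[X in measurable X]setTI; exact: measurable_mulmx.
rewrite !integral_leb_indic// (lin_change_unit uT (measurable_EFin_indic mE)) => [|x]; last by rewrite lee_fin.
congr (_ * _); apply: eq_integral => x _; congr (_%:E); apply: eq_indic; split; last by move=> Ax; exists x.
by move=> [y Ay /(can_inj (mulmxK uT)) <-].
Qed.

Lemma leb_image_scale n (s : R) (A : set 'rV[R]_n) : (0 < s)%R -> measurable A ->
  leb n [set s *: x | x in A]%R = (s ^+ n)%:E * leb n A.
Proof.
move=> s0 mA; have := @leb_image_lin n s%:M A.
rewrite det_scalar ger0_norm ?exprn_ge0 ?(ltW s0)// => <- //.
  by congr (leb n _); apply/seteqP; split => _ [x Ax <-]; exists x => //; rewrite mul_mx_scalar.
by rewrite unitmxE det_scalar unitfE expf_neq0// gt_eqF.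
Qed.

Lemma measurable_dot n (a : 'rV[R]_n) : measurable_fun setT (dot a).
Proof.
by apply: measurable_sum => i; apply: measurable_funM => //; exact: measurable_coord.
Qed.

Lemma measurable_hyperplane n (a : 'rV[R]_n) (b : R) : measurable [set x | dot a x = b].
Proof.
rewrite (_ : [set x | _] = setT `&` dot a @^-1` [set b]); last by rewrite setTI.
exact: measurable_dot.
Qed.

Lemma dot_cons n (a : 'rV[R]_n.+1) x v : (dot a (cons_rv x v) =
  a 0 0 * x + dot (behead_rv a) v)%R.
Proof.
rewrite /dot big_ord_recl cons_rv0; congr (_ + _)%R.
by apply: eq_bigr => i _; rewrite cons_rvS mxE.
Qed.

(** If the first coordinate of [a] vanishes, the slices are hyperplanes of lower
    dimension; otherwise the lines along the first coordinate meet the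
    hyperplane in one point. *)
Lemma leb_hyperplane n (a : 'rV[R]_n) (b : R) : a != 0%R -> leb n [set x | dot a x = b] = 0.
Proof.
elim: n a b => [|n IHn] a b; first by rewrite (rV0E a) eqxx.
move=> an0; rewrite integral_leb_indic; last exact: measurable_hyperplane.
have mI := measurable_EFin_indic (measurable_hyperplane a b).
have I0 x : 0 <= (\1_[set x : 'rV[R]_n.+1 | dot a x = b] x)%:E :> \bar R by rewrite lee_fin.
have [a0|a0] := eqVneq (a 0 0)%R 0%R.
  rewrite integral_leb_cons// -[RHS](@integral0 _ _ R mu setT); apply: eq_integral => x _.
  rewrite -(IHn (behead_rv a) b); last first.
    apply: contra_neq an0 => bh0; rewrite (cons_rvP a) a0 bh0.
    apply/rowP => i; case: (unliftP ord0 i) => [j ->|->]; first by rewrite cons_rvS !mxE.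
    by rewrite cons_rv0 mxE.
  rewrite integral_leb_indic; last exact: measurable_hyperplane.
  apply: eq_integral => v _; congr (_%:E); apply: eq_indic => /=.
  by rewrite dot_cons a0 mul0r add0r.
rewrite integral_leb_cons2// -[RHS](@integral0 _ _ R (leb n) setT); apply: eq_integral => v _.
rewrite -[RHS](@lebesgue_measure_set1 R ((b - dot (behead_rv a) v) / a 0 0)%R).
rewrite -[X in mu X]setIT -integral_indic//.
apply: eq_integral => x _; congr (_%:E); apply: eq_indic => /=; rewrite dot_cons; split.
  by move=> <-; field.
by move=> ->; field.
Qed.

Lemma leb_in_hyperplane n (A : set 'rV[R]_n) : measurable A -> in_hyperplane A -> leb n A = 0.
Proof.
move=> mA [a [b [a0 sA]]]; apply: subset_measure0 (leb_hyperplane b a0) => //.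
exact: measurable_hyperplane.
Qed.

Lemma measurable_box n (A : 'I_n -> set R) : (forall i, measurable (A i)) ->
  measurable [set x : 'rV[R]_n | forall i, A i (x 0%R i)].
Proof.
move=> mA; rewrite (_ : [set x | _] = \bigcap_(i in [set: 'I_n])
    ((fun x : 'rV[R]_n => x 0%R i) @^-1` A i)); last first.
  by apply/seteqP; split => x /= h i; [move=> _; exact: h|exact: (h i)].
apply: fin_bigcap_measurable => // i _; rewrite -[X in measurable X]setTI.
exact: measurable_coord.
Qed.

Lemma leb_bounded n (A : set 'rV[R]_n) (K : R) : measurable A ->
  (forall x, A x -> forall i, `|x 0 i| <= K)%R -> leb n A \is a fin_num.
Proof.
move=> mA AK; rewrite ge0_fin_numE//.
have mI : measurable (`[(- K)%R, K]%classic : set R) by exact: measurable_itv.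
have H : leb n A <= leb n [set x | forall i, `[(- K)%R, K]%classic (x 0%R i)].
  apply: le_measure; [by rewrite inE|by rewrite inE; apply: (measurable_box (A := fun=> _))|].
  by move=> x Ax i /=; rewrite in_itv/= -ler_norml; exact: AK.
apply: (le_lt_trans H); rewrite (leb_box (A := fun=> `[(- K)%R, K]%classic))//.
rewrite -ge0_fin_numE; last exact: prode_ge0.
elim/big_ind: _ => // [x y x0 y0|i _]; first exact: fin_numM.
by rewrite lebesgue_measure_itv/=; case: ifP.
Qed.
End LinearSets.

(** * Total variation of a convex function on a sublevel set *)

Section OneDim.
Context {R : realType} (q : R).
Local Notation mu := (@lebesgue_measure R).

(** Positive part raised to the power [a], so that a power of [|s|] can be
    treated separately on either side of [0]. *)
Definition ppow (a s : R) : R := (Num.max s 0) `^ a.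

Lemma ppow_ge0 a s : 0 <= ppow a s. Proof. exact: powR_ge0. Qed.

Lemma ppow_pos a s : 0 <= s -> ppow a s = s `^ a.
Proof. by move=> s0; rewrite /ppow max_l. Qed.

Lemma ppow_neg a s : a != 0 -> s <= 0 -> ppow a s = 0.
Proof. by move=> a0 s0; rewrite /ppow max_r// powR0. Qed.

Lemma ppow_homo a : 0 <= a -> {homo ppow a : s t / s <= t}.
Proof.
move=> a0 s t st; apply: ge0_ler_powR; rewrite ?nnegrE ?(le_max 0) ?lexx ?orbT//.
by rewrite ge_max !le_max st lexx orbT.
Qed.

Lemma continuous_ppow a : 0 < a -> continuous (ppow a).
Proof.
move=> a0 x; have [x0|x0|->] := ltgtP x 0.
- apply/cvgrPdist_lt => e e0; near=> y.
  have y0 : y < 0 by near: y; exact: lt_nbhsl.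
  by rewrite !ppow_neg ?(ltW x0) ?(ltW y0) ?gt_eqF// subr0 normr0.
- have C : {for x, continuous (fun s : R => s `^ a)}.
    apply: differentiable_continuous; apply/derivable1_diffP.
    by apply: derivable_powR; rewrite in_itv/= x0.
  apply/cvgrPdist_lt => e e0.
  have /cvgrPdist_lt/(_ _ e0) {}C := C.
  near=> y; have y0 : 0 < y by near: y; exact: lt_nbhsr.
  rewrite !ppow_pos ?(ltW x0) ?(ltW y0)//; near: y; exact: C.
- apply/cvgrPdist_lt => e e0; near=> y.
  rewrite (@ppow_neg a 0) ?gt_eqF// sub0r normrN ger0_norm ?ppow_ge0//.
  have E : e = (e `^ a^-1) `^ a by rewrite -powRrM mulVf ?gt_eqF// powRr1// ltW.
  rewrite E /ppow; apply: gt0_ltr_powR => //; rewrite ?nnegrE ?powR_ge0 ?le_max ?lexx ?orbT//.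
  rewrite gt_max powR_gt0// andbT.
  by near: y; apply: lt_nbhsl; rewrite powR_gt0.
Unshelve. all: by end_near. Qed.

(** At [0] the difference quotient equals [ppow (q - 1)], which tends to [0]
    because [1 < q]. *)
Lemma is_derive_ppow (x : R) : 1 < q -> is_derive x 1 (ppow q) (q * ppow (q - 1) x).
Proof.
move=> q1; have q0 : 0 < q by lra.
have qm : 0 < q - 1 by lra.
have [x0|x0|->] := ltgtP x 0.
- rewrite ppow_neg ?gt_eqF ?(ltW x0)// mulr0.
  apply: (@near_eq_is_derive _ _ _ (cst 0)).
  near=> y; rewrite /cst ppow_neg ?gt_eqF//; apply/ltW; near: y; exact: lt_nbhsl.
- rewrite ppow_pos ?(ltW x0)//.
  apply: (@near_eq_is_derive R R R (fun s : R => s `^ q)); last exact: is_derive1_powR.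
  by near=> y; rewrite ppow_pos//; apply/ltW; near: y; exact: lt_nbhsr.
- rewrite ppow_neg ?gt_eqF// mulr0.
  have H : (h^-1 *: (ppow q (h *: 1 + 0) - ppow q 0)) @[h --> 0^'] --> (0 : R).
    have L : ppow (q - 1) h @[h --> 0^'] --> (0 : R).
      apply: cvg_trans (_ : ppow (q - 1) h @[h --> 0] --> (0 : R)).
        by apply: cvg_app; exact: cvg_within.
      have C : {for (0 : R), continuous (ppow (q - 1))} by exact: continuous_ppow.
      by apply: cvg_trans C _; rewrite (@ppow_neg (q - 1) 0) ?gt_eqF.
    apply: cvg_trans L; apply: near_eq_cvg; near=> h.
    have h0 : h != 0 by near: h; exact: nbhs_dnbhs_neq.
    rewrite [h *: 1]mulr1 addr0 (@ppow_neg q 0) ?gt_eqF// subr0.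
    have [hn|hp] := leP h 0; first by rewrite !ppow_neg ?gt_eqF// scaler0.
    by rewrite !ppow_pos ?(ltW hp)// -(mulr_powRB1 (ltW hp) q0) scalerA mulVf// scale1r.
  split; first by apply/cvg_ex; exists 0; exact: H.
  exact: (cvg_lim (@Rhausdorff R) H).
Unshelve. all: by end_near. Qed.

Lemma tangent_le (G dG : R -> R) : (forall t, is_derive (t : R) 1 G (dG t)) ->
  {homo dG : s t / s <= t} -> forall s t, G s + dG s * (t - s) <= G t.
Proof.
move=> dG1 hG s t.
have cG x y : {within `[x, y], continuous G}.
  by apply: derivable_within_continuous => z _; have [] := dG1 z.
have [st|ts|->] := ltgtP s t; last by rewrite subrr mulr0 addr0.
- have [c] := MVT st (fun x _ => dG1 x) (cG _ _).
  rewrite in_itv/= => /andP[sc ct] E.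
  have : dG s * (t - s) <= dG c * (t - s) by rewrite ler_wpM2r ?subr_ge0 ?(ltW st)// hG// ltW.
  by move: E; lra.
- have [c] := MVT ts (fun x _ => dG1 x) (cG _ _).
  rewrite in_itv/= => /andP[sc ct] E.
  have : dG c * (s - t) <= dG s * (s - t) by rewrite ler_wpM2r ?subr_ge0 ?(ltW ts)// hG// ltW.
  by move: E; lra.
Qed.

Local Open Scope ereal_scope.

(** On the interval [G <= 1] the convex function [G] descends from [1] to its
    minimum and climbs back, so its total variation is twice the difference.
    The constant [K] provides the compact interval on which the minimum and the
    two solutions of [G t = 1] are found. *)
Lemma integral_unimodal (G dG : R -> R) (K : R) : (0 < K)%R ->
  (forall t, is_derive (t : R) 1%R G (dG t)) -> continuous dG ->
  {homo dG : s t / (s <= t)%R} ->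
  (forall t, (K <= `|t|)%R -> (1 < G t)%R /\ (G 0 < G t)%R) ->
  exists2 c, (forall t, (G c <= G t)%R) &
    \int[mu]_t ((\1_[set t | (G t <= 1)%R] t * `|dG t|)%R)%:E = ((Num.max (1 - G c) 0) *+ 2)%:E.
Proof.
move=> K0 dG1 cdG hG GK.
have cG : continuous G.
  by move=> z; apply: differentiable_continuous; apply/derivable1_diffP; have [] := dG1 z.
have tan := tangent_le dG1 hG.
have dGmin t : (forall x, (G t <= G x)%R) -> dG t = 0%R.
  move=> tmin; have [_ h0] : is_derive t 1%R G 0%R.
    apply: (@derive1_at_min _ _ (t - 1) (t + 1))%R; rewrite ?in_itv/=.
    - lra.
    - by move=> x _; have [] := dG1 x.
    - by apply/andP; split; lra.
    - by move=> x _; exact: tmin.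
  by have [_] := dG1 t; rewrite h0 => <-.
have [c cK cmin0] : exists2 c, c \in `[(- K)%R, K]%R & forall t, t \in `[(- K)%R, K]%R -> (G c <= G t)%R.
  by apply: EVT_min; [lra|exact: continuous_subspaceT].
have cmin t : (G c <= G t)%R.
  have [tK|] := leP `|t|%R K; first by apply: cmin0; rewrite in_itv/= -ler_norml.
  move=> /ltW/GK[_ /ltW]; apply: le_trans.
  by apply: cmin0; rewrite in_itv/=; apply/andP; split; lra.
exists c => //.
have dGl t : (t < c -> dG t <= 0)%R.
  move=> tc; have := tan t c; have := cmin t => h1 h2.
  rewrite -(@pmulr_lle0 _ (c - t)%R) ?subr_gt0//; lra.
have dGr t : (c < t -> 0 <= dG t)%R.
  move=> tc; have := tan t c; have := cmin t => h1 h2.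
  rewrite -(@pmulr_lge0 _ (t - c)%R) ?subr_gt0//; lra.
have [G1|G1] := leP 1%R (G c).
  rewrite max_r ?subr_le0// mul0rn.
  under eq_integral => t _.
    rewrite (_ : (\1_[set t | (G t <= 1)%R] t * `|dG t|)%R = 0%R); first over.
    rewrite indicE; case: (boolP (t \in _)); rewrite ?mul0r// inE/= mul1r => Gt1.
    by rewrite dGmin ?normr0// => x; apply: le_trans (cmin x); exact: le_trans G1.
  by rewrite integral0.
rewrite max_l ?subr_ge0 ?(ltW G1)//.
move: cK; rewrite in_itv/= => /andP[Kc cK].
have [a] : exists2 a, a \in `[(- K)%R, c]%R & G a = 1%R.
  apply: IVT => //; first exact: continuous_subspaceT.
  have [] := GK (- K)%R; rewrite ?normrN ?ger0_norm ?(ltW K0)// => h _.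
  by rewrite ge_min (ltW G1) orbT le_max (ltW h).
rewrite in_itv/= => /andP[_ ac] Ga.
have [b] : exists2 b, b \in `[c, K]%R & G b = 1%R.
  apply: IVT => //; first exact: continuous_subspaceT.
  have [] := GK K; rewrite ?ger0_norm ?(ltW K0)// => h _.
  by rewrite ge_min (ltW G1) le_max (ltW h) orbT.
rewrite in_itv/= => /andP[cb _] Gb.
have {}ac : (a < c)%R by rewrite lt_neqAle ac andbT; apply: contraTneq G1 => <-; rewrite Ga ltxx.
have {}cb : (c < b)%R by rewrite lt_neqAle cb andbT; apply: contraTneq G1 => ->; rewrite Gb ltxx.
have da : (dG a < 0)%R.
  have := tan a c; rewrite Ga => h.
  by rewrite -(@pmulr_llt0 _ (c - a)%R) ?subr_gt0//; lra.
have db : (0 < dG b)%R.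
  have := tan b c; rewrite Gb => h.
  by rewrite -(@pmulr_lgt0 _ (b - c)%R) ?subr_gt0//; lra.
(* The tangents at [a] and [b] exclude the points outside; tangents at inner
   points give the converse. *)
have SE : [set t | (G t <= 1)%R] = `[a, b]%classic.
  apply/seteqP; split => t /=; rewrite in_itv/=.
    move=> Gt; apply/andP; split; rewrite leNgt; apply/negP => ta.
      have := tan a t; rewrite Ga => h.
      have : (0 < dG a * (t - a))%R by rewrite nmulr_rgt0// subr_lt0.
      lra.
    have := tan b t; rewrite Gb => h.
    have : (0 < dG b * (t - b))%R by rewrite mulr_gt0// subr_gt0.
    lra.
  move=> /andP[a_t tb].
  have [tc|tc|->] := ltgtP t c; last exact: ltW.
    have := tan t a; rewrite Ga => h.
    have : (0 <= dG t * (a - t))%R by rewrite mulr_le0 ?dGl// subr_le0.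
    lra.
  have := tan t b; rewrite Gb => h.
  have : (0 <= dG t * (b - t))%R by rewrite mulr_ge0 ?dGr// subr_ge0.
  lra.
rewrite SE.
transitivity (\int[mu]_(t in `[a, b]) (`|dG t|)%:E).
  rewrite [RHS]integral_mkcond; apply: eq_integral => t _.
  by rewrite patchE indicE; case: ifP => _; rewrite ?mul1r ?mul0r.
have mdG : measurable_fun setT (fun t => `|dG t|%:E : \bar R).
  by apply/measurable_EFinP; apply: measurableT_comp => //; exact: continuous_measurable_fun.
rewrite (@itv_bndbnd_setU _ _ _ (BLeft c)) ?bnd_simp ?(ltW ac) ?(ltW cb)//.
rewrite ge0_integral_setU//=; last 2 first.
- exact: measurable_funS mdG.
- by apply: lt_disjoint => x y; rewrite !in_itv/= => /andP[_ xc] /andP[cy _]; exact: lt_le_trans cy.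
rewrite integral_itv_bndo_bndc; last exact: measurable_funS mdG.
have cG' x y : derivable_oo_LRcontinuous G x y.
  split => [z _||]; first by have [] := dG1 z.
    by apply: cvg_at_right_filter; exact: cG.
  by apply: cvg_at_left_filter; exact: cG.
have dGE x : (G^`())%classic x = dG x by rewrite derive1E; have [_ ->] := dG1 x.
have H1 : \int[mu]_(t in `[a, c]) (`|dG t|)%:E = (1 - G c)%:E.
  transitivity (\int[mu]_(t in `[a, c]) (- dG t)%:E).
    apply: eq_integral => t; rewrite inE/= in_itv/= => /andP[_ tc]; congr (_%:E).
    apply: ler0_norm; move: tc; rewrite le_eqVlt => /orP[/eqP ->|/dGl//].
    by rewrite dGmin.
  rewrite (@continuous_FTC2 _ (fun t => - dG t)%R (fun t => - G t)%R)//.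
  - by rewrite Ga -EFinB; congr (_%:E); lra.
  - by apply: continuous_subspaceT => t; apply: cvgN; exact: cdG.
  - split => [z _||]; first by apply: derivableN; have [] := dG1 z.
      by apply: cvg_at_right_filter; apply: cvgN; exact: cG.
    by apply: cvg_at_left_filter; apply: cvgN; exact: cG.
  - by move=> t _; rewrite derive1E deriveN; [rewrite -derive1E dGE|have [] := dG1 t].
have H2 : \int[mu]_(t in `[c, b]) (`|dG t|)%:E = (1 - G c)%:E.
  transitivity (\int[mu]_(t in `[c, b]) (dG t)%:E).
    apply: eq_integral => t; rewrite inE/= in_itv/= => /andP[ct _]; congr (_%:E).
    apply: ger0_norm; move: ct; rewrite le_eqVlt => /orP[/eqP <-|/dGr//].
    by rewrite dGmin.
  rewrite (@continuous_FTC2 _ dG G)// ?Gb//.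
  by apply: continuous_subspaceT => t; exact: cdG.
by rewrite [X in X + _]H1 [X in _ + X]H2 -EFinD mulr2n.
Qed.
End OneDim.

(** * Asymmetric l_q balls *)

Section Gauge.
Context {R : realType} (q : R).
Hypothesis q1 : 1 < q.
Local Notation mu := (@lebesgue_measure R).

Lemma q_gt0 : 0 < q. Proof. exact: lt_trans ltr01 q1. Qed.
Lemma qm1_gt0 : 0 < q - 1. Proof. by rewrite subr_gt0. Qed.
Let q0 := q_gt0.
Let qm0 := qm1_gt0.

(** The asymmetric version of [|s|^q] whose negative side is stretched by [1 / r]. *)
Definition phi (r s : R) : R := ppow q s + ppow q (- s / r).

(** The derivative of [phi r]. *)
Definition dphi (r s : R) : R := q * ppow (q - 1) s - q * ppow (q - 1) (- s / r) / r.

(** Homogeneous of degree [q], hence the [q]-th power of a gauge. *)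
Definition gauge n (r : R) (x : 'rV[R]_n) : R := \sum_i phi r (x 0 i).

Definition asym_ball n (r : R) : set 'rV[R]_n := [set x | gauge r x <= 1].

Lemma phi_ge0 r s : 0 <= phi r s.
Proof. by rewrite addr_ge0// ppow_ge0. Qed.

Lemma gauge_ge0 n r (x : 'rV[R]_n) : 0 <= gauge r x.
Proof. by apply: sumr_ge0 => i _; exact: phi_ge0. Qed.

Lemma phi_pos r s : 0 < r -> 0 <= s -> phi r s = s `^ q.
Proof.
move=> r0 s0; rewrite /phi ppow_pos// ppow_neg ?addr0 ?gt_eqF//.
by rewrite mulNr oppr_le0 divr_ge0// ltW.
Qed.

Lemma phi_neg r s : 0 < r -> s <= 0 -> phi r s = (- s / r) `^ q.
Proof.
move=> r0 s0; rewrite /phi ppow_neg ?gt_eqF// add0r ppow_pos//.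
by rewrite divr_ge0 ?oppr_ge0// ltW.
Qed.

Lemma phi1 s : phi 1 s = `|s| `^ q.
Proof.
have [s0|s0] := leP 0 s; first by rewrite phi_pos// ger0_norm.
by rewrite phi_neg ?(ltW s0)// ltr0_norm// divr1.
Qed.

Lemma phi_ge r s : 0 < r -> r <= 1 -> `|s| `^ q <= phi r s.
Proof.
move=> r0 r1; have [s0|s0] := leP 0 s; first by rewrite phi_pos// ger0_norm.
rewrite phi_neg ?(ltW s0)// ltr0_norm//.
apply: ge0_ler_powR; rewrite ?nnegrE ?oppr_ge0 ?divr_ge0 ?oppr_ge0 ?(ltW s0) ?(ltW r0) ?(ltW q0)//.
by rewrite ler_pdivlMr// ler_piMr// oppr_ge0 ltW.
Qed.

Lemma phiZ r c s : 0 < c -> phi r (c * s) = c `^ q * phi r s.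
Proof.
move=> c0.
have ppowZ t : ppow q (c * t) = c `^ q * ppow q t.
  rewrite /ppow -powRM ?le_max ?lexx ?orbT ?(ltW c0)//; congr (_ `^ _).
  by rewrite maxr_pMr ?(ltW c0)// mulr0.
by rewrite /phi mulrDr -!ppowZ; congr (_ + ppow q _); rewrite -mulrN mulrA.
Qed.

Lemma gaugeZ n r c (x : 'rV[R]_n) : 0 < c -> gauge r (c *: x) = c `^ q * gauge r x.
Proof.
by move=> c0; rewrite /gauge mulr_sumr; apply: eq_bigr => i _; rewrite mxE phiZ.
Qed.

Lemma asym_ball_coord n r (x : 'rV[R]_n) i : 0 < r -> r <= 1 -> asym_ball r x -> `|x 0 i| <= 1.
Proof.
move=> r0 r1 /= gx.
have : `|x 0 i| `^ q <= 1.
  apply: le_trans gx; rewrite /gauge (bigD1 i)//=; apply: le_trans (phi_ge _ r0 r1) _.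
  by rewrite lerDl sumr_ge0// => j _; exact: phi_ge0.
rewrite !leNgt; apply: contraNN => x1.
have : 1 `^ q < `|x 0 i| `^ q by apply: gt0_ltr_powR; rewrite ?nnegrE.
by rewrite powR1.
Qed.

Lemma continuous_ppow_opp (a r : R) : 0 < a -> continuous (fun s : R => ppow a (- s / r)).
Proof.
move=> a0 s; apply: (@continuous_comp _ _ _ (fun s : R => - s / r) (ppow a)); last exact: continuous_ppow.
by apply: cvgM; [apply: cvgN; exact: cvg_id|exact: cvg_cst].
Qed.

Lemma continuous_phi r : continuous (phi r).
Proof.
move=> s; apply: cvgD; first exact: continuous_ppow.
exact: continuous_ppow_opp.
Qed.

Lemma continuous_gauge n r : continuous (@gauge n r).
Proof.
apply: (@continuous_sum R n 'rV[R]_n (fun i x => phi r (x 0 i))) => i x.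
apply: (@continuous_comp _ _ _ (fun x : 'rV[R]_n => x 0 i)); last exact: continuous_phi.
exact: coord_continuous.
Qed.

Lemma closed_asym_ball n r : closed (@asym_ball n r).
Proof.
rewrite (_ : asym_ball r = @gauge n r @^-1` [set s | s <= 1])//.
by apply: preimage_closed; [move=> x _; exact: continuous_gauge|exact: closed_le].
Qed.

Lemma compact_asym_ball n r : 0 < r -> r <= 1 -> compact (@asym_ball n r).
Proof.
move=> r0 r1; apply: bounded_closed_compact; last exact: closed_asym_ball.
exists 1; split; first exact: num_real.
move=> c c1 x xB; change (`|x| <= c); rewrite [leLHS]/Num.norm/= mx_normrE.
apply: bigmax_le => [|[i j] _ /=]; first by lra.
by rewrite (ord1 i) (le_trans (asym_ball_coord j r0 r1 xB))// ltW.
Qed.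

Lemma is_derive_ppow_affine a b t :
  is_derive (t : R) 1 (fun s => ppow q (a + s * b)) (b * (q * ppow (q - 1) (a + t * b))).
Proof.
have h : is_derive (t : R) 1 (fun s : R => a + s * b) b.
  have := is_deriveD (is_derive_cst a (t : R) 1) (is_deriveZ b (is_derive_id (t : R) 1)).
  rewrite add0r [b *: 1]mulr1; congr is_derive; apply/funext => s.
  by congr (a + _); exact: mulrC.
rewrite mulrC; apply: (is_derive1_comp (f := ppow q)) => //.
exact: is_derive_ppow.
Qed.

Lemma is_derive_phi_affine r a b t :
  is_derive (t : R) 1 (fun s => phi r (a + s * b)) (b * dphi r (a + t * b)).
Proof.
rewrite /dphi mulrBr.
have E s : - (a + s * b) / r = - a / r + s * (- b / r) by ring.
rewrite (_ : (fun s => _) = (fun s => ppow q (a + s * b)) + (fun s => ppow q (- a / r + s * (- b / r)))); last first.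
  by apply/funext => s; rewrite /phi E.
apply: is_deriveD; first exact: is_derive_ppow_affine.
have := is_derive_ppow_affine (- a / r) (- b / r) t; rewrite -E.
by congr is_derive; ring.
Qed.

Lemma dphi_homo r : 0 < r -> {homo dphi r : s t / s <= t}.
Proof.
move=> r0 s t st; rewrite /dphi lerB// ?ler_pM2r ?invr_gt0// ler_pM2l//.
  by apply: ppow_homo => //; exact: ltW.
by apply: ppow_homo; rewrite ?(ltW qm0)// ler_pM2r ?invr_gt0// lerN2.
Qed.

Lemma continuous_dphi r : continuous (dphi r).
Proof.
move=> s; apply: cvgB; first by apply: cvgM; [exact: cvg_cst|exact: continuous_ppow].
apply: cvgM; last exact: cvg_cst.
by apply: cvgM; [exact: cvg_cst|exact: continuous_ppow_opp].
Qed.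

(** The derivative of [gauge r] at [x] in the direction [W]. *)
Definition dgauge n (r : R) (W x : 'rV[R]_n) : R := \sum_i W 0 i * dphi r (x 0 i).

Lemma continuous_dgauge n r (W : 'rV[R]_n) : continuous (dgauge r W).
Proof.
apply: (@continuous_sum R n 'rV[R]_n (fun i x => W 0 i * dphi r (x 0 i))) => i x.
apply: (@continuous_comp _ _ _ (fun x : 'rV[R]_n => x 0 i) (fun s : R => W 0 i * dphi r s)); last first.
  by apply: cvgM; [exact: cvg_cst|exact: continuous_dphi].
exact: coord_continuous.
Qed.

Local Open Scope ereal_scope.

Definition gauge_flux n (r : R) (W x : 'rV[R]_n) : \bar R :=
  (\1_(asym_ball r) x * `|dgauge r W x|)%:E.

Lemma gauge_flux_ge0 n r (W x : 'rV[R]_n) : 0 <= gauge_flux r W x.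
Proof. by rewrite lee_fin mulr_ge0. Qed.

Lemma measurable_asym_ball n r : measurable (@asym_ball n r).
Proof. by apply: closed_measurable_mx; exact: closed_asym_ball. Qed.

Lemma continuous_measurable_rV n (f : 'rV[R]_n -> R) : continuous f -> measurable_fun setT f.
Proof.
move=> cf; apply: (measurability _ (RGenOpens.measurableE R)).
move=> _ [_ [a [b ->] <-]]; rewrite setTI; apply: open_measurable_mx.
by apply: open_comp => [x _|]; [exact: cf|exact: interval_open].
Qed.

Lemma measurable_gauge_flux n r (W : 'rV[R]_n) : measurable_fun setT (gauge_flux r W).
Proof.
apply/measurable_EFinP; apply: measurable_funM.
  by apply: measurable_indic; exact: measurable_asym_ball.
apply: measurableT_comp => //; apply: continuous_measurable_rV; exact: continuous_dgauge.
Qed.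

Lemma coord_line n (x W : 'rV[R]_n) t i : ((x + t *: W) 0 i = x 0 i + t * W 0 i)%R.
Proof. by rewrite !mxE. Qed.

(** The restriction of the gauge to the line through [(0, y)] with direction
    [(1, w)] is convex and dominates [|t|^q], so [integral_unimodal] applies. *)
Lemma integral_gauge_flux_line n r (y w : 'rV[R]_n) : (0 < r <= 1)%R ->
  exists2 c, (forall t, gauge r (cons_rv c (y + c *: w)) <= gauge r (cons_rv t (y + t *: w)))%R &
  \int[mu]_t gauge_flux r (cons_rv 1 w) (cons_rv t (y + t *: w)%R) =
  (Num.max (1 - gauge r (cons_rv c (y + c *: w)%R)) 0 *+ 2)%:E.
Proof.
move=> /andP[r0 r1].
pose W := cons_rv 1 w; pose a := cons_rv 0 y.
have E t : (cons_rv t (y + t *: w) = a + t *: W)%R.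
  apply/rowP => i; rewrite coord_line; case: (unliftP ord0 i) => [j ->|->].
    by rewrite !cons_rvS coord_line.
  by rewrite !cons_rv0 add0r mulr1.
pose G t := gauge r (a + t *: W)%R.
pose dG t := dgauge r W (a + t *: W)%R.
have G0 t : (0 <= G t)%R by exact: gauge_ge0.
have tG t : (`|t| `^ q <= G t)%R.
  rewrite /G /gauge big_ord_recl coord_line !cons_rv0 add0r mulr1 (le_trans (phi_ge t r0 r1))//.
  by rewrite lerDl sumr_ge0// => i _; exact: phi_ge0.
(* For [|t| >= 2 + G 0] one has [G t >= |t|^q >= |t|], which exceeds
   both [1] and [G 0]. *)
have K0 : (0 < 2 + G 0)%R by rewrite ltr_wpDr.
have [] := integral_unimodal K0 (G := G) (dG := dG).
- move=> t; rewrite (_ : G = \sum_i (fun s => phi r (a 0 i + s * W 0 i)))%R; last first.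
    by apply/funext => s; rewrite /G /gauge fct_sumE; apply: eq_bigr => i _; rewrite coord_line.
  rewrite (_ : dG t = \sum_i W 0 i * dphi r (a 0 i + t * W 0 i))%R; last first.
    by rewrite /dG /dgauge; apply: eq_bigr => i _; rewrite coord_line.
  by apply: is_derive_sum => i; exact: is_derive_phi_affine.
- move=> t; apply: continuous_comp; last exact: continuous_dgauge.
  by apply: cvgD; [exact: cvg_cst|apply: cvgZl; exact: cvg_id].
- move=> s t st; apply: ler_sum => i _; rewrite !coord_line.
  have [Wi|Wi] := leP 0%R (W 0 i)%R.
    by apply: ler_wpM2l => //; apply: dphi_homo => //; rewrite lerD2l ler_wpM2r.
  by apply: ler_wnM2l; [exact: ltW|apply: dphi_homo => //; rewrite lerD2l ler_wnM2r// ltW].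
- move=> t tK; have : (`|t| <= G t)%R.
    apply: le_trans (tG t); apply: le1r_powR; last exact: ltW.
    by apply: le_trans tK; rewrite -addrA lerDl addr_ge0.
  move=> /(le_trans tK) tG'; split; apply: lt_le_trans tG'; last by rewrite ltrDr.
  by apply: (@lt_le_trans _ _ 2%R); rewrite ?ltr1n// lerDl.
move=> c cmin I; exists c; first by move=> t; rewrite !E; exact: cmin.
rewrite E -[in RHS]/(G c) -I; apply: eq_integral => t _; rewrite E /gauge_flux.
by congr (_%:E); congr (_ * _)%R; exact: eq_indic.
Qed.

End Gauge.

(** * Volumes of shadows *)

Section Crofton.
Context {R : realType} (q : R).
Hypothesis q1 : 1 < q.
Local Notation mu := (@lebesgue_measure R).
Let q0 := q_gt0 q1.

Lemma continuous_mx (X : topologicalType) m n (f : X -> 'M[R]_(m, n)) :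
  (forall i j, continuous (fun x => f x i j)) -> continuous f.
Proof.
move=> cf x A [P Pn PA]; apply: filterS PA _ => /=.
have : \forall y \near x, forall ij : 'I_m * 'I_n, P ij.1 ij.2 (f y ij.1 ij.2).
  by apply: filter_forall => -[i j]; apply: cf; exact: Pn.
by apply: filterS => y h i j; exact: (h (i, j)).
Qed.

Lemma continuous_mulmxr m n p (M : 'M[R]_(n, p)) : continuous (fun x : 'M[R]_(m, n) => x *m M).
Proof.
apply: continuous_mx => i j; rewrite (_ : (fun x => _) = fun x : 'M[R]_(m, n) => \sum_k x i k * M k j); last first.
  by apply/funext => x; rewrite mxE.
apply: (@continuous_sum R n _ (fun k (x : 'M[R]_(m, n)) => x i k * M k j)) => k x.
apply: (@continuous_comp _ _ _ (fun x : 'M[R]_(m, n) => x i k) (fun s : R => s * M k j)); first exact: coord_continuous.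
by apply: cvgM; [exact: cvg_id|exact: cvg_cst].
Qed.

Lemma compact_image_mulmx m n p (M : 'M[R]_(n, p)) (A : set 'M[R]_(m, n)) : compact A ->
  compact [set x *m M | x in A].
Proof.
by move=> cA; apply: continuous_compact => //; apply: continuous_subspaceT; exact: continuous_mulmxr.
Qed.

(** The matrix of the projection [(t, x) |-> x - t w] along [(1, w)]. *)
Definition shadow_mx n (w : 'rV[R]_n) : 'M[R]_(n.+1, n) := @col_mx R 1 n n (- w) 1%:M.

Lemma cons_rv_shadow n (w : 'rV[R]_n) t x : cons_rv t x *m shadow_mx w = x - t *: w.
Proof.
rewrite /cons_rv /shadow_mx (@mul_row_col _ 1 1 n n) mulmx1 mul_scalar_mx scalerN addrC.
by [].
Qed.

(** The integral of [s^(n/q)] over the unit interval: in the layer-cake formula of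
    [crofton] the level [s] contributes the shadow scaled by [s^(1/q)]. *)
Definition kappa n : \bar R :=
  (\int[mu]_s ((\1_(`]0, 1]%classic : set R) s * (s `^ q^-1) ^+ n)%R)%:E)%E.

Local Open Scope ereal_scope.

(** Fubini along the lines with direction [(1, w)], which the projection
    collapses to points. *)
Lemma integral_shear n (w : 'rV[R]_n) (F : 'rV[R]_n.+1 -> \bar R) :
  measurable_fun setT F -> (forall x, 0 <= F x) ->
  \int[leb n.+1]_z F z = \int[leb n]_y \int[mu]_t F (cons_rv t (y + t *: w)%R).
Proof.
move=> mF F0.
have /(_ F mF F0) -> := @lin_change_upper R n 1%R w 1%:M (oner_neq0 _) (@lin_change1 R n).
rewrite [\det _](det_ublock (1%:M : 'M[R]_1) w 1%:M) !det1 mulr1 normr1 mul1e.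
set M := block_mx _ _ _ _.
have mFM : measurable_fun setT (fun z => F (z *m M)%R).
  exact: (measurableT_comp mF (measurable_mulmx _)).
rewrite (integral_leb_cons2 mFM (fun z => F0 _)) /M.
apply: eq_integral => y _; apply: eq_integral => t _; congr (F _).
by rewrite /cons_rv [LHS](@mul_row_block _ 1 1 n 1 n) mulmx0 addr0 !mulmx1 mul_scalar_mx addrC.
Qed.

(** By homogeneity the minimum of the gauge on the line above [y] is at most [s]
    exactly when [y] lies in the shadow scaled by [s^(1/q)]. *)
Lemma shadow_scaleP n (r : R) (w y : 'rV[R]_n) c s : (0 < s)%R ->
  (forall t, gauge q r (cons_rv c (y + c *: w)) <= gauge q r (cons_rv t (y + t *: w)))%R ->
  [set z *m shadow_mx w | z in asym_ball q r]%R ((s `^ q^-1)^-1 *: y)%R <->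
  (gauge q r (cons_rv c (y + c *: w)) <= s)%R.
Proof.
move=> s0 cmin; set d := (s `^ q^-1)%R.
have d0 : (0 < d)%R by rewrite powR_gt0.
have dq : (d `^ q = s)%R by rewrite -powRrM mulVf ?gt_eqF// powRr1// ltW.
have consZ a t x : (a *: cons_rv t x = cons_rv (a * t) (a *: x) :> 'rV[R]_n.+1)%R.
  apply/rowP => i; rewrite [LHS]mxE; case: (unliftP ord0 i) => [j ->|->].
    by rewrite !cons_rvS mxE.
  by rewrite !cons_rv0.
split.
  move=> [z]; rewrite (cons_rvP z); move: (z _ _) (behead_rv z) => t x zB.
  rewrite cons_rv_shadow => /(congr1 (fun v => d *: v)%R); rewrite scalerA divff ?gt_eqF// scale1r => yE.
  apply: le_trans (cmin (d * t)%R) _.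
  rewrite -yE scalerBr scalerA subrK -consZ gaugeZ// dq.
  by rewrite -[leRHS]mulr1 ler_pM2l.
move=> ms; exists (d^-1 *: cons_rv c (y + c *: w)%R)%R.
  rewrite /asym_ball /= gaugeZ ?invr_gt0//.
  have -> : (d^-1 `^ q = s^-1)%R.
    by rewrite -dq -[(d^-1)%R]powR_inv1 ?(ltW d0)// powRAC powR_inv1 ?powR_ge0.
  by rewrite mulrC ler_pdivrMr// mul1r.
by rewrite consZ cons_rv_shadow scalerDr -addrA scalerA subrr addr0.
Qed.

(** The layer-cake representation of [(1 - m)^+]. *)
Lemma integral_level (m : R) : (0 <= m)%R ->
  \int[mu]_s (\1_[set s | (0 < s <= 1)%R /\ (m <= s)%R] s)%:E = (Num.max (1 - m) 0)%:E.
Proof.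
move=> m0; rewrite integral_indic ?setIT//; last first.
  rewrite (_ : [set s | _] = `]0%R, 1%R] `&` `[m, +oo[)//; first by apply: measurableI.
  by apply/seteqP; split => s /=; rewrite !in_itv/= andbT.
move: m0; rewrite le_eqVlt => /orP[/eqP <-|m0].
  rewrite (_ : [set s | _] = `]0%R, 1%R]%classic); last first.
    apply/seteqP; split => s /=; rewrite in_itv/=; first by case.
    by move=> /andP[s0 s1]; rewrite s0 s1 ltW.
  by rewrite /= lebesgue_measure_itv/= lte01 -EFinB max_l subr0.
have [m1|m1] := leP m 1%R.
  rewrite (_ : [set s | _] = `[m, 1%R]%classic); last first.
    apply/seteqP; split => s /=; rewrite in_itv/=; first by move=> [/andP[_ ->] ->].
    by move=> /andP[ms ->]; rewrite ms (lt_le_trans m0 ms).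
  rewrite /= lebesgue_measure_itv/= lte_fin; case: ltP => h; first by rewrite -EFinB max_l// subr_ge0.
  by rewrite max_r// subr_le0.
rewrite (_ : [set s | _] = set0) ?measure0 ?max_r ?subr_le0 ?(ltW m1)//.
apply/seteqP; split => s //= [/andP[_ s1] ms].
by move: (le_lt_trans s1 m1); rewrite ltNge ms.
Qed.

Lemma measurable_shadow n r (w : 'rV[R]_n) : (0 < r <= 1)%R ->
  measurable [set z *m shadow_mx w | z in asym_ball q r]%R.
Proof.
move=> /andP[r0 r1]; apply: compact_measurable_mx; apply: compact_image_mulmx.
exact: compact_asym_ball.
Qed.

(** Each line contributes [2 (1 - m)^+], where [m] is the minimum of the gauge
    on it. Writing this as an integral over levels and exchanging the
    integrations, the points [y] with [m <= s] form the shadow scaled by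
    [s^(1/q)], whose measure is [s^(n/q)] times that of the shadow. *)
Lemma crofton n (r : R) (w : 'rV[R]_n) : (0 < r <= 1)%R ->
  \int[leb n.+1]_z gauge_flux q r (cons_rv 1 w) z =
  2%:E * kappa n * leb n [set z *m shadow_mx w | z in asym_ball q r]%R.
Proof.
move=> r01; rewrite (integral_shear w); last 2 first.
- exact: measurable_gauge_flux.
- exact: gauge_flux_ge0.
set S := [set z *m shadow_mx w | z in asym_ball q r]%R.
have mS : measurable S by exact: measurable_shadow.
(* Pairs of a line [y] and a level [s] above its minimum. *)
pose A := [set ys : 'rV[R]_n * R | (0 < ys.2 <= 1)%R /\ S ((ys.2 `^ q^-1)^-1 *: ys.1)%R].
have mg : measurable_fun setT (fun ys : 'rV[R]_n * R => (ys.2 `^ q^-1)^-1 *: ys.1)%R.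
  apply: measurable_fun_mx => i j; under eq_fun do rewrite mxE.
  apply: measurable_funM; last exact: (measurableT_comp (measurable_coord _ _) measurable_fst).
  under eq_fun do rewrite -powRN.
  exact: (measurableT_comp (@measurable_powR R (- q^-1)%R) (@measurable_snd _ _ 'rV[R]_n (measurableTypeR R))).
have mA : measurable A.
  rewrite (_ : A = (snd @^-1` `]0%R, 1%R]%classic) `&` ((fun ys => (ys.2 `^ q^-1)^-1 *: ys.1)%R @^-1` S)); last first.
    by apply/seteqP; split => ys /=; rewrite in_itv/=.
  apply: measurableI; rewrite -[X in measurable X]setTI; first by apply: measurable_snd => //; exact: measurable_itv.
  exact: mg.
transitivity (\int[leb n]_y (2%:E * \int[mu]_s (\1_A (y, s))%:E)).
  apply: eq_integral => y _.
  have [c cmin ->] := integral_gauge_flux_line q1 y w r01.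
  have m0 : (0 <= gauge q r (cons_rv c (y + c *: w)))%R by exact: gauge_ge0.
  rewrite -[X in X%:E]mulr_natl EFinM; congr (_ * _)%E; apply: (etrans (esym (integral_level m0))).
  apply: eq_integral => s _; congr (_%:E); apply: eq_indic; rewrite /A /=.
  split=> -[/andP[s0 s1] h]; rewrite s0 s1; split => //.
    by apply/(shadow_scaleP s0 cmin).
  by apply/(shadow_scaleP s0 cmin).
have mI := @measurable_EFin_indic R _ _ _ mA.
have mF : measurable_fun setT (fun y : 'rV[R]_n => \int[mu]_s (\1_A (y, s))%:E).
  apply: (@measurable_fun_fubini_tonelli_F _ _ 'rV[R]_n (measurableTypeR R) R mu (fun ys => (\1_A ys)%:E)) => //.
have F0 (y : 'rV[R]_n) : 0 <= \int[mu]_s (\1_A (y, s))%:E.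
  by apply: integral_ge0 => s _; rewrite lee_fin.
transitivity (2%:E * \int[leb n]_y \int[mu]_s (\1_A (y, s))%:E).
  by rewrite -ge0_integralZl.
rewrite -muleA; congr (_ * _).
transitivity (\int[mu]_s \int[leb n]_y (\1_A (y, s))%:E).
  have := @fubini_tonelli _ _ 'rV[R]_n (measurableTypeR R) R (leb n) mu (fun ys => (\1_A ys)%:E) mI.
  by apply => ys; rewrite lee_fin.
rewrite /kappa muleC -ge0_integralZl//; last 2 first.
- apply/measurable_EFinP; apply: measurable_funM; first exact: measurable_indic.
  by apply: measurable_funX; exact: measurable_powR.
- by move=> s _; rewrite lee_fin mulr_ge0// exprn_ge0// powR_ge0.
apply: eq_integral => s _.
have [s01|s01] := boolP (0 < s <= 1)%R; last first.
  rewrite [X in _ * X](_ : _ = 0); last first.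
    by rewrite indicE memNset ?mul0r//= in_itv/=; exact/negP.
  rewrite mule0; under eq_integral => y _.
    rewrite (_ : (\1_A (y, s))%:E = 0); first over.
    by rewrite indicE memNset// => -[/= h _]; move: s01; rewrite h.
  by rewrite integral0.
rewrite indicE mem_set ?mul1r//= ?in_itv//=.
move/andP: (s01) => [s0 s1].
have d0 : (0 < s `^ q^-1)%R by rewrite powR_gt0.
rewrite muleC -leb_image_scale// integral_leb_indic; last first.
  rewrite (_ : [set _ | _ in _] = ((fun y => (s `^ q^-1)^-1 *: y)%R @^-1` S)).
    rewrite -[X in measurable X]setTI; apply: (measurable_fun_mx _) => // i j.
    under eq_fun do rewrite mxE; apply: measurable_funM => //; exact: measurable_coord.
  apply/seteqP; split => [_ [x Sx <-]|x Sx] /=; first by rewrite scalerA mulVf ?gt_eqF// scale1r.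
  by eexists; [exact: Sx|]; rewrite scalerA divff ?gt_eqF// scale1r.
apply: eq_integral => y _; congr (_%:E); apply: eq_indic; split.
  by move=> [_ Sy]; eexists; [exact: Sy|]; rewrite /= scalerA divff ?gt_eqF// scale1r.
by move=> [x Sx <-]; split => //=; rewrite scalerA mulVf ?gt_eqF// scale1r.
Qed.

Lemma kappa_fin n : kappa n \is a fin_num.
Proof.
rewrite ge0_fin_numE; last first.
  by apply: integral_ge0 => s _; rewrite lee_fin mulr_ge0// exprn_ge0// powR_ge0.
apply: (@le_lt_trans _ _ (\int[mu]_s (\1_(`]0%R, 1%R]%classic : set R) s)%:E)).
  apply: ge0_le_integral => //.
  - by move=> s _; rewrite lee_fin mulr_ge0// exprn_ge0// powR_ge0.
  - apply/measurable_EFinP; apply: measurable_funM; first exact: measurable_indic.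
    by apply: measurable_funX; exact: measurable_powR.
  - by apply/measurable_EFinP; exact: measurable_indic.
  - move=> s _; rewrite lee_fin.
    have [s01|s01] := boolP (s \in (`]0%R, 1%R]%classic : set R)); last first.
      by rewrite indicE (negbTE s01) mul0r.
    rewrite !indicE s01 mul1r exprn_ile1 ?powR_ge0//.
    move: s01; rewrite inE/= in_itv/= => /andP[s0 s1].
    have <- : (1 `^ q^-1 = 1 :> R)%R by rewrite powR1.
    apply: ge0_ler_powR; rewrite ?nnegrE ?invr_ge0 ?(ltW q0) ?(ltW s0)//.
by rewrite integral_indic// setIT/= lebesgue_measure_itv/= lte01 -EFinB ltry.
Qed.

Lemma kappa_gt0 n : 0 < kappa n.
Proof.
pose c := (((2^-1 : R) `^ q^-1) ^+ n)%R.
have c0 : (0 < c)%R by rewrite exprn_gt0// powR_gt0// invr_gt0.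
have mI : measurable (`[(2^-1)%R, 1%R]%classic : set R) by exact: measurable_itv.
apply: (@lt_le_trans _ _ (\int[mu]_s (c * \1_(`[(2^-1)%R, 1%R]%classic : set R) s)%:E)).
  under eq_integral do rewrite EFinM.
  rewrite ge0_integralZl//; last 2 first.
  - by apply/measurable_EFinP; exact: measurable_indic.
  - by rewrite lee_fin ltW.
  rewrite integral_indic// setIT/= lebesgue_measure_itv/= lte_fin invf_lt1// ltr1n.
  by rewrite -EFinB -EFinM lte_fin mulr_gt0// subr_gt0 invf_lt1// ltr1n.
apply: ge0_le_integral => //.
- by move=> s _; rewrite lee_fin mulr_ge0// ltW.
- by apply/measurable_EFinP; apply: measurable_funM => //; exact: measurable_indic.
- apply/measurable_EFinP; apply: measurable_funM; first exact: measurable_indic.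
  by apply: measurable_funX; exact: measurable_powR.
- move=> s _; rewrite lee_fin.
  have [s01|s01] := boolP (s \in (`[(2^-1)%R, 1%R]%classic : set R)); last first.
    by rewrite indicE (negbTE s01) mulr0 mulr_ge0// exprn_ge0// powR_ge0.
  rewrite indicE s01 mulr1; move: s01; rewrite inE/= in_itv/= => /andP[s0 s1].
  have s_gt0 : (0 < s)%R by apply: lt_le_trans s0; rewrite invr_gt0.
  rewrite indicE mem_set/= ?in_itv/= ?s_gt0// mul1r /c lerXn2r ?nnegrE ?powR_ge0//.
  by apply: ge0_ler_powR; rewrite ?nnegrE ?invr_ge0 ?(ltW q0) ?(ltW s_gt0)// ltW.
Qed.

End Crofton.

(** * Splitting the flux into orthants *)

Section Orthants.
Context {R : realType} (q : R).
Hypothesis q1 : 1 < q.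
Let q0 := q_gt0 q1.
Let qm0 := qm1_gt0 q1.

(** The part of the unit ball in the open positive orthant; the coordinate
    hyperplanes are null sets. *)
Definition cap m : set 'rV[R]_m :=
  [set x | (forall i, 0 < x 0 i) /\ \sum_i x 0 i `^ q <= 1].

(** On the positive orthant this is the derivative of [\sum_i x_i^q] in the
    direction [c]. *)
Definition lform m (c : 'I_m -> R) (x : 'rV[R]_m) : R :=
  \sum_i c i * (q * x 0 i `^ (q - 1)).

Definition orthant m (A : {set 'I_m}) : set 'rV[R]_m :=
  [set x | forall i, if i \in A then x 0 i < 0 else 0 < x 0 i].

(** Substituting [x_i := - r t_i] for the indices in [A] multiplies the volume by
    [r^#|A|] and the [i]-th partial derivative by [- 1 / r] when [i] is in [A].
    The truncated difference in the exponent is a true one, since [#|A| >= 1] as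
    soon as [i] is in [A]. *)
Definition orthant_coef m (W : 'I_m -> R) (A : {set 'I_m}) (r : R) (i : 'I_m) : R :=
  W i * (-1) ^+ (i \in A) * r ^+ (#|A| - (i \in A)).

Lemma measurable_lform m (c : 'I_m -> R) : measurable_fun setT (lform c).
Proof.
apply: measurable_sum => i; apply: measurable_funM => //; apply: measurable_funM => //.
exact: (measurableT_comp (@measurable_powR R (q - 1)) (measurable_coord _ _)).
Qed.

Lemma measurable_orthant m (A : {set 'I_m}) : measurable (orthant A).
Proof.
rewrite (_ : orthant A = [set x | forall i, (if i \in A then `]-oo, 0[%classic else `]0, +oo[%classic) (x 0 i)]).
  apply: (measurable_box (A := fun i => if i \in A then `]-oo, 0[%classic else `]0, +oo[%classic)) => i.
  by case: ifP => _; exact: measurable_itv.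
by apply/seteqP; split => x h i; have := h i; case: ifP => _ /=; rewrite in_itv/= ?andbT.
Qed.

Lemma measurable_cap m : measurable (@cap m).
Proof.
rewrite (_ : cap (m := m) = orthant finset.set0 `&` ((fun x : 'rV[R]_m => \sum_i x 0 i `^ q) @^-1` `]-oo, 1])); last first.
  apply/seteqP; split => x /= [h1 h2]; split.
  - by move=> i; rewrite inE; exact: h1.
  - by rewrite in_itv.
  - by move=> i; have := h1 i; rewrite inE.
  - by move: h2; rewrite in_itv.
apply: measurableI; first exact: measurable_orthant.
rewrite -[X in measurable X]setTI.
have : measurable_fun setT (fun x : 'rV[R]_m => \sum_i x 0 i `^ q).
  apply: measurable_sum => i.
  exact: (measurableT_comp (@measurable_powR R q) (measurable_coord _ _)).
by apply => //; exact: measurable_itv.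
Qed.

Local Open Scope ereal_scope.

Definition lform_int m (c : 'I_m -> R) : \bar R :=
  \int[leb m]_x (\1_(@cap m) x * `|lform c x|)%:E.

Lemma measurable_lform_int m (c : 'I_m -> R) :
  measurable_fun setT (fun x : 'rV[R]_m => (\1_(@cap m) x * `|lform c x|)%:E : \bar R).
Proof.
apply/measurable_EFinP; apply: measurable_funM; first by apply: measurable_indic; exact: measurable_cap.
by apply: measurableT_comp => //; exact: measurable_lform.
Qed.

Lemma negligible_coord0 m : (leb m).-negligible [set x : 'rV[R]_m | exists i, x 0%R i = 0%R].
Proof.
pose F k := [set x : 'rV[R]_m | exists2 i : 'I_m, i = k :> nat & x 0%R i = 0%R].
apply: (@negligibleS _ _ _ (leb m) (\bigcup_k F k)).
  by move=> x [i xi]; exists i => //; exists i.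
apply: negligible_bigcup => k.
have [km|km] := ltnP k m; last first.
  apply: (@negligibleS _ _ _ _ set0); last exact: negligible_set0.
  by move=> x [i ik _]; move: km; rewrite -ik leqNgt ltn_ord.
exists [set x | dot (delta_mx 0%R (Ordinal km)) x = 0%R]; split.
- exact: measurable_hyperplane.
- apply: leb_hyperplane; apply/eqP => /matrixP/(_ 0%R (Ordinal km)); rewrite !mxE !eqxx => /eqP.
  by rewrite oner_eq0.
- move=> x /= [i ik xi]; rewrite dotC dot_delta -xi; congr (x _ _); exact: val_inj.
Qed.

Lemma integral_orthants m (F : 'rV[R]_m -> \bar R) : measurable_fun setT F ->
  (forall x, 0 <= F x) ->
  \int[leb m]_x F x = \sum_(A : {set 'I_m}) \int[leb m]_x ((\1_(orthant A) x)%:E * F x).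
Proof.
move=> mF F0.
have mG (A : {set 'I_m}) : measurable_fun setT (fun x => (\1_(orthant A) x)%:E * F x).
  apply: emeasurable_funM => //; apply/measurable_EFinP; apply: measurable_indic.
  exact: measurable_orthant.
have G0 (A : {set 'I_m}) x : 0 <= (\1_(orthant A) x)%:E * F x by rewrite mule_ge0// lee_fin.
rewrite -ge0_integral_sum//.
apply: ge0_ae_eq_integral => //.
- exact: emeasurable_sum.
- by move=> x _; exact: sume_ge0.
have [N [mN N0 sN]] := negligible_coord0 m.
exists N; split => // x /= h; apply: sN; apply: contrapT => xn0; apply: h => _.
rewrite (bigD1 [set i | x 0 i < 0]%SET%R)//= big1 => [|A nA].
  rewrite adde0 indicE mem_set ?mul1e// => i; rewrite inE.
  case: ltP => //; rewrite le_eqVlt => /orP[/eqP xi|//].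
  by exfalso; apply: xn0; exists i.
rewrite indicE memNset ?mul0e// => xA; move/eqP: nA; apply.
apply/setP => i; rewrite inE; have := xA i; case: ifP => // _ xi.
by apply/esym/negbTE; rewrite -leNgt ltW.
Qed.

(** The substitution maps the positive part of the ball onto the part of the
    asymmetric ball in the orthant; see [orthant_coef] for the coefficients. *)
Lemma flux_orthant m (W : 'rV[R]_m) (A : {set 'I_m}) (r : R) : (0 < r)%R ->
  \int[leb m]_x ((\1_(orthant A) x)%:E * gauge_flux q r W x) =
  lform_int (orthant_coef (W 0%R) A r).
Proof.
move=> r0; have rn : (- r < 0)%R by rewrite oppr_lt0.
pose D : 'M[R]_m := diag_mx (\row_i if i \in A then (- r)%R else 1%R).
have DE x i : ((x *m D) 0 i = x 0 i * (if i \in A then - r else 1))%R.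
  by rewrite mul_mx_diag !mxE.
have detD : `|\det D|%R = (r ^+ #|A|)%R.
  rewrite det_diag normr_prod (bigID (mem A))/= [X in (_ * X)%R]big1 ?mulr1.
    rewrite (eq_bigr (fun=> r)) ?prodr_const// => i iA.
    by rewrite mxE iA normrN gtr0_norm.
  by move=> i /negbTE iA; rewrite mxE iA normr1.
have uD : D \in unitmx.
  by rewrite unitmxE unitfE -normr_eq0 detD expf_neq0// gt_eqF.
have mF : measurable_fun setT (fun x : 'rV[R]_m => (\1_(orthant A) x)%:E * gauge_flux q r W x).
  apply: emeasurable_funM; last exact: measurable_gauge_flux.
  by apply/measurable_EFinP; apply: measurable_indic; exact: measurable_orthant.
rewrite (lin_change_unit uD mF) => [|x]; last by rewrite mule_ge0 ?gauge_flux_ge0 ?lee_fin.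
have mFD := measurableT_comp mF (measurable_mulmx D).
rewrite detD /lform_int -(ge0_integralZl _ measurableT mFD); first last.
- by rewrite lee_fin exprn_ge0// ltW.
- by move=> x _; rewrite mule_ge0 ?gauge_flux_ge0 ?lee_fin.
apply: eq_integral => x _; rewrite /gauge_flux -!EFinM; congr (_%:E).
have [xp|xn] := pselect (forall i, 0 < x 0 i)%R; last first.
  rewrite [X in (_ = X * _)%R]indicE memNset; last by move=> [].
  rewrite mul0r [X in (_ * (X * _))%R]indicE memNset ?mul0r ?mulr0// => h; apply: xn => i.
  by have := h i; rewrite DE; case: (i \in A); rewrite ?mulr1// nmulr_llt0.
rewrite [X in (_ * (X * _))%R]indicE mem_set ?mul1r; last first.
  by move=> i /=; rewrite DE; case: (i \in A); rewrite ?mulr1// nmulr_llt0.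
rewrite mulrCA; congr (_ * _)%R.
  apply: eq_indic; rewrite /asym_ball /cap /gauge /=.
  rewrite (eq_bigr (fun i => x 0 i `^ q))%R; first by split => [//|[]].
  move=> i _; rewrite DE; case: ifP => _; last by rewrite mulr1 phi_pos// ltW.
  rewrite phi_neg//; last by rewrite mulrN oppr_le0 mulr_ge0// ltW.
  by rewrite mulrN opprK mulfK// gt_eqF.
rewrite -(ger0_norm (exprn_ge0 #|A| (ltW r0))) -normrM; congr (`|_|)%R.
rewrite /dgauge mulr_sumr /lform; apply: eq_bigr => i _.
rewrite DE /orthant_coef; case: ifPn => iA; last first.
  rewrite mulr1 expr0 mulr1 subn0 /dphi ppow_pos ?(ltW (xp _))//.
  rewrite ppow_neg ?gt_eqF//; last by rewrite mulNr oppr_le0 divr_ge0// ltW.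
  by ring.
have cA : (0 < #|A|)%N by apply/card_gt0P; exists i.
rewrite expr1 /dphi ppow_neg ?gt_eqF//; last by rewrite mulrN oppr_le0 mulr_ge0// ltW.
rewrite (_ : - (x 0 i * - r) / r = x 0 i)%R; last by field; rewrite gt_eqF.
rewrite ppow_pos ?(ltW (xp _))// -{1}(prednK cA) exprS subn1; field.
by rewrite gt_eqF.
Qed.

Lemma flux_decomposition m (W : 'rV[R]_m) (r : R) : (0 < r)%R ->
  \int[leb m]_x gauge_flux q r W x =
  \sum_(A : {set 'I_m}) lform_int (orthant_coef (W 0%R) A r).
Proof.
move=> r0; rewrite integral_orthants; first by apply: eq_bigr => A _; exact: flux_orthant.
  exact: measurable_gauge_flux.
exact: gauge_flux_ge0.
Qed.

End Orthants.

(** * A norm on coefficient vectors *)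

Section CapIntegral.
Context {R : realType} (q : R) (m : nat).
Hypothesis q1 : 1 < q.
Let q0 := q_gt0 q1.
Let qm0 := qm1_gt0 q1.
Local Notation cap := (@cap R q m).
Implicit Types (f g : 'rV[R]_m -> R) (c d : 'I_m -> R).

Lemma cap_coord x i : cap x -> 0 < x 0 i <= 1.
Proof.
move=> [x0 x1]; rewrite x0/=.
have : x 0 i `^ q <= 1.
  apply: le_trans x1; rewrite (bigD1 i)//= lerDl sumr_ge0// => j _; exact: powR_ge0.
rewrite !leNgt; apply: contraNN => h.
have : 1 `^ q < x 0 i `^ q by apply: gt0_ltr_powR; rewrite ?nnegrE ?(ltW (x0 _)).
by rewrite powR1.
Qed.

Lemma leb_cap_fin : leb m cap \is a fin_num.
Proof.
apply: (@leb_bounded _ _ _ 1); first exact: measurable_cap.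
by move=> x /cap_coord h i; have /andP[x0 x1] := h i; rewrite ger0_norm// ltW.
Qed.

Definition cap_integrable f := (leb m).-integrable cap (EFin \o f).

Definition capint f : R := \int[leb m]_(x in cap) f x.

Lemma cap_integrable_bounded f M : measurable_fun setT f ->
  (forall x, cap x -> `|f x| <= M) -> cap_integrable f.
Proof.
move=> mf fM; apply/integrableP; split.
  by apply/measurable_EFinP; exact: measurable_funS mf.
apply: (@le_lt_trans _ _ (\int[leb m]_(x in cap) (cst M%:E) x)%E).
  apply: ge0_le_integral => //.
  - exact: measurable_cap.
  - by apply/measurable_EFinP; apply: measurableT_comp => //; exact: measurable_funS mf.
rewrite integral_cst; last exact: measurable_cap.
by rewrite /= -(fineK leb_cap_fin) -EFinM ltry.
Qed.

Lemma capintD f g : cap_integrable f -> cap_integrable g ->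
  capint (fun x => f x + g x) = capint f + capint g.
Proof. by move=> hf hg; apply: RintegralD => //; exact: measurable_cap. Qed.

Lemma capintZ k f : cap_integrable f -> capint (fun x => k * f x) = k * capint f.
Proof. by move=> hf; apply: RintegralZl => //; exact: measurable_cap. Qed.

Lemma cap_integrableD f g : cap_integrable f -> cap_integrable g ->
  cap_integrable (fun x => f x + g x).
Proof. by move=> hf hg; apply: integrableD hf hg; exact: measurable_cap. Qed.

Lemma cap_integrableZ k f : cap_integrable f -> cap_integrable (fun x => k * f x).
Proof. by move=> hf; apply: integrableZl hf; exact: measurable_cap. Qed.

Lemma cap_integrable_sum (J : finType) (f : J -> 'rV[R]_m -> R) :
  (forall j, cap_integrable (f j)) -> cap_integrable (fun x => \sum_j f j x).
Proof.
move=> hf; elim: (index_enum J) => [|j s hs].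
  under eq_fun do rewrite big_nil.
  by apply: (@cap_integrable_bounded _ 0) => // x _; rewrite normr0.
by under eq_fun do rewrite big_cons; exact: cap_integrableD.
Qed.

Lemma capint_sum (J : finType) (f : J -> 'rV[R]_m -> R) :
  (forall j, cap_integrable (f j)) ->
  capint (fun x => \sum_j f j x) = \sum_j capint (f j).
Proof.
move=> hf.
suff : cap_integrable (fun x => \sum_j f j x) /\
    capint (fun x => \sum_j f j x) = \sum_j capint (f j) by case.
elim: (index_enum J) => [|j s [h1 h2]].
  rewrite big_nil; under eq_fun do rewrite big_nil; split.
    by apply: (@cap_integrable_bounded _ 0) => // x _; rewrite normr0.
  by rewrite /capint Rintegral_cst ?mul0r//; exact: measurable_cap.
rewrite big_cons; under eq_fun do rewrite big_cons; split; first exact: cap_integrableD.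
by rewrite -h2 -capintD.
Qed.

Lemma capint_le f g : cap_integrable f -> cap_integrable g ->
  (forall x, cap x -> f x <= g x) -> capint f <= capint g.
Proof. by move=> hf hg fg; apply: le_Rintegral => //; exact: measurable_cap. Qed.

(** A nonnegative function that is positive on a nondegenerate box has a
    positive integral; the strict inequalities below rest on this. *)
Lemma capint_gt0 f (a b : 'I_m -> R) : cap_integrable f ->
  (forall x, cap x -> 0 <= f x) -> (forall i, a i < b i) ->
  (forall x : 'rV[R]_m, (forall i, a i <= x 0 i <= b i) -> cap x /\ 0 < f x) ->
  0 < capint f.
Proof.
move=> hf f0 ab box.
rewrite lt_neqAle eq_sym /capint Rintegral_ge0// andbT; apply/eqP => I0.
have mc := @measurable_cap R q m.
have hf' := hf.
move/integrableP: hf' => [mf _].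
have : (\int[leb m]_(x in cap) `|(f x)%:E| = 0)%E.
  transitivity (\int[leb m]_(x in cap) (f x)%:E)%E.
    by apply: eq_integral => x; rewrite inE => xc; rewrite gee0_abs// lee_fin f0.
  have : (\int[leb m]_(x in cap) (f x)%:E)%E \is a fin_num by exact: integrable_fin_num hf.
  by move=> /fineK <-; rewrite -[fine _]/(\int[leb m]_(x in cap) f x) I0.
move/(ae_eq_integral_abs (leb m) mc mf) => [N [mN N0 sN]].
pose B := [set x : 'rV[R]_m | forall i, `[a i, b i]%classic (x 0 i)].
have mB : measurable B by apply: (measurable_box (A := fun i => `[a i, b i]%classic)) => i; exact: measurable_itv.
have : (leb m B <= leb m N)%E.
  apply: le_measure; rewrite ?inE// => x xB; apply: sN => /= h.
  have [xc fx] : cap x /\ 0 < f x.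
    by apply: box => i; have := xB i; rewrite /= in_itv.
  by have [] := h xc => fx0; move: fx; rewrite fx0 ltxx.
rewrite N0 leNgt (leb_box (A := fun i => `[a i, b i]%classic))//.
apply/negP/negPn.
elim/big_ind: _ => // [x y x0 y0|i _]; first exact: mule_gt0.
by rewrite lebesgue_measure_itv/= lte_fin ab -EFinB lte_fin subr_gt0.
Qed.

Lemma cap_dpowR_bounds x i : cap x -> 0 <= q * x 0 i `^ (q - 1) <= q.
Proof.
move=> /(cap_coord i)/andP[x0 x1]; rewrite mulr_ge0 ?powR_ge0 ?(ltW q0)//=.
rewrite ler_piMr ?(ltW q0)//.
have : x 0 i `^ (q - 1) <= 1 `^ (q - 1) by apply: ge0_ler_powR; rewrite ?nnegrE ?(ltW x0) ?(ltW qm0).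
by rewrite powR1.
Qed.

Lemma cap_integrable_lform c : cap_integrable (fun x => `|lform q c x|).
Proof.
apply: (@cap_integrable_bounded _ (\sum_i `|c i| * q)).
  by apply: measurableT_comp => //; exact: measurable_lform.
move=> x xc; rewrite normr_id; apply: le_trans (ler_norm_sum _ _ _) _.
apply: ler_sum => i _; rewrite normrM ler_wpM2l//.
by have /andP[h1 h2] := cap_dpowR_bounds i xc; rewrite ger0_norm.
Qed.

(** Subadditive and homogeneous in [c], being an integral of absolute values of
    linear forms in [c]. *)
Definition cap_norm c : R := capint (fun x => `|lform q c x|).

Lemma lform_intE c : lform_int q c = (cap_norm c)%:E.
Proof.
rewrite /cap_norm /capint /Rintegral fineK; last first.
  by apply: integrable_fin_num (cap_integrable_lform c); exact: measurable_cap.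
rewrite integral_mkcond; apply: eq_integral => x _; rewrite patchE indicE.
by case: ifP => _; rewrite ?mul1r ?mul0r.
Qed.

Lemma cap_norm_ge0 c : 0 <= cap_norm c.
Proof. by apply: Rintegral_ge0. Qed.

Lemma lform_sum (J : finType) (c : J -> 'I_m -> R) x :
  lform q (fun i => \sum_j c j i) x = \sum_j lform q (c j) x.
Proof.
by rewrite /lform exchange_big/=; apply: eq_bigr => i _; rewrite mulr_suml.
Qed.

Lemma cap_norm_sum (J : finType) (c : J -> 'I_m -> R) :
  cap_norm (fun i => \sum_j c j i) <= \sum_j cap_norm (c j).
Proof.
rewrite -capint_sum; last by move=> j; exact: cap_integrable_lform.
apply: capint_le; first exact: cap_integrable_lform.
  by apply: cap_integrable_sum => j; exact: cap_integrable_lform.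
by move=> x _; rewrite lform_sum; exact: ler_norm_sum.
Qed.

Lemma cap_normZ k c : cap_norm (fun i => k * c i) = `|k| * cap_norm c.
Proof.
rewrite -capintZ; last exact: cap_integrable_lform.
rewrite /cap_norm; congr capint; apply/funext => x; rewrite -normrM; congr `|_|.
by rewrite /lform mulr_sumr; apply: eq_bigr => i _; rewrite -mulrA.
Qed.

Definition delta (i j : 'I_m) : R := (j == i)%:R.

Lemma lform_delta i x : lform q (delta i) x = q * x 0 i `^ (q - 1).
Proof.
rewrite /lform (bigD1 i)//= /delta eqxx mul1r big1 ?addr0// => j /negbTE ->.
by rewrite mul0r.
Qed.

(** Lipschitz continuity of the norm, written additively. *)
Lemma cap_norm_dist c d : cap_norm c <= cap_norm d + \sum_i `|c i - d i| * cap_norm (delta i).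
Proof.
(* [c] is [d], indexed by [None], plus the multiples of the unit vectors. *)
have E : (fun i => c i) = (fun i => \sum_(j : option 'I_m)
    (if j is Some k then (c k - d k) * delta k i else d i)).
  apply/funext => i; rewrite (bigD1 None)//= (bigD1 (Some i))//= /delta eqxx mulr1.
  rewrite big1 ?addr0; first by rewrite addrC subrK.
  move=> [k|]//= ki; rewrite (_ : (i == k) = false) ?mulr0//.
  by apply/negbTE; apply: contraNneq ki => ->.
rewrite -[leLHS]/(cap_norm (fun i => c i)) E; apply: le_trans (cap_norm_sum _) _.
rewrite (bigD1 None)//= lerD2l.
rewrite (reindex_omap Some id)/=; last by case.
rewrite (eq_bigl xpredT); last by move=> i; rewrite eqxx.
by apply: ler_sum => i _; rewrite cap_normZ.
Qed.

End CapIntegral.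

(** * Averages over all choices of signs *)

Section SignSums.
Context {R : realType} (m : nat).
Implicit Types (a : 'I_m -> R) (A B : {set 'I_m}).

Definition signed_sum a A : R := \sum_i a i * (-1) ^+ (i \in A).

(** The two sums for opposite relative signs; this is what makes the average
    over signs computable. *)
Lemma normr_sum_sub (x y : R) : `|x + y| + `|x - y| = 2 * Num.max `|x| `|y|.
Proof.
have [x0|x0] := leP 0 x; have [y0|y0] := leP 0 y;
have [s0|s0] := leP 0 (x + y); have [d0|d0] := leP 0 (x - y);
have [xy|xy] := leP `|x| `|y|; move: xy;
rewrite ?(ger0_norm x0) ?(ltr0_norm x0) ?(ger0_norm y0) ?(ltr0_norm y0)
  ?(ger0_norm s0) ?(ltr0_norm s0) ?(ger0_norm d0) ?(ltr0_norm d0); lra.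
Qed.

Definition possum a : R := \sum_i Num.max (a i) 0.
Definition negsum a : R := \sum_i Num.max (- a i) 0.

Lemma maxr_posneg (s : R) : s = Num.max s 0 - Num.max (- s) 0.
Proof.
have [s0|s0] := boolP (0 <= s).
  by rewrite max_l// max_r ?oppr_le0// subr0.
have {}s0 : s <= 0 by move: s0; rewrite -ltNge => /ltW.
by rewrite max_r// max_l ?oppr_ge0// sub0r opprK.
Qed.

Lemma normr_posneg (s : R) : `|s| = Num.max s 0 + Num.max (- s) 0.
Proof.
have [s0|s0] := boolP (0 <= s).
  by rewrite max_l// max_r ?oppr_le0// addr0 ger0_norm.
have {}s0 : s <= 0 by move: s0; rewrite -ltNge => /ltW.
by rewrite max_r// max_l ?oppr_ge0// add0r ler0_norm.
Qed.

Lemma max_posneg a : `|\sum_i a i| + \sum_i `|a i| = 2 * Num.max (possum a) (negsum a).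
Proof.
have -> : \sum_i a i = possum a - negsum a.
  by rewrite /possum /negsum -sumrB; apply: eq_bigr => i _; exact: maxr_posneg.
have -> : \sum_i `|a i| = possum a + negsum a.
  by rewrite /possum /negsum -big_split; apply: eq_bigr => i _; exact: normr_posneg.
have [h|h] := leP (possum a) (negsum a).
  by rewrite ler0_norm ?subr_le0//; ring.
by rewrite gtr0_norm ?subr_gt0//; ring.
Qed.

(** The partial sums over the nonnegative and over the negative [a_i]: reversing
    the signs on the second group turns their sum into their difference. *)
Definition signed_pos a A : R := \sum_(i | 0 <= a i) a i * (-1) ^+ (i \in A).
Definition signed_neg a A : R := \sum_(i | ~~ (0 <= a i)) a i * (-1) ^+ (i \in A).

Lemma signed_sum_split a A : signed_sum a A = signed_pos a A + signed_neg a A.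
Proof. by rewrite /signed_sum (bigID (fun i => 0 <= a i)). Qed.

Lemma possumE a : possum a = \sum_(i | 0 <= a i) a i.
Proof.
rewrite /possum (bigID (fun i => 0 <= a i))/= [X in _ + X]big1 ?addr0.
  by apply: eq_bigr => i ai; rewrite max_l.
by move=> i; rewrite -ltNge => ai; rewrite max_r// ltW.
Qed.

Lemma negsumE a : negsum a = \sum_(i | ~~ (0 <= a i)) - a i.
Proof.
rewrite /negsum (bigID (fun i => 0 <= a i))/= [X in X + _]big1 ?add0r.
  by apply: eq_bigr => i; rewrite -ltNge => ai; rewrite max_l// oppr_ge0 ltW.
by move=> i ai; rewrite max_r// oppr_le0.
Qed.

Lemma signed_pos_le a A : `|signed_pos a A| <= possum a.
Proof.
rewrite possumE; apply: le_trans (ler_norm_sum _ _ _) _; apply: ler_sum => i ai.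
by rewrite normrM normrX normrN1 expr1n mulr1 ger0_norm.
Qed.

Lemma signed_neg_le a A : `|signed_neg a A| <= negsum a.
Proof.
rewrite negsumE; apply: le_trans (ler_norm_sum _ _ _) _; apply: ler_sum => i.
rewrite -ltNge => ai.
by rewrite normrM normrX normrN1 expr1n mulr1 ltr0_norm.
Qed.

Definition flipneg a A : {set 'I_m} := [set i | (i \in A) (+) ~~ (0 <= a i)]%SET.

Lemma flipnegK a : involutive (flipneg a).
Proof. by move=> A; apply/setP => i; rewrite !inE -addbA addbb addbF. Qed.

(** Average the sum over [A] with the same sum after reversing the signs of the
    negative [a_i], and apply [normr_sum_sub]. *)
Lemma sum_signed_max a :
  \sum_A `|signed_sum a A| = \sum_A Num.max `|signed_pos a A| `|signed_neg a A|.
Proof.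
have E : \sum_A `|signed_sum a A| = \sum_A `|signed_pos a A - signed_neg a A|.
  rewrite (reindex_inj (inv_inj (flipnegK a)))/=; apply: eq_bigr => A _.
  rewrite signed_sum_split; congr `|_ + _|.
    by apply: eq_bigr => i ai; rewrite !inE ai addbF.
  rewrite /signed_neg -sumrN; apply: eq_bigr => i ai; rewrite !inE ai addbT.
  by case: (i \in A); rewrite /= ?expr0 ?expr1; ring.
have : \sum_A `|signed_sum a A| + \sum_A `|signed_sum a A| =
    2 * \sum_A Num.max `|signed_pos a A| `|signed_neg a A|.
  rewrite {2}E -big_split mulr_sumr; apply: eq_bigr => A _ /=.
  by rewrite signed_sum_split normr_sum_sub.
lra.
Qed.

Lemma signed_max_le a A :
  Num.max `|signed_pos a A| `|signed_neg a A| <= Num.max (possum a) (negsum a).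
Proof.
by rewrite ge_max !le_max signed_pos_le signed_neg_le orbT.
Qed.

Lemma card_sets : #|{set 'I_m}| = (2 ^ m)%N.
Proof. by rewrite -cardsT -powersetT card_powerset cardsT card_ord. Qed.

(** Both sides are twice a sum of maxima by [sum_signed_max] and [max_posneg],
    and the signed partial sums are bounded by the unsigned ones. *)
Lemma sum_signed_le a :
  2 * \sum_A `|signed_sum a A| <= 2 ^+ m * (`|\sum_i a i| + \sum_i `|a i|).
Proof.
rewrite max_posneg mulrCA ler_pM2l// sum_signed_max.
apply: (@le_trans _ _ (\sum_(A : {set 'I_m}) Num.max (possum a) (negsum a))).
  by apply: ler_sum => A _; exact: signed_max_le.
by rewrite sumr_const card_sets -[leLHS]mulr_natl natrX.
Qed.

(** The bound is not attained at the choice of signs that reverses only [a_i]: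
    there [a_i] and [a_j] partly cancel, while the negative part is already
    smaller than the positive one. *)
Lemma sum_signed_lt a i j : i != j -> 0 < a i -> 0 < a j -> negsum a < possum a ->
  2 * \sum_A `|signed_sum a A| < 2 ^+ m * (`|\sum_i a i| + \sum_i `|a i|).
Proof.
move=> ij ai aj np.
rewrite max_posneg mulrCA ltr_pM2l// sum_signed_max.
apply: (@lt_le_trans _ _ (\sum_(A : {set 'I_m}) Num.max (possum a) (negsum a))); last first.
  by rewrite sumr_const card_sets -[leLHS]mulr_natl natrX.
rewrite (bigD1 [set i]%SET)// [ltRHS](bigD1 [set i]%SET)//=.
apply: ltr_leD; last by apply: ler_sum => A _; exact: signed_max_le.
rewrite [ltRHS]max_l ?(ltW np)// gt_max; apply/andP; split; last first.
  exact: le_lt_trans (signed_neg_le _ _) np.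
have E : possum a = a i + a j + \sum_(k | (0 <= a k) && (k != i) && (k != j)) a k.
  by rewrite possumE (bigD1 i) ?ltW//= (bigD1 j) ?ltW 1?eq_sym ?ij//= addrA.
rewrite /signed_pos (bigD1 i) ?ltW//= (bigD1 j) ?ltW 1?eq_sym ?ij//=.
rewrite !inE eqxx expr1 (negbTE (_ : j != i)) 1?eq_sym// expr0 mulr1 mulrN1.
rewrite (eq_bigr a) => [|k /andP[/andP[_ ki] _]]; last first.
  by rewrite inE (negbTE ki) expr0 mulr1.
rewrite E; have : 0 <= \sum_(k | (0 <= a k) && (k != i) && (k != j)) a k.
  by apply: sumr_ge0 => k /andP[/andP[]].
by move=> S0; rewrite ltr_norml; apply/andP; split; lra.
Qed.

End SignSums.

(** * From the full ball to its positive part *)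

Lemma leb_compact_fin (R : realType) n (A : set 'rV[R]_n) : compact A -> leb n A \is a fin_num.
Proof.
move=> cA; have mA := compact_measurable_mx cA.
have [M [_ /(_ (M + 1)) bM]] := compact_bounded cA.
apply: (@leb_bounded _ _ _ (M + 1)) => // x Ax i.
have : `|x| <= M + 1 by apply: bM => //; rewrite ltrDl.
rewrite [X in X <= _ -> _]/Num.norm/= mx_normrE; apply: le_trans.
exact: (le_bigmax_cond _ (fun ij : 'I_1 * 'I_n => `|x ij.1 ij.2|) (j := (0, i))).
Qed.

Section Limit.
Context {R : realType} (q : R).
Hypothesis q1 : 1 < q.
Let q0 := q_gt0 q1.
Let qm0 := qm1_gt0 q1.

Definition posball m : set 'rV[R]_m :=
  [set x | (forall i, 0 <= x 0 i) /\ \sum_i x 0 i `^ q <= 1].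

Lemma phi_antimono (r s t : R) : 0 < r -> r <= s -> phi q s t <= phi q r t.
Proof.
move=> r0 rs; have s0 : 0 < s by apply: lt_le_trans rs.
have [t0|t0] := leP 0 t; first by rewrite !phi_pos.
rewrite !phi_neg ?(ltW t0)//; apply: ge0_ler_powR; rewrite ?nnegrE ?divr_ge0 ?oppr_ge0 ?(ltW q0) ?(ltW t0) ?(ltW r0) ?(ltW s0)//.
by rewrite ler_pM2l ?oppr_gt0// lef_pV2.
Qed.

Lemma asym_ball_mono m (r s : R) : 0 < r -> r <= s -> asym_ball q r `<=` @asym_ball _ q m s.
Proof.
move=> r0 rs x; rewrite /asym_ball /=; apply: le_trans; apply: ler_sum => i _.
exact: phi_antimono.
Qed.

Lemma posball_asym_ball m (r : R) : 0 < r -> @posball m `<=` asym_ball q r.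
Proof.
move=> r0 x [x0 x1]; rewrite /asym_ball /= /gauge (eq_bigr (fun i => x 0 i `^ q))// => i _.
exact: phi_pos.
Qed.

(** A negative coordinate is penalized by [1 / r], so it cannot persist as
    [r -> 0]. *)
Lemma bigcap_asym_ball m : \bigcap_k asym_ball q k.+1%:R^-1 = @posball m.
Proof.
apply/seteqP; split => [x xB|x xp k _]; last by apply: posball_asym_ball xp; rewrite invr_gt0.
have x0 i : 0 <= x 0 i.
  rewrite leNgt; apply/negP => xi.
  have k0 k : (0 : R) < k.+1%:R^-1 by rewrite invr_gt0.
  pose k := Num.bound ((- x 0 i)^-1).
  have kx : (- x 0 i)^-1 < k.+1%:R.
    by apply: lt_trans (archi_boundP _) _; rewrite ?invr_ge0 ?oppr_ge0 ?ltW// ltr_nat.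
  have : phi q k.+1%:R^-1 (x 0 i) <= 1.
    apply: le_trans (xB k I); rewrite /gauge (bigD1 i)//= lerDl sumr_ge0// => j _; exact: phi_ge0.
  rewrite phi_neg ?(ltW xi)// invrK leNgt => /negP; apply.
  have h : 1 < - x 0 i * k.+1%:R.
    by rewrite -(@ltr_pM2l _ (- x 0 i)^-1) ?invr_gt0 ?oppr_gt0// mulr1 mulKf// oppr_eq0 lt_eqF.
  have : 1 `^ q < (- x 0 i * k.+1%:R) `^ q.
    by apply: gt0_ltr_powR; rewrite ?nnegrE// (le_trans _ (ltW h)).
  by rewrite powR1.
split => //; have := xB 0%N I; rewrite /asym_ball /= /gauge; apply: le_trans.
by apply: ler_sum => i _; rewrite phi_pos.
Qed.

Lemma compact_posball m : compact (@posball m).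
Proof.
rewrite -bigcap_asym_ball; apply: (subclosed_compact _ (@compact_asym_ball R q q1 m 1 _ _)) => //.
  by apply: closed_bigI => k _; exact: closed_asym_ball.
by move=> x /(_ 0%N I); rewrite invr1.
Qed.

(** Preimages of a point [y] in the sets [A k] have a cluster point, which lies in
    all the [A k] and still maps to [y]. *)
Lemma image_bigcap_compact m n (M : 'M[R]_(m, n)) (A : nat -> set 'rV[R]_m) :
  (forall k, compact (A k)) -> {homo A : i j / (i <= j)%N >-> j `<=` i} ->
  \bigcap_k [set z *m M | z in A k] = [set z *m M | z in \bigcap_k A k].
Proof.
move=> cA nA; apply/seteqP; split; last by move=> _ [z zA <-] k _; exists z => //; exact: zA.
move=> y yA.
have /choice[z zP] : forall k, exists z, A k z /\ z *m M = y.
  by move=> k; have [z ? ?] := yA k I; exists z.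
have ncl k : closed (A k `&` [set z | z *m M = y]).
  apply: closedI; first by apply: compact_closed (cA k); exact: norm_hausdorff.
  rewrite (_ : [set z | _] = (fun z => z *m M) @^-1` [set y])//.
  apply: preimage_closed; first by move=> x _; exact: continuous_mulmxr.
  by apply: accessible_closed_set1; apply: hausdorff_accessible; exact: norm_hausdorff.
have [p [A0p clp]] : exists p, A 0%N p /\ cluster (z @ \oo) p.
  have [|p [? ?]] := cA 0%N (z @ \oo) _; last by exists p.
  by exists 0%N => // k _; apply: nA (leq0n k) _ _; case: (zP k).
have pP k : (A k `&` [set z | z *m M = y]) p.
  apply: ncl; move: clp; rewrite clusterE; apply.
  by exists k => // j kj; split; [apply: nA kj _ _|]; case: (zP j).
exists p; first by move=> k _; case: (pP k).
by case: (pP 0%N).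
Qed.

End Limit.

Section Formulas.
Context {R : realType} (q : R) (n : nat) (w : 'rV[R]_n).
Hypothesis q1 : 1 < q.
Let q0 := q_gt0 q1.
Let qm0 := qm1_gt0 q1.
Local Notation W := (fun i => cons_rv 1 w 0 i).
Local Notation k := (fine (kappa q n)).

Lemma fine_kappa_gt0 : 0 < k.
Proof. by rewrite fine_gt0// kappa_gt0//= -ge0_fin_numE ?kappa_fin// ltW// kappa_gt0. Qed.

Definition vol (A : set 'rV[R]_n) : R := fine (leb n A).

Lemma compact_shadow_asym_ball r : 0 < r <= 1 -> compact [set z *m shadow_mx w | z in asym_ball q r].
Proof. by move=> /andP[r0 r1]; apply: compact_image_mulmx; exact: compact_asym_ball. Qed.

(** [crofton] and [flux_decomposition] compute the same integral. *)
Lemma vol_shadow_asym_ball r : 0 < r <= 1 ->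
  2 * k * vol [set z *m shadow_mx w | z in asym_ball q r] =
  \sum_(A : {set 'I_n.+1}) cap_norm q (orthant_coef W A r).
Proof.
move=> r01; have := crofton q1 w r01.
rewrite flux_decomposition//; last by case/andP: r01.
rewrite (eq_bigr (fun A => (cap_norm q (orthant_coef W A r))%:E)); last first.
  by move=> A _; rewrite lform_intE.
rewrite sumEFin -(fineK (kappa_fin q1 n)) -(fineK (leb_compact_fin (compact_shadow_asym_ball r01))).
by rewrite -!EFinM => -[->].
Qed.

(** Every coefficient is a constant times a power of [r]; only the powers of
    exponent [0] survive at [r = 0]. *)
Lemma orthant_coef_lip (A : {set 'I_n.+1}) r i : 0 <= r <= 1 ->
  `|orthant_coef W A r i - orthant_coef W A 0 i| <= `|W i| * r.
Proof.
move=> /andP[r0 r1]; rewrite /orthant_coef -mulrBr !normrM normrX normrN1 expr1n mulr1.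
rewrite ler_wpM2l//; case: (#|A| - _)%N => [|j]; first by rewrite !expr0 subrr normr0.
rewrite [0 ^+ _]expr0n subr0 ger0_norm ?exprn_ge0// exprS ler_piMr//.
exact: exprn_ile1.
Qed.

Lemma cvg_cap_norm (A : {set 'I_n.+1}) :
  cap_norm q (orthant_coef W A j.+1%:R^-1) @[j --> \oo] --> cap_norm q (orthant_coef W A 0).
Proof.
pose C := \sum_i `|W i| * cap_norm q (delta i).
apply/cvgrPdist_le => e e0.
have C0 : 0 <= C by apply: sumr_ge0 => i _; rewrite mulr_ge0// cap_norm_ge0.
have b (r : R) : 0 <= r <= 1 ->
   `|cap_norm q (orthant_coef W A 0) - cap_norm q (orthant_coef W A r)| <= r * C.
  move=> r01; have CE : r * C = \sum_i (`|W i| * r) * cap_norm q (delta i).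
    by rewrite mulr_sumr; apply: eq_bigr => i _; ring.
  rewrite CE ler_norml; apply/andP; split.
    have := cap_norm_dist q1 (orthant_coef W A r) (orthant_coef W A 0).
    move=> /le_trans/(_ (lerD (lexx _) (ler_sum _ (fun i _ => ler_wpM2r (cap_norm_ge0 q _) (orthant_coef_lip A i r01))))).
    lra.
  have := cap_norm_dist q1 (orthant_coef W A 0) (orthant_coef W A r).
  under eq_bigr do rewrite distrC.
  move=> /le_trans/(_ (lerD (lexx _) (ler_sum _ (fun i _ => ler_wpM2r (cap_norm_ge0 q _) (orthant_coef_lip A i r01))))).
  lra.
near=> j.
apply: le_trans (b _ _) _; first by rewrite invr_ge0 ler0n/= invf_le1// ler1n.
rewrite mulrC ler_pdivrMr// mulrC -ler_pdivrMr//.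
near: j; exists (Num.bound (C / e)) => // j /= ej.
have := archi_boundP (divr_ge0 C0 (ltW e0)) => h.
apply: le_trans (ltW h) _; rewrite ler_nat; exact: leq_trans ej _.
Unshelve. all: by end_near. Qed.

(** The shadows decrease to the shadow of the positive part, by
    [image_bigcap_compact], and the measure is continuous from above. *)
Lemma cvg_vol_shadow :
  vol [set z *m shadow_mx w | z in asym_ball q j.+1%:R^-1] @[j --> \oo] -->
  vol [set z *m shadow_mx w | z in @posball R q n.+1].
Proof.
pose S j := [set z *m shadow_mx w | z in asym_ball q (j.+1%:R^-1 : R)].
have j01 j : 0 < (j.+1%:R^-1 : R) <= 1 by rewrite invr_gt0 ltr0n/= invf_le1// ler1n.
have cS j : compact (S j) by exact: compact_shadow_asym_ball.
have nA : {homo (fun j => @asym_ball _ q n.+1 (j.+1%:R^-1 : R)) : i j / (i <= j)%N >-> j `<=` i}.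
  move=> i j ij; apply: asym_ball_mono => //.
  by rewrite lef_pV2 ?posrE// ler_nat.
have SE : \bigcap_j S j = [set z *m shadow_mx w | z in @posball R q n.+1].
  rewrite -bigcap_asym_ball// image_bigcap_compact// => j; apply: compact_asym_ball => //; by case/andP: (j01 j).
have mS j : measurable (S j) by exact: compact_measurable_mx.
have : leb n \o S @ \oo --> leb n (\bigcap_j S j).
  apply: nonincreasing_cvg_mu => //.
  - by rewrite -ge0_fin_numE//; exact: leb_compact_fin.
  - exact: bigcap_measurable.
  - move=> i j ij; apply/subsetPset => _ [z zA <-]; exists z => //; exact: nA zA.
rewrite SE => h; apply: fine_cvg; rewrite fineK//.
by apply: leb_compact_fin; apply: compact_image_mulmx; exact: compact_posball.
Qed.

(** The limit [r -> 0] of [vol_shadow_asym_ball]. *)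
Lemma vol_shadow_posball :
  2 * k * vol [set z *m shadow_mx w | z in @posball R q n.+1] =
  \sum_(A : {set 'I_n.+1}) cap_norm q (orthant_coef W A 0).
Proof.
have h1 : (2 * k) * vol [set z *m shadow_mx w | z in asym_ball q (j.+1%:R^-1 : R)] @[j --> \oo] -->
  2 * k * vol [set z *m shadow_mx w | z in @posball R q n.+1].
  by apply: cvgM; [exact: cvg_cst|exact: cvg_vol_shadow].
have h2 : \sum_(A : {set 'I_n.+1}) cap_norm q (orthant_coef W A (j.+1%:R^-1 : R)) @[j --> \oo] -->
    \sum_(A : {set 'I_n.+1}) cap_norm q (orthant_coef W A 0).
  by apply: cvg_big => [|A _]; [exact: add_continuous|exact: cvg_cap_norm].
apply: (cvg_unique _ h1); first exact: Rhausdorff.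
rewrite (_ : (fun j => _) = (fun j : nat => \sum_(A : {set 'I_n.+1}) cap_norm q (orthant_coef W A (j.+1%:R^-1 : R))))//.
apply/funext => j; apply: vol_shadow_asym_ball.
by rewrite invr_gt0 ltr0n/= invf_le1// ler1n.
Qed.

End Formulas.

(** * Inequalities between the averaged norms *)

Section SignNorm.
Import fingroup perm.
Context {R : realType} (q : R) (m : nat).
Hypothesis q1 : 1 < q.
Let q0 := q_gt0 q1.
Let qm0 := qm1_gt0 q1.
Implicit Types (c d : 'I_m -> R).
Local Notation N := (cap_norm q).
Local Notation iota i := (cap_norm q (delta i)).

Definition signed c (A : {set 'I_m}) (i : 'I_m) : R := c i * (-1) ^+ (i \in A).

Definition sign_norm c : R := \sum_(A : {set 'I_m}) N (signed c A).

Lemma orthant_coef1 c A : orthant_coef c A 1 = signed c A.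
Proof. by apply/funext => i; rewrite /orthant_coef expr1n mulr1. Qed.

(** At [r = 0] the coefficients vanish unless [A] is empty, or [A] is a
    singleton and the index is its element. *)
Lemma sum_orthant_coef0 c :
  \sum_(A : {set 'I_m}) N (orthant_coef c A 0) = N c + \sum_i `|c i| * iota i.
Proof.
rewrite (bigD1 finset.set0)//=; congr (_ + _).
  congr (N _); apply/funext => i; by rewrite /orthant_coef inE cards0 sub0n !expr0 !mulr1.
have Nzero (A : {set 'I_m}) : (1 < #|A|)%N -> N (orthant_coef c A 0) = 0.
  move=> cA; rewrite (_ : orthant_coef c A 0 = fun i => 0 * 0).
    by rewrite cap_normZ// normr0 mul0r.
  apply/funext => i; rewrite /orthant_coef expr0n (_ : _ == 0%N = false) ?mulr0//.
  by apply/negbTE; rewrite -lt0n subn_gt0; case: (i \in A) => //; exact: ltnW.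
have Nset1 i : N (orthant_coef c [set i]%SET 0) = `|c i| * iota i.
  rewrite -[in RHS]normrN -cap_normZ//; congr (N _); apply/funext => j.
  rewrite /orthant_coef cards1 inE /delta; have [->|ji] := eqVneq j i.
    by rewrite expr1 subnn expr0 !mulr1 mulrN1.
  by rewrite subn0 expr1 !mulr0.
rewrite (bigID (fun A : {set 'I_m} => #|A| == 1%N))/= [X in _ + X]big1 ?addr0; last first.
  move=> A /andP[A0 A1]; apply: Nzero; rewrite ltn_neqAle eq_sym A1 card_gt0//.
rewrite (eq_bigl (fun A => A \in [set [set i]%SET | i in 'I_m]%SET)); last first.
  move=> A; apply/andP/imsetP => [[_ /cards1P[i ->]]|[i _ ->]]; first by exists i.
  by rewrite cards1 eqxx -card_gt0 cards1.
rewrite big_imset/=; last by move=> i j _ _ /finset.set1_inj.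
by apply: eq_big => [i|i _]; rewrite ?inE// Nset1.
Qed.

Lemma signed_sum_lform c A (x : 'rV[R]_m) :
  signed_sum (fun i => c i * (q * x 0 i `^ (q - 1))) A = lform q (signed c A) x.
Proof. by apply: eq_bigr => i _; rewrite /signed mulrAC. Qed.

(** The integrand of the difference of the two sides of [sign_norm_le]. *)
Definition sign_gap c (x : 'rV[R]_m) : R :=
  2 ^+ m * (`|lform q c x| + \sum_i `|c i| * `|lform q (delta i) x|) +
  (- 2) * \sum_(A : {set 'I_m}) `|lform q (signed c A) x|.

Lemma sign_gapE c x : cap q x -> let a := fun i => c i * (q * x 0 i `^ (q - 1)) in
  sign_gap c x = 2 ^+ m * (`|\sum_i a i| + \sum_i `|a i|) - 2 * \sum_(A : {set 'I_m}) `|signed_sum a A|.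
Proof.
move=> xc a; rewrite /sign_gap mulNr; congr (_ * (_ + _) - 2 * _).
  by apply: eq_bigr => i _; rewrite normrM lform_delta.
by apply: eq_bigr => A _; rewrite signed_sum_lform.
Qed.

Lemma cap_integrable_gap1 c :
  cap_integrable q (fun x => `|lform q c x| + \sum_i `|c i| * `|lform q (delta i) x|).
Proof.
apply: cap_integrableD => //; first exact: cap_integrable_lform.
apply: cap_integrable_sum => // i; apply: cap_integrableZ => //; exact: cap_integrable_lform.
Qed.

Lemma cap_integrable_gap2 c :
  cap_integrable q (fun x => \sum_(A : {set 'I_m}) `|lform q (signed c A) x|).
Proof. by apply: cap_integrable_sum => // A; exact: cap_integrable_lform. Qed.

Lemma cap_integrable_gap c : cap_integrable q (sign_gap c).
Proof.
apply: cap_integrableD => //; apply: cap_integrableZ => //.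
  exact: cap_integrable_gap1.
exact: cap_integrable_gap2.
Qed.

Lemma capint_gap c :
  capint q (sign_gap c) = 2 ^+ m * (N c + \sum_i `|c i| * iota i) - 2 * sign_norm c.
Proof.
have h1 := cap_integrable_gap1 c; have h2 := cap_integrable_gap2 c.
rewrite /sign_gap capintD//; last 2 first.
- exact: cap_integrableZ.
- exact: cap_integrableZ.
rewrite !capintZ// mulNr; congr (_ * _ - 2 * _); last first.
  by rewrite capint_sum// => A; exact: cap_integrable_lform.
have hi i : cap_integrable q (fun x : 'rV[R]_m => `|c i| * `|lform q (delta i) x|).
  by apply: cap_integrableZ => //; exact: cap_integrable_lform.
rewrite capintD//; last 2 first.
- exact: cap_integrable_lform.
- exact: cap_integrable_sum.
congr (_ + _); rewrite capint_sum//; apply: eq_bigr => i _.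
by rewrite capintZ//; exact: cap_integrable_lform.
Qed.

(** The pointwise inequality [sum_signed_le], integrated. *)
Lemma sign_norm_le c : 2 * sign_norm c <= 2 ^+ m * (N c + \sum_i `|c i| * iota i).
Proof.
rewrite -subr_ge0 -capint_gap.
have : capint q (fun x : 'rV[R]_m => 0 * sign_gap c x) <= capint q (sign_gap c).
  apply: capint_le => //; last 2 first.
  - exact: cap_integrable_gap.
  - by move=> x xc; rewrite mul0r sign_gapE// subr_ge0; exact: sum_signed_le.
  - by apply: cap_integrableZ => //; exact: cap_integrable_gap.
by rewrite capintZ ?mul0r//; exact: cap_integrable_gap.
Qed.

(** [sum_signed_lt] requires the positive terms to outweigh the negative ones.
    This holds on a box on which the coordinates with nonpositive coefficient
    are small in comparison with the [i]-th coordinate. *)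
Lemma sign_norm_lt c i j : i != j -> 0 < c i -> 0 < c j ->
  2 * sign_norm c < 2 ^+ m * (N c + \sum_i `|c i| * iota i).
Proof.
move=> ij ci cj; rewrite -subr_gt0 -capint_gap.
have m0 : (0 < m)%N by apply: leq_ltn_trans (leq0n i) (ltn_ord i).
have m0' : (0 : R) < m%:R by rewrite ltr0n.
(* The factor [tau] is such that [tau^(q-1) \sum_l |c_l| < c_i]. *)
pose C := \sum_l `|c l| + 1.
have ciC : c i <= \sum_l `|c l|.
  by rewrite (bigD1 i)//= gtr0_norm// lerDl sumr_ge0.
have C0 : 0 < C by rewrite /C; lra.
pose tau := (c i / C) `^ (q - 1)^-1.
have tau0 : 0 < tau by rewrite powR_gt0// divr_gt0.
have tauq : tau `^ (q - 1) = c i / C.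
  by rewrite -powRrM mulVf ?gt_eqF// powRr1// divr_ge0// ltW.
have tau1 : tau <= 1.
  have h : c i / C <= 1 by rewrite ler_pdivrMr// mul1r /C; lra.
  have : (c i / C) `^ (q - 1)^-1 <= 1 `^ (q - 1)^-1.
    by apply: ge0_ler_powR; rewrite ?nnegrE ?invr_ge0 ?divr_ge0 ?(ltW qm0) ?(ltW ci) ?(ltW C0).
  by rewrite powR1.
(* Coordinates of size at most [1 / m] keep the box inside the unit ball. *)
pose s := (2 * m%:R : R)^-1.
have s0 : 0 < s by rewrite invr_gt0 mulr_gt0.
have s2 : 2 * s = m%:R^-1 by rewrite /s; field; rewrite gt_eqF.
pose lo l := if 0 < c l then s else s * tau / 2.
pose hi l := if 0 < c l then 2 * s else s * tau.
have st0 : 0 < s * tau by rewrite mulr_gt0.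
have sts : s * tau <= s by rewrite ler_piMr// ltW.
apply: (capint_gt0 (a := lo) (b := hi)) => //.
- exact: cap_integrable_gap.
- by move=> x xc; rewrite sign_gapE// subr_ge0; exact: sum_signed_le.
- by move=> l; rewrite /lo /hi; case: ifP => _; lra.
move=> x xb.
have x0 l : 0 < x 0 l.
  have /andP[+ _] := xb l; apply: lt_le_trans; rewrite /lo; case: ifP => _ //; lra.
have xc : cap q x.
  split => //; apply: (@le_trans _ _ (\sum_(l < m) m%:R^-1)); last first.
    by rewrite sumr_const card_ord -[X in X <= _]mulr_natr mulVf// gt_eqF.
  apply: ler_sum => l _.
  have h : x 0 l <= m%:R^-1.
    have /andP[_ +] := xb l; rewrite -s2 => /le_trans; apply; rewrite /hi; case: ifP => _ //; lra.
  apply: (le_trans _ h).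
  have h1 : (m%:R^-1 : R) <= 1 by rewrite invf_le1// ler1n.
  apply: ge1r_powR; rewrite ?(ltW q1)// x0/=; lra.
split => //; rewrite sign_gapE// subr_gt0.
have xi0 l : 0 < q * x 0 l `^ (q - 1) by rewrite mulr_gt0// powR_gt0.
apply: (@sum_signed_lt _ _ _ i j) => //; try by rewrite mulr_gt0.
apply: (@lt_le_trans _ _ (c i * (q * x 0 i `^ (q - 1)))); last first.
  have ai0 : 0 <= c i * (q * x 0 i `^ (q - 1)) by rewrite mulr_ge0 ?(ltW ci) ?(ltW (xi0 _)).
  rewrite possumE (bigD1 i)//= lerDl.
  by apply: sumr_ge0 => l /andP[].
have xs : s `^ (q - 1) <= x 0 i `^ (q - 1).
  apply: ge0_ler_powR; rewrite ?nnegrE ?(ltW qm0) ?(ltW s0) ?(ltW (x0 _))//.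
  by have /andP[+ _] := xb i; rewrite /lo ci.
apply: (@lt_le_trans _ _ (c i * (q * s `^ (q - 1)))); last by rewrite ler_pM2l// ler_pM2l.
apply: (@le_lt_trans _ _ (\sum_l `|c l| * (q * (s `^ (q - 1) * (c i / C))))).
  apply: ler_sum => l _; rewrite ge_max; apply/andP; split; last first.
    by rewrite !mulr_ge0 ?powR_ge0 ?invr_ge0 ?(ltW q0) ?(ltW ci) ?(ltW C0).
  have [cl|cl] := ltP 0 (c l).
    apply: (@le_trans _ _ 0); first by rewrite oppr_le0 mulr_ge0 ?(ltW cl) ?(ltW (xi0 _)).
    by rewrite !mulr_ge0 ?powR_ge0 ?invr_ge0 ?(ltW q0) ?(ltW ci) ?(ltW C0).
  rewrite -mulNr -(ler0_norm cl) ler_wpM2l// ler_pM2l// -tauq -powRM ?(ltW s0) ?(ltW tau0)//.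
  apply: ge0_ler_powR; rewrite ?nnegrE ?(ltW qm0) ?(ltW st0) ?(ltW (x0 _))//.
  by have /andP[_ +] := xb l; rewrite /hi ltNge cl.
rewrite -mulr_suml.
have P0 : 0 < q * s `^ (q - 1) by rewrite mulr_gt0// powR_gt0.
have -> : (\sum_l `|c l|) * (q * (s `^ (q - 1) * (c i / C))) =
  (q * s `^ (q - 1)) * (c i * ((\sum_l `|c l|) / C)) by ring.
have -> : c i * (q * s `^ (q - 1)) = (q * s `^ (q - 1)) * c i by ring.
rewrite ltr_pM2l// gtr_pMr// ltr_pdivrMr// mul1r /C; lra.
Qed.

Lemma cap_normN c : N (fun i => - c i) = N c.
Proof.
rewrite (_ : (fun i => - c i) = fun i => -1 * c i); last by apply/funext => i; rewrite mulN1r.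
by rewrite cap_normZ// normrN1 mul1r.
Qed.

Lemma sign_normN c : sign_norm (fun i => - c i) = sign_norm c.
Proof.
apply: eq_bigr => A _; rewrite -[RHS]cap_normN; congr (N _); apply/funext => i.
by rewrite /signed mulNr.
Qed.

(** If two coefficients are positive, the inequality is strict by [sign_norm_lt];
    for two negative ones apply this to [- c]. *)
Lemma sign_norm_eq c : 2 * sign_norm c = 2 ^+ m * (N c + \sum_i `|c i| * iota i) ->
  (forall i j, 0 < c i -> 0 < c j -> i = j) /\ (forall i j, c i < 0 -> c j < 0 -> i = j).
Proof.
move=> E; split => i j ci cj; apply/eqP; apply: contraT => ij.
  by have := sign_norm_lt ij ci cj; rewrite E ltxx.
have := @sign_norm_lt (fun i => - c i) i j ij; rewrite !oppr_gt0 => /(_ ci cj).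
rewrite sign_normN cap_normN; under eq_bigr do rewrite normrN.
by rewrite E ltxx.
Qed.

Lemma cap_norm_le c : N c <= \sum_i `|c i| * iota i.
Proof.
have E : c = (fun i => \sum_j c j * delta j i).
  apply/funext => i; rewrite (bigD1 i)//= /delta eqxx mulr1 big1 ?addr0// => j ji.
  by rewrite eq_sym (negbTE ji) mulr0.
rewrite {1}E; apply: le_trans (cap_norm_sum _ _) _ => //.
by apply: ler_sum => i _; rewrite cap_normZ.
Qed.

(** All terms of the linear form are positive on the domain of integration. *)
Lemma cap_norm1 : N (fun _ : 'I_m => 1) = \sum_(i < m) iota i.
Proof.
rewrite -capint_sum//; last by move=> i; exact: cap_integrable_lform.
apply: eq_Rintegral => x /set_mem xc.
have h i : 0 <= q * x 0 i `^ (q - 1) by have /andP[] := cap_dpowR_bounds q1 i xc.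
rewrite ger0_norm; last by apply: sumr_ge0 => i _; rewrite mul1r.
by apply: eq_bigr => i _; rewrite lform_delta// ger0_norm// mul1r.
Qed.

(** The domain of integration and Lebesgue measure are invariant under
    permutations of the coordinates. *)
Lemma cap_norm_perm c (s : {perm 'I_m}) : N (fun i => c (s i)) = N c.
Proof.
have c0 (x : 'rV[R]_m) : (0 <= (\1_(@cap R q m) x * `|lform q c x|)%:E)%E.
  by rewrite lee_fin mulr_ge0.
apply: EFin_inj; rewrite -!lform_intE// [in RHS]/lform_int.
rewrite (lin_change_unit (unitmx_perm _ s) (measurable_lform_int q c) c0).
rewrite det_perm normrX normrN1 expr1n mul1e.
apply: eq_integral => x _; congr (_%:E).
have sE i : (x *m perm_mx s) 0 (s i) = x 0 i.
  rewrite -[s in perm_mx s]invgK -col_permE mxE permK.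
  by [].
congr (_ * _)%R; last congr (`|_|)%R.
  apply: eq_indic; rewrite /cap /=; split=> -[h1 h2]; split.
  - by move=> i; have := h1 (s^-1%g i); rewrite -sE permKV.
  - by rewrite (reindex_inj (@perm_inj _ s))/=; under eq_bigr do rewrite sE.
  - by move=> i; rewrite -sE.
  - by move: h2; rewrite (reindex_inj (@perm_inj _ s))/=; under eq_bigr do rewrite sE.
by rewrite /lform [RHS](reindex_inj (@perm_inj _ s))/=; apply: eq_bigr => i _; rewrite sE.
Qed.

Lemma iota_perm (i j : 'I_m) : iota i = iota j.
Proof.
rewrite -(cap_norm_perm (delta i) (tperm i j)); congr (N _); apply/funext => l.
rewrite /delta; congr (nat_of_bool _)%:R; have [->|lj] := eqVneq l j; first by rewrite tpermR eqxx.
apply/negbTE; apply: contra_neq lj => /(congr1 (tperm i j)); rewrite tpermK tpermL.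
by [].
Qed.

Lemma sign_norm_abs c : sign_norm (fun i => `|c i|) = sign_norm c.
Proof.
pose f (A : {set 'I_m}) := [set i | (i \in A) (+) (c i < 0)]%SET.
have fK : involutive f by move=> A; apply/setP => i; rewrite !inE -addbA addbb addbF.
rewrite [RHS](reindex_inj (inv_inj fK)); apply: eq_bigr => A _; congr (N _).
apply/funext => i; rewrite /signed inE; case: ltP => ci.
  by rewrite ltr0_norm// addbT; case: (i \in A); rewrite ?expr0 ?expr1; ring.
by rewrite ger0_norm// addbF.
Qed.

Lemma sign_norm_perm c (s : {perm 'I_m}) : sign_norm (fun i => c (s i)) = sign_norm c.
Proof.
rewrite /sign_norm (reindex (fun B : {set 'I_m} => s @^-1: B)%SET)/=; last first.
  exists (fun B : {set 'I_m} => (s^-1)%g @^-1: B)%SET => B _; apply/setP => i.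
    by rewrite !inE permKV.
  by rewrite !inE permK.
apply: eq_bigr => B _; rewrite -(cap_norm_perm (signed c B) s); congr (N _).
by apply/funext => i; rewrite /signed inE.
Qed.

Lemma sign_norm_sum (J : finType) (c : J -> 'I_m -> R) :
  sign_norm (fun i => \sum_j c j i) <= \sum_j sign_norm (c j).
Proof.
rewrite exchange_big/=; apply: ler_sum => A _.
apply: le_trans (cap_norm_sum q1 (fun j => signed (c j) A)).
rewrite le_eqVlt; apply/orP; left; apply/eqP; congr (N _); apply/funext => i.
by rewrite /signed mulr_suml.
Qed.

Lemma sign_normZ k c : sign_norm (fun i => k * c i) = `|k| * sign_norm c.
Proof.
rewrite /sign_norm mulr_sumr; apply: eq_bigr => A _; rewrite -cap_normZ//.
by congr (N _); apply/funext => i; rewrite /signed mulrA.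
Qed.

End SignNorm.

Section SignNormAverage.
Import fingroup perm.

(** By invariance under signs and permutations, [(n+1) sign_norm c] is the sum of
    the values at all cyclic shifts of [|c|], which dominates the value at the
    sum of the shifts, a constant vector. *)
Lemma sign_norm_average (R : realType) (q : R) (n : nat) (c : 'I_n.+1 -> R) : 1 < q ->
  (\sum_i `|c i|) * sign_norm q (fun _ : 'I_n.+1 => 1) <= n.+1%:R * sign_norm q c.
Proof.
move=> q1; have s (k : 'I_n.+1) : injective (fun i : 'I_n.+1 => i + k) by exact: addIr.
rewrite -(sign_norm_abs q c).
have <- : \sum_(k < n.+1) sign_norm q (fun i => `|c (perm (s k) i)|) = n.+1%:R * sign_norm q (fun i => `|c i|).
  rewrite (eq_bigr (fun=> sign_norm q (fun i => `|c i|))); last first.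
    by move=> k _; rewrite (sign_norm_perm q1 (fun i => `|c i|)).
  by rewrite sumr_const card_ord mulr_natl.
apply: le_trans (sign_norm_sum q1 _).
rewrite -[X in X * _](ger0_norm (sumr_ge0 _ (fun i _ => normr_ge0 _))) -sign_normZ//.
rewrite le_eqVlt; apply/orP; left; apply/eqP; congr (sign_norm q _); apply/funext => i.
rewrite mulr1 (reindex_inj (@addrI _ i))/=; apply: eq_bigr => k _.
by rewrite permE.
Qed.

End SignNormAverage.

(** * The normalized zonotopes *)

Section ShadowVolumes.
Context {R : realType} (q : R) (n : nat).
Hypothesis q1 : 1 < q.
Let q0 := q_gt0 q1.
Implicit Types w : 'rV[R]_n.
Local Notation k := (fine (kappa q n)).
Local Notation one := (const_mx 1 : 'rV[R]_n).
Local Notation coefs w := (fun i => cons_rv 1 w 0 i).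
Local Notation unit_int := (cap_norm q (delta (ord0 : 'I_n.+1))).

(** The zonotope generated by the standard basis and [- w], and its symmetrization;
    by a linear change of variables every nondegenerate case has this form. *)
Definition zono w : set 'rV[R]_n := [set z *m shadow_mx w | z in @posball R q n.+1].
Definition sym_zono w : set 'rV[R]_n := [set z *m shadow_mx w | z in @lq_ball R n.+1 q].

Lemma lq_ballE m : @lq_ball R m q = @asym_ball R q m 1.
Proof.
apply/funext => x; rewrite /lq_ball /asym_ball /gauge /=; congr (is_true (_ <= 1)).
by apply: eq_bigr => i _; rewrite phi1.
Qed.

Lemma compact_lq_ball m : compact (@lq_ball R m q).
Proof. by rewrite lq_ballE; exact: compact_asym_ball. Qed.

(** The case [r = 1] of [vol_shadow_asym_ball]. *)
Lemma vol_sym_zono w : 2 * k * vol (sym_zono w) = sign_norm q (coefs w).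
Proof.
rewrite /sym_zono lq_ballE vol_shadow_asym_ball ?ltr01 ?lexx//.
by apply: eq_bigr => A _; rewrite orthant_coef1.
Qed.

(** [vol_shadow_posball], in which only the empty set and the singletons
    contribute; the weights of the singletons agree by symmetry. *)
Lemma vol_zono w : 2 * k * vol (zono w) =
  cap_norm q (coefs w) + (\sum_i `|cons_rv 1 w 0 i|) * unit_int.
Proof.
rewrite /zono vol_shadow_posball// sum_orthant_coef0//; congr (_ + _).
by rewrite mulr_suml; apply: eq_bigr => i _; rewrite (iota_perm q1 i ord0).
Qed.

Lemma kappa2_gt0 : 0 < 2 * k. Proof. by rewrite mulr_gt0// fine_kappa_gt0. Qed.

Lemma vol_sym_zono_le w : vol (sym_zono w) <= 2 ^+ n * vol (zono w).
Proof.
have k0 := kappa2_gt0; have H := sign_norm_le q1 (coefs w).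
rewrite -(ler_pM2l k0) (mulrCA (2 * k) (2 ^+ n)) vol_zono vol_sym_zono -(ler_pM2l (ltr0n R 2)).
rewrite mulrA -exprS mulr_suml; move: H.
by under eq_bigr do rewrite (iota_perm q1 _ ord0).
Qed.

(** Among the coefficients [(1, w)] no two have the same strict sign; the
    leading [1] is already positive. *)
Lemma vol_sym_zono_eq w : vol (sym_zono w) = 2 ^+ n * vol (zono w) ->
  (forall i, w 0 i <= 0) /\ (forall i j, w 0 i < 0 -> w 0 j < 0 -> i = j).
Proof.
move=> E; have := @sign_norm_eq R q n.+1 q1 (coefs w).
rewrite -vol_sym_zono E => H; case: H.
  rewrite (mulrCA (2 * k) (2 ^+ n)) vol_zono exprS mulrA; congr (_ * (_ + _)).
  by rewrite mulr_suml; apply: eq_bigr => i _; rewrite (iota_perm q1 _ ord0).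
move=> hp hn; split => [i|i j wi wj].
  rewrite leNgt; apply/negP => wi.
  have := hp ord0 (lift ord0 i); rewrite cons_rv0 cons_rvS ltr01 => /(_ isT wi) /eqP.
  by rewrite (negbTE (neq_lift _ _)).
have := hn (lift ord0 i) (lift ord0 j); rewrite !cons_rvS => /(_ wi wj).
exact: lift_inj.
Qed.

Lemma coefs_one : (fun i => cons_rv 1 one 0 i) = fun=> 1.
Proof.
apply/funext => i; case: (unliftP ord0 i) => [j ->|->]; first by rewrite cons_rvS mxE.
by rewrite cons_rv0.
Qed.

Lemma vol_zono_one : 2 * k * vol (zono one) = 2 * n.+1%:R * unit_int.
Proof.
rewrite vol_zono coefs_one cap_norm1//.
rewrite (eq_bigr (fun=> unit_int)); last by move=> i _; exact: iota_perm.
rewrite sumr_const card_ord (eq_bigr (fun=> 1)); last by move=> i _; rewrite -[cons_rv _ _ _ _]/(coefs one i) coefs_one normr1.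
by rewrite sumr_const card_ord -[X in X + _]mulr_natl -mulrDl; congr (_ * _); ring.
Qed.

Lemma unit_int_ge0 : 0 <= unit_int. Proof. exact: cap_norm_ge0. Qed.

(** The numerator of the quotient of volumes is bounded below by
    [sign_norm_average] and the denominator above by [cap_norm_le]; both are
    equalities at the vector of ones. *)
Lemma vol_sym_zono_ge w : vol (sym_zono one) * vol (zono w) <= vol (sym_zono w) * vol (zono one).
Proof.
have k0 := kappa2_gt0.
rewrite -(ler_pM2l k0) -(ler_pM2l k0).
have -> : 2 * k * (2 * k * (vol (sym_zono one) * vol (zono w))) =
  (2 * k * vol (sym_zono one)) * (2 * k * vol (zono w)) by ring.
have -> : 2 * k * (2 * k * (vol (sym_zono w) * vol (zono one))) =
  (2 * k * vol (sym_zono w)) * (2 * k * vol (zono one)) by ring.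
rewrite vol_zono vol_zono_one !vol_sym_zono.
have := sign_norm_average (coefs w) q1.
have := cap_norm_le q1 (coefs w).
rewrite -[leRHS]/(\sum_i `|cons_rv 1 w 0 i| * cap_norm q (delta i)).
under eq_bigr do rewrite (iota_perm q1 _ ord0).
rewrite -mulr_suml coefs_one.
have s0 : 0 <= sign_norm q (fun _ : 'I_n.+1 => 1 : R).
  by apply: sumr_ge0 => A _; exact: cap_norm_ge0.
have := unit_int_ge0.
move: (\sum_i _) (cap_norm q (coefs w)) (cap_norm q _) s0 (sign_norm q (coefs w)) => W N U.
move: (sign_norm _ _) => S S0 T U0 h1 h2.
apply: (@le_trans _ _ (S * (2 * (W * U)))).
  by apply: ler_wpM2l => //; lra.
rewrite (_ : S * (2 * (W * U)) = (W * S) * (2 * U)); last by ring.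
rewrite (_ : T * (2 * n.+1%:R * U) = (n.+1%:R * T) * (2 * U)); last by ring.
by apply: ler_wpM2r => //; rewrite mulr_ge0.
Qed.

Lemma shadow_mx0 t x : cons_rv t x *m shadow_mx 0 = x :> 'rV[R]_n.
Proof. by rewrite cons_rv_shadow scaler0 subr0. Qed.

(** The case [w = 0] gives the volumes of the balls in dimension [n] in terms of
    the same integrals. *)
Lemma zono0 : zono 0 = @posball R q n.
Proof.
apply/seteqP; split => [_ [z [z0 z1] <-]|x [x0 x1]].
  rewrite (cons_rvP z) shadow_mx0; split => [i|]; first by rewrite mxE.
  move: z1; rewrite big_ord_recl => z1; apply: le_trans z1.
  rewrite -[leLHS]add0r lerD ?powR_ge0//.
  by apply: ler_sum => i _; rewrite mxE.
exists (cons_rv 0 x); last by rewrite shadow_mx0.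
split => [i|]; first by case: (unliftP ord0 i) => [j ->|->]; rewrite ?cons_rvS ?cons_rv0.
rewrite big_ord_recl cons_rv0 powR0 ?gt_eqF// add0r.
by under eq_bigr do rewrite cons_rvS.
Qed.

Lemma sym_zono0 : sym_zono 0 = @lq_ball R n q.
Proof.
apply/seteqP; split => [_ [z z1 <-]|x x1].
  rewrite (cons_rvP z) shadow_mx0; move: z1; rewrite /lq_ball /= big_ord_recl => z1.
  apply: le_trans z1; rewrite -[leLHS]add0r lerD ?powR_ge0//.
  by apply: ler_sum => i _; rewrite mxE.
exists (cons_rv 0 x); last by rewrite shadow_mx0.
rewrite /lq_ball /= big_ord_recl cons_rv0 normr0 powR0 ?gt_eqF// add0r.
by under eq_bigr do rewrite cons_rvS.
Qed.

Lemma coefs0 : coefs (0 : 'rV[R]_n) = @delta R n.+1 ord0.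
Proof.
apply/funext => i; rewrite /delta; case: (unliftP ord0 i) => [j ->|->].
  by rewrite cons_rvS mxE eq_sym (negbTE (neq_lift _ _)).
by rewrite cons_rv0 eqxx.
Qed.

Lemma vol_posball : k * vol (@posball R q n) = unit_int.
Proof.
have := vol_zono 0; rewrite zono0 coefs0.
rewrite big_ord_recl cons_rv0 normr1 big1 ?addr0; last by move=> i _; rewrite cons_rvS mxE normr0.
by rewrite mul1r; lra.
Qed.

(** With [w = 0] only the first coefficient is nonzero, so all [2^(n+1)] terms of
    [sign_norm] are equal. *)
Lemma vol_lq_ball : vol (@lq_ball R n q) = 2 ^+ n * vol (@posball R q n).
Proof.
have k0 := kappa2_gt0; apply: (mulfI (lt0r_neq0 k0)).
rewrite (mulrCA (2 * k) (2 ^+ n)) -sym_zono0 vol_sym_zono coefs0 -mulrA vol_posball.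
have cE : 2 ^+ n * 2 = #|{set 'I_n.+1}|%:R :> R by rewrite card_sets natrX exprSr.
rewrite mulrA cE mulr_natl -sumr_const.
apply: eq_bigr => A _; rewrite -[RHS]mul1r.
have -> : 1 = `|(-1) ^+ (ord0 \in A) : R| by rewrite normrX normrN1 expr1n.
rewrite -cap_normZ//; congr (cap_norm q _); apply/funext => i.
by rewrite /signed /delta; case: eqP => [->|_]; rewrite ?mul1r ?mulr1// mul0r mulr0.
Qed.

Lemma vol_zono_oneE : vol (zono one) = n.+1%:R * vol (@posball R q n).
Proof.
have k0 := kappa2_gt0; apply: (mulfI (lt0r_neq0 k0)).
by rewrite vol_zono_one -vol_posball; ring.
Qed.

Lemma unit_int_gt0 : 0 < unit_int.
Proof.
have m0' : (0 : R) < n.+1%:R by rewrite ltr0n.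
pose s := (2 * n.+1%:R : R)^-1.
have s0 : 0 < s by rewrite invr_gt0 mulr_gt0.
have s2 : 2 * s = n.+1%:R^-1 by rewrite /s; field; rewrite gt_eqF.
apply: (capint_gt0 (a := fun=> s) (b := fun=> 2 * s)) => //.
- exact: cap_integrable_lform.
- by move=> i; lra.
move=> x xb; have x0 i : 0 < x 0 i by have /andP[+ _] := xb i; exact: lt_le_trans.
split; last by rewrite lform_delta normr_gt0 mulf_neq0 ?gt_eqF// powR_gt0.
split => //; apply: (@le_trans _ _ (\sum_(l < n.+1) n.+1%:R^-1)); last first.
  by rewrite sumr_const card_ord -[X in X <= _]mulr_natr mulVf// gt_eqF.
apply: ler_sum => l _.
have /andP[_ h] := xb l; rewrite s2 in h.
apply: (le_trans _ h).
have h1 : (n.+1%:R^-1 : R) <= 1 by rewrite invf_le1// ler1n.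
by apply: ge1r_powR; rewrite ?(ltW q1)// x0/= (le_trans h).
Qed.

Lemma vol_posball_gt0 : 0 < vol (@posball R q n).
Proof.
have k0 : 0 < k by exact: fine_kappa_gt0.
by rewrite -(pmulr_rgt0 _ k0) vol_posball unit_int_gt0.
Qed.

End ShadowVolumes.

(** * Zonotopes as linear images of balls *)

Local Notation support := Defs.support.

Section Hoelder.
Context {R : realType} (p q : R) (m : nat).
Hypotheses (p1 : 1 < p) (pq : p^-1 + q^-1 = 1).
Implicit Types a : 'I_m -> R.

Lemma p_gt0 : 0 < p. Proof. exact: lt_trans ltr01 p1. Qed.
Let p0 := p_gt0.

Lemma conj_exp_gt1 : 1 < q.
Proof.
have qE : q^-1 = 1 - p^-1 by rewrite -pq addrAC subrr add0r.
have ip1 : p^-1 < 1 by rewrite invf_lt1.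
have ip0 : 0 < p^-1 by rewrite invr_gt0.
have iq0 : 0 < q^-1 by rewrite qE; lra.
have q0 : 0 < q by rewrite -invr_gt0.
by rewrite -[q]invrK -[X in X < _]invr1 ltf_pV2 ?posrE// qE; lra.
Qed.
Let q1 := conj_exp_gt1.
Let q0 := q_gt0 q1.

Definition pnorm a : R := (\sum_i `|a i| `^ p) `^ p^-1.

Lemma pnormX a : pnorm a `^ p = \sum_i `|a i| `^ p.
Proof.
rewrite -powRrM mulVf ?gt_eqF// powRr1// sumr_ge0// => i _; exact: powR_ge0.
Qed.

Lemma pnorm_div a : pnorm a != 0 -> (\sum_i `|a i| `^ p) / pnorm a `^ p = 1.
Proof.
by move=> a0; rewrite -pnormX divff// powR_eq0 (negbTE a0).
Qed.

Lemma pnorm_add a b c : (forall i, `|a i| `^ p + `|b i| `^ p = `|c i| `^ p) ->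
  (pnorm a `^ p + pnorm b `^ p) `^ p^-1 = pnorm c.
Proof.
move=> abc; rewrite [RHS]/pnorm; congr (_ `^ _).
rewrite -(eq_bigr _ (fun i _ => abc i)) big_split /=.
by congr (_ + _); exact: pnormX.
Qed.

Lemma pnorm_eq0 a i : pnorm a = 0 -> a i = 0.
Proof.
move=> a0; have := pnormX a; rewrite a0 powR0 ?gt_eqF// => /esym/eqP.
rewrite psumr_eq0 => [|j _]; last exact: powR_ge0.
by move=> /allP/(_ i (mem_index_enum i)); rewrite powR_eq0 normr_eq0 => /andP[/eqP].
Qed.

(** Young's inequality [st <= s^p / p + t^q / q] for the normalized [a], summed. *)
Lemma hoelder_sum a (x : 'rV[R]_m) : lq_ball q x -> \sum_i x 0 i * a i <= pnorm a.
Proof.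
move=> xB; have [S0|Sn0] := eqVneq (pnorm a) 0.
  by rewrite S0 big1// => i _; rewrite (pnorm_eq0 i S0) mulr0.
have S_gt0 : 0 < pnorm a by rewrite lt_neqAle eq_sym Sn0 powR_ge0.
rewrite -[leRHS]mul1r -ler_pdivrMr// mulr_suml.
apply: (@le_trans _ _ (\sum_i ((`|a i| / pnorm a) `^ p / p + `|x 0 i| `^ q / q))).
  apply: ler_sum => i _; apply: (@le_trans _ _ ((`|a i| / pnorm a) * `|x 0 i|)).
    rewrite (_ : x 0 i * a i / pnorm a = a i / pnorm a * x 0 i); last by ring.
    by apply: le_trans (ler_norm _) _; rewrite !normrM normfV (ger0_norm (ltW S_gt0)).
  by apply: conjugate_powR => //; rewrite divr_ge0// ltW.
rewrite big_split -!mulr_suml /=.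
rewrite (eq_bigr (fun i => `|a i| `^ p / pnorm a `^ p)); last first.
  move=> i _; rewrite powRM ?invr_ge0 ?(ltW S_gt0)//; congr (_ * _).
  by rewrite -[(pnorm a)^-1]powR_inv1 ?(ltW S_gt0)// powRAC powR_inv1 ?powR_ge0.
rewrite -mulr_suml pnorm_div// mul1r -pq lerD2l.
by rewrite ler_piMl// invr_ge0 ltW.
Qed.

(** The extremal vector has entries proportional to [sg(a_i) |a_i|^(p-1)]. The
    clause on signs lets the same vector serve for the positive part of the ball. *)
Lemma hoelder_attained a : exists x : 'rV[R]_m,
  [/\ lq_ball q x, (forall i, 0 <= a i -> 0 <= x 0 i) & \sum_i x 0 i * a i = pnorm a].
Proof.
have [S0|Sn0] := eqVneq (pnorm a) 0.
  exists 0; split.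
  - by rewrite /lq_ball /= big1// => i _; rewrite mxE normr0 powR0// gt_eqF.
  - by move=> i _; rewrite mxE.
  - by rewrite S0 big1// => i _; rewrite mxE mul0r.
have S_gt0 : 0 < pnorm a by rewrite lt_neqAle eq_sym Sn0 powR_ge0.
exists (\row_i (Num.sg (a i) * (`|a i| / pnorm a) `^ (p - 1))); split.
- rewrite /lq_ball /= (eq_bigr (fun i => `|a i| `^ p / pnorm a `^ p)).
    by rewrite -mulr_suml pnorm_div.
  move=> i _; rewrite mxE normrM (ger0_norm (powR_ge0 _ _)).
  have [ai|ai] := eqVneq (a i) 0.
    by rewrite ai sgr0 !normr0 mul0r !powR0 ?mul0r ?gt_eqF.
  rewrite normr_sg ai mul1r -powRrM.
  have -> : (p - 1) * q = p.
    have h : p^-1 * (p * q) + q^-1 * (p * q) = p * q by rewrite -mulrDl pq mul1r.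
    have h1 : p^-1 * (p * q) = q by rewrite mulKf ?gt_eqF.
    have h2 : q^-1 * (p * q) = p by rewrite (mulrC p) mulKf ?gt_eqF.
    by rewrite mulrBl mul1r -h h1 h2; ring.
  rewrite powRM ?invr_ge0 ?(ltW S_gt0)//; congr (_ * _).
  by rewrite -[(pnorm a)^-1]powR_inv1 ?(ltW S_gt0)// powRAC powR_inv1 ?powR_ge0.
- by move=> i ai; rewrite mxE mulr_ge0 ?powR_ge0// sgr_ge0.
- rewrite (eq_bigr (fun i => pnorm a * (`|a i| `^ p / pnorm a `^ p))).
    by rewrite -mulr_sumr -mulr_suml pnorm_div// mulr1.
  by move=> i _; rewrite mxE -mul_powR_div// mulrAC -normrEsg.
Qed.

Lemma convex_lq_ball : convex_set (lq_ball q : set 'rV[R]_m).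
Proof.
move=> x y t; rewrite !inE /lq_ball /= => xB yB; rewrite convE.
have t0 : 0 <= t%:num by [].
have t1 : t%:num <= 1 by [].
apply: (@le_trans _ _ (\sum_i (t%:num * `|x 0 i| `^ q + (1 - t%:num) * `|y 0 i| `^ q))).
  apply: ler_sum => i _; rewrite !mxE.
  have := @convex_powR R q (ltW q1) t `|x 0 i| `|y 0 i|.
  rewrite !inE /= !in_itv/= !andbT => /(_ (normr_ge0 _) (normr_ge0 _)).
  apply: le_trans; apply: ge0_ler_powR; rewrite ?nnegrE ?(ltW q0)//.
    by rewrite addr_ge0// mulr_ge0// subr_ge0.
  apply: le_trans (ler_normD _ _) _; rewrite !normrM (ger0_norm t0).
  by rewrite (ger0_norm (_ : 0 <= 1 - t%:num)) ?subr_ge0.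
rewrite big_split -!mulr_sumr /=.
move: (t%:num) t0 t1 (\sum_i _) xB (\sum_i _) yB => s s0 s1 A A1 B B1.
nra.
Qed.

Lemma posballE : @posball R q m = lq_ball q `&` [set x | forall i, 0 <= x 0 i].
Proof.
apply/seteqP; split => x; rewrite /lq_ball /posball /=.
  by move=> [x0 x1]; split => //; under eq_bigr do rewrite ger0_norm//.
by move=> [x1 x0]; split => //; move: x1; under eq_bigr do rewrite ger0_norm//.
Qed.

Lemma convex_posball : convex_set (@posball R q m).
Proof.
rewrite posballE => x y t; rewrite !inE => -[x1 x0] [y1 y0]; split.
  by apply: set_mem; apply: convex_lq_ball; rewrite inE.
by move=> i; rewrite convE !mxE addr_ge0// mulr_ge0// subr_ge0.
Qed.

Lemma convex_image_mulmx n (M : 'M[R]_(m, n)) (A : set 'rV[R]_m) : convex_set A ->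
  convex_set [set x *m M | x in A].
Proof.
move=> cA x y t; rewrite !inE => -[a Aa <-] [b Ab <-].
exists (t%:num *: a + (1 - t%:num) *: b); first exact: convex_comb.
by rewrite convE mulmxDl !scalemxAl.
Qed.

Lemma posball0 : @posball R q m 0.
Proof.
split=> [i|]; first by rewrite mxE.
by rewrite big1// => i _; rewrite mxE powR0// gt_eqF.
Qed.

Lemma lq_ball0 : lq_ball q (0 : 'rV[R]_m).
Proof. by have := posball0; rewrite posballE => -[]. Qed.

Lemma support_max n (K : set 'rV[R]_n) x k : compact K -> K k ->
  (forall l, K l -> dot x l <= dot x k) -> support K x = dot x k.
Proof.
move=> cK Kk h; have [|l [Kl E _]] := support_attained x cK; first by exists k.
by apply/eqP; rewrite eq_le {1}E h//= dot_le_support.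
Qed.

Definition vecs_mx n (u : 'I_m -> 'rV[R]_n) : 'M[R]_(m, n) := \matrix_(i, j) u i 0 j.

Lemma mul_vecs_mx n (u : 'I_m -> 'rV[R]_n) x : x *m vecs_mx u = \sum_i x 0 i *: u i.
Proof.
apply/rowP => j; rewrite mxE summxE; apply: eq_bigr => i _; by rewrite !mxE.
Qed.

Lemma dot_vecs_mx n (u : 'I_m -> 'rV[R]_n) x y :
  dot y (x *m vecs_mx u) = \sum_i x 0 i * dot y (u i).
Proof.
rewrite mul_vecs_mx.
elim: (index_enum _) => [|i s IHs]; first by rewrite !big_nil dot0r.
by rewrite !big_cons dotDr dotZr IHs.
Qed.

Lemma support_lq_image n (u : 'I_m -> 'rV[R]_n) y :
  support [set x *m vecs_mx u | x in lq_ball q] y = pnorm (fun i => dot y (u i)).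
Proof.
have [x [xB _ E]] := hoelder_attained (fun i => dot y (u i)).
rewrite (@support_max _ _ y (x *m vecs_mx u)).
- by rewrite dot_vecs_mx.
- by apply: compact_image_mulmx; exact: compact_lq_ball.
- by exists x.
- by move=> _ [z zB <-]; rewrite !dot_vecs_mx E; exact: hoelder_sum.
Qed.

(** On the positive part of the ball the functional is at most the one with the
    positive parts of the coefficients; equality holds at the extremal vector
    of the latter, restricted to the indices with nonnegative coefficient. *)
Lemma support_pos_image n (u : 'I_m -> 'rV[R]_n) y :
  support [set x *m vecs_mx u | x in @posball R q m] y =
  pnorm (fun i => Num.max (dot y (u i)) 0).
Proof.
have [x [xB x0 E]] := hoelder_attained (fun i => Num.max (dot y (u i)) 0).
have xp : @posball R q m x.
  by rewrite posballE; split => // i; apply: x0; rewrite le_max lexx orbT.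
have [x' x'E] : exists x' : 'rV[R]_m, x' = \row_i (if 0 <= dot y (u i) then x 0 i else 0) by eexists.
have xp' : @posball R q m x'.
  case: xp => h1 h2; split => [i|]; first by rewrite x'E mxE; case: ifP.
  apply: le_trans h2; apply: ler_sum => i _; rewrite x'E mxE; case: ifP => // _.
  by rewrite powR0 ?gt_eqF// powR_ge0.
have E' : \sum_i x' 0 i * dot y (u i) = pnorm (fun i => Num.max (dot y (u i)) 0).
  rewrite -E; apply: eq_bigr => i _; rewrite x'E mxE; case: ifPn => h; first by rewrite max_l.
  by rewrite mul0r max_r ?mulr0// ltW// ltNge.
rewrite (@support_max _ _ y (x' *m vecs_mx u)).
- by rewrite dot_vecs_mx.
- by apply: compact_image_mulmx; apply: compact_posball; exact: q1.
- by exists x'.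
- move=> _ [z [z0 z1] <-]; rewrite !dot_vecs_mx E'.
  apply: (@le_trans _ _ (\sum_i z 0 i * Num.max (dot y (u i)) 0)).
    by apply: ler_sum => i _; rewrite ler_wpM2l// le_max lexx.
  by apply: hoelder_sum; have : @posball R q m z by []; rewrite posballE => -[].
Qed.

Lemma support_segment0 n (u y : 'rV[R]_n) : support (segment0 u) y = Num.max (dot y u) 0.
Proof.
have [cS _ _] := convex_body0_segment0 u.
have [h|h] := leP 0 (dot y u).
  rewrite (@support_max _ _ y u)//.
    by exists 1; rewrite ?scale1r//= in_itv/= lexx ler01.
  by move=> _ [t /= + <-]; rewrite in_itv/= dotZr => /andP[t0 t1]; rewrite ler_piMl.
rewrite (@support_max _ _ y 0) ?dot0r//.
  by exists 0; rewrite ?scale0r//= in_itv/= lexx ler01.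
by move=> _ [t /= + <-]; rewrite in_itv/= dotZr => /andP[t0 t1]; rewrite mulr_ge0_le0// ltW.
Qed.

Lemma support_Lp_sum_segments n (u : 'I_m -> 'rV[R]_n) y :
  support (Lp_sum_segments p u) y = pnorm (fun i => Num.max (dot y (u i)) 0).
Proof.
suff H : convex_body0 (Lp_sum_segments p u) /\
    support (Lp_sum_segments p u) y `^ p = \sum_i Num.max (dot y (u i)) 0 `^ p.
  case: H => -[cK _ K0] E.
  rewrite /pnorm; under [in RHS]eq_bigr do rewrite ger0_norm ?le_max ?lexx ?orbT//.
  by rewrite -E -powRrM divff ?gt_eqF// powRr1// support_ge0.
rewrite /Lp_sum_segments; elim: (index_enum _) => [|i s [bK IHs]].
  rewrite !big_nil; split; first exact: convex_body0_set1.
  rewrite (@support_max _ _ y 0)//; first by rewrite dot0r powR0// gt_eqF.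
    exact: compact_set1.
  by move=> l ->.
rewrite !big_cons; have [bM hM] := Lp_sumP p1 (convex_body0_segment0 (u i)) bK.
split => //; rewrite hM -powRrM mulVf ?gt_eqF// powRr1 ?addr_ge0 ?powR_ge0//.
by rewrite support_segment0 IHs.
Qed.

(** Both sides are convex bodies with the same support function. *)
Lemma Lp_sum_segmentsE n (u : 'I_m -> 'rV[R]_n) :
  Lp_sum_segments p u = [set x *m vecs_mx u | x in @posball R q m].
Proof.
have [cK vK K0] := convex_body0_Lp_sum_segments u p1.
apply: support_inj => //.
- by exists 0.
- by apply: compact_image_mulmx; apply: compact_posball; exact: q1.
- by apply: convex_image_mulmx; exact: convex_posball.
- by exists 0, 0; rewrite ?mul0mx//; exact: posball0.
- by apply/funext => y; rewrite support_Lp_sum_segments support_pos_image.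
Qed.

Lemma support_opp n (K : set 'rV[R]_n) y : support (-%R @` K) y = support K (- y).
Proof.
rewrite /support; congr sup; apply/seteqP; split => x [].
  by move=> _ [k Kk <-] <-; exists k; rewrite ?dotNl ?dotNr.
by move=> k Kk <-; exists (- k); [exists k|rewrite dotNl dotNr].
Qed.

(** For every real [s] one of [s^+] and [(-s)^+] vanishes, so that
    [(s^+)^p + ((-s)^+)^p = |s|^p]. *)
Lemma Lp_sum_oppE n (u : 'I_m -> 'rV[R]_n) :
  Lp_sum p (Lp_sum_segments p u) (-%R @` Lp_sum_segments p u) =
  [set x *m vecs_mx u | x in lq_ball q].
Proof.
have bK := convex_body0_Lp_sum_segments u p1.
have [[cM vM M0] hM] := Lp_sumP p1 bK (convex_body0_opp bK).
apply: support_inj => //.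
- by exists 0.
- by apply: compact_image_mulmx; exact: compact_lq_ball.
- by apply: convex_image_mulmx; exact: convex_lq_ball.
- by exists 0, 0; rewrite ?mul0mx//; exact: lq_ball0.
apply/funext => y; rewrite hM support_opp !support_Lp_sum_segments support_lq_image.
apply: pnorm_add => i; rewrite dotNl; have [h|h] := leP 0 (dot y (u i)).
  by rewrite max_r ?oppr_le0// normr0 powR0 ?gt_eqF// addr0.
by rewrite max_l ?oppr_ge0 ?(ltW h)// normr0 powR0 ?gt_eqF// add0r normrN.
Qed.

End Hoelder.

(** * Reduction to a shadow along a line *)

Section Reduction.
Context {R : realType} (n : nat).
Implicit Types (U : 'M[R]_(n.+1, n)) (x k : 'rV[R]_n.+1) (j : 'I_n.+1).

Lemma exists_left_kernel U : exists k j, k *m U = 0 /\ k 0 j != 0.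
Proof.
have : kermx U != 0.
  by rewrite -mxrank_eq0 mxrank_ker subn_eq0 -ltnNge ltnS rank_leq_col.
move=> /rowV0Pn[k /sub_kermxP kU /rV0Pn[j kj]]; by exists k, j.
Qed.

Lemma mulmx_split_row U x j :
  x *m U = x 0 j *: row j U + col' j x *m row' j U.
Proof.
apply/rowP => c; rewrite !mxE (bigD1_ord j)//=; congr (_ + _).
by apply: eq_bigr => i _; rewrite !mxE.
Qed.

(** The linear relation [k], solved for the [j]-th row. *)
Definition dep_coef k j : 'rV[R]_n := (k 0 j)^-1 *: col' j k.

Lemma row_dep U k j : k *m U = 0 -> k 0 j != 0 ->
  row j U = - (dep_coef k j *m row' j U).
Proof.
move=> kU kj; move: kU; rewrite (mulmx_split_row _ _ j) => /eqP.
rewrite addr_eq0 => /eqP E.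
by rewrite /dep_coef -scalemxAl -scalerN -E scalerA mulVf// scale1r.
Qed.

(** Replacing the [j]-th row by its expression in the others turns [U] into the
    projection along a line, after moving the [j]-th coordinate to the front. *)
Lemma mulmx_dep U k j x : k *m U = 0 -> k 0 j != 0 ->
  x *m U = cons_rv (x 0 j) (col' j x) *m shadow_mx (dep_coef k j) *m row' j U.
Proof.
move=> kU kj; rewrite (mulmx_split_row _ _ j) (row_dep kU kj) cons_rv_shadow.
by rewrite mulmxBl scalerN addrC scalemxAl.
Qed.

Lemma cons_rv_surj j (z : 'rV[R]_n.+1) :
  exists x : 'rV[R]_n.+1, z = cons_rv (x 0 j) (col' j x).
Proof.
exists (\row_i oapp (fun i' => z 0 (lift ord0 i')) (z 0 0) (unlift j i)).
rewrite [LHS]cons_rvP mxE unlift_none /=; congr cons_rv.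
by apply/rowP => i; rewrite !mxE liftK.
Qed.

Lemma sum_cons_rv (F : R -> R) j x :
  \sum_i F (cons_rv (x 0 j) (col' j x) 0 i) = \sum_i F (x 0 i).
Proof.
rewrite big_ord_recl cons_rv0 [RHS](bigD1_ord j)//=; congr (_ + _).
by apply: eq_bigr => i _; rewrite cons_rvS mxE.
Qed.

(** For sets that are invariant under reordering the coordinates, the reordering
    in [mulmx_dep] is harmless. *)
Lemma image_dep (A : set 'rV[R]_n.+1) U k j : k *m U = 0 -> k 0 j != 0 ->
  (forall x, A (cons_rv (x 0 j) (col' j x)) <-> A x) ->
  [set x *m U | x in A] =
  [set y *m row' j U | y in [set z *m shadow_mx (dep_coef k j) | z in A]].
Proof.
move=> kU kj hA; apply/seteqP; split => y.
  move=> [x Ax <-]; rewrite (mulmx_dep x kU kj).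
  by exists (cons_rv (x 0 j) (col' j x) *m shadow_mx (dep_coef k j)) => //; exists (cons_rv (x 0 j) (col' j x)) => //; exact/hA.
move=> [_ [z Az <-] <-]; have [x zE] := cons_rv_surj j z.
by exists x; [apply/hA; rewrite -zE|rewrite (mulmx_dep x kU kj) -zE].
Qed.

Lemma posball_cons_rv q j x :
  @posball R q n.+1 (cons_rv (x 0 j) (col' j x)) <-> @posball R q n.+1 x.
Proof.
rewrite /posball /= (sum_cons_rv (fun t => t `^ q)).
split => -[h ?]; split => // i.
  case: (unliftP j i) => [i' ->|->]; first by have := h (lift 0 i'); rewrite cons_rvS mxE.
  by have := h 0; rewrite cons_rv0.
by case: (unliftP ord0 i) => [i' ->|->]; rewrite ?cons_rv0 ?cons_rvS ?mxE.
Qed.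

Lemma lq_ball_cons_rv q j x :
  lq_ball q (cons_rv (x 0 j) (col' j x)) <-> lq_ball q x.
Proof. by rewrite /lq_ball /= (sum_cons_rv (fun t => `|t| `^ q)). Qed.

Lemma image_singular m (M : 'M[R]_(m, n)) (a : 'rV[R]_n) (A : set 'rV[R]_m) :
  a != 0 -> M *m a^T = 0 -> in_hyperplane [set x *m M | x in A].
Proof.
move=> a0 Ma; exists a, 0; split=> // _ [x _ <-] /=.
have := mulmx_trE (x *m M) a; rewrite -mulmxA Ma mulmx0.
by move=> /matrixP/(_ 0 0); rewrite !mxE eqxx mulr1n dotC.
Qed.

Lemma singular_normal (T : 'M[R]_n) : T \notin unitmx ->
  exists2 a : 'rV[R]_n, a != 0 & T *m a^T = 0.
Proof.
rewrite unitmxE unitfE negbK -det_tr => /det0P[a a0 aT]; exists a => //.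
by apply: trmx_inj; rewrite trmx_mul trmxK aT trmx0.
Qed.

Lemma vol_hyperplane (A : set 'rV[R]_n) : compact A -> in_hyperplane A -> vol A = 0.
Proof. by move=> cA hA; rewrite /vol leb_in_hyperplane//; exact: compact_measurable_mx. Qed.

Lemma vol_image_lin (T : 'M[R]_n) (A : set 'rV[R]_n) : T \in unitmx -> compact A ->
  vol [set x *m T | x in A] = `|\det T| * vol A.
Proof.
move=> uT cA; rewrite /vol leb_image_lin//; last exact: compact_measurable_mx.
by rewrite fineM// leb_compact_fin.
Qed.

End Reduction.

Lemma compact_zonotope (R : realType) (q : R) m n (M : 'M[R]_(m, n)) : 1 < q ->
  compact [set x *m M | x in @posball R q m].
Proof. by move=> q1; apply: compact_image_mulmx; exact: compact_posball. Qed.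

Lemma compact_sym_zonotope (R : realType) (q : R) m n (M : 'M[R]_(m, n)) : 1 < q ->
  compact [set x *m M | x in @lq_ball R m q].
Proof. by move=> q1; apply: compact_image_mulmx; exact: compact_lq_ball. Qed.

Section ZonoReduction.
Context {R : realType} (p q : R) (n : nat).
Hypotheses (p1 : 1 < p) (pq : p^-1 + q^-1 = 1).
Let q1 := conj_exp_gt1 p1 pq.

(** Some row [j] depends on the others. If these are independent, they serve as
    a basis in which the map is a projection along a line; otherwise all rows are
    orthogonal to a common vector. *)
Lemma zonotope_cases (U : 'M[R]_(n.+1, n)) :
  (forall A : set 'rV[R]_n.+1, in_hyperplane [set x *m U | x in A]) \/
  exists j w d, [/\ 0 < d, row j U = - (w *m row' j U),
    vol [set x *m U | x in @posball R q n.+1] = d * vol (zono q w)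
  & vol [set x *m U | x in @lq_ball R n.+1 q] = d * vol (sym_zono q w)].
Proof.
have [k [j [kU kj]]] := exists_left_kernel U.
have [uT|nT] := boolP (row' j U \in unitmx); [right|left].
  exists j, (dep_coef k j), `|\det (row' j U)|; split.
  - by rewrite normr_gt0 -unitfE -unitmxE.
  - exact: row_dep.
  - rewrite (image_dep kU kj (posball_cons_rv q j)) vol_image_lin//.
    exact: compact_zonotope.
  - rewrite (image_dep kU kj (lq_ball_cons_rv q j)) vol_image_lin//.
    exact: compact_sym_zonotope.
move=> A; have [a a0 Ta] := singular_normal nT.
have := @image_singular _ _ _ U a A a0; apply; apply/row_matrixP => i; rewrite row_mul row0.
case: (unliftP j i) => [i' ->|->].
  by rewrite (_ : row _ U = row i' (row' j U)) -?row_mul ?Ta ?row0//; apply/rowP => c; rewrite !mxE.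
by rewrite (row_dep kU kj) mulNmx -mulmxA Ta mulmx0 oppr0.
Qed.

Lemma volume_fin (A : set 'rV[R]_n) : compact A -> volume A = (vol A)%:E.
Proof. by move=> cA; rewrite volumeE /vol fineK// leb_compact_fin. Qed.

(** Segments [ [0, x] ] and [ [0, s x] ] have the [L_p]-sum [ [0, c x] ] with
    [c^p = 1 + s^p], as the support functions show. *)
Lemma Lp_sum_segments_merge (u : 'I_n.+1 -> 'rV[R]_n) j i0 s : 0 <= s ->
  u j = s *: u (lift j i0) ->
  exists v : 'I_n -> 'rV[R]_n, Lp_sum_segments p u = Lp_sum_segments p v.
Proof.
have p0 := p_gt0 p1.
move=> s0 uj; pose c := (1 + s `^ p) `^ p^-1.
have c0 : 0 <= c by exact: powR_ge0.
have cp : c `^ p = 1 + s `^ p.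
  by rewrite /c -powRrM mulVf ?gt_eqF// powRr1// addr_ge0 ?powR_ge0.
have maxZ t b : 0 <= t -> Num.max (t * b) 0 = t * Num.max b 0 :> R.
  by move=> t0; rewrite maxr_pMr// mulr0.
exists (fun i => if i == i0 then c *: u (lift j i0) else u (lift j i)).
have [cK vK K0] := convex_body0_Lp_sum_segments u p1.
set v := fun i => _; have [cL vL L0] := convex_body0_Lp_sum_segments v p1.
apply: support_inj => //; [by exists 0|by exists 0|].
apply/funext => y; rewrite !(support_Lp_sum_segments p1) /pnorm; congr (_ `^ _).
rewrite (bigD1_ord j)//= (bigD1 i0)//= [RHS](bigD1 i0)//= addrA; congr (_ + _); last first.
  by apply: eq_bigr => i /negbTE ii0; rewrite /v ii0.
rewrite /v eqxx uj !dotZr !maxZ// !normrM !powRM// !(ger0_norm s0) !(ger0_norm c0) cp.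
by ring.
Qed.

End ZonoReduction.

(** * Projection along the main diagonal *)

Section LeftConstant.
Context {R : realType} (n : nat).
Implicit Types (Q : 'M[R]_(n, n.+1)) (theta : 'rV[R]_n.+1).

Lemma frame_orthogonal theta Q : dot theta theta = 1 -> orthonormal_frame theta Q ->
  @col_mx R 1 n n.+1 theta Q *m (@col_mx R 1 n n.+1 theta Q)^T = 1%:M.
Proof.
move=> t1 [QQ Qt]; rewrite tr_col_mx mul_col_row QQ Qt mulmx_trE t1.
have -> : theta *m Q^T = 0 by apply: trmx_inj; rewrite trmx_mul trmxK Qt trmx0.
by rewrite -scalar_mx_block.
Qed.

Lemma frame_complete theta Q : dot theta theta = 1 -> orthonormal_frame theta Q ->
  Q^T *m Q = 1%:M - theta^T *m theta.
Proof.
move=> t1 fQ; have /mulmx1C := frame_orthogonal t1 fQ.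
by rewrite tr_col_mx (@mul_row_col _ n.+1 1 n n.+1) => <-; rewrite addrC addKr.
Qed.

(** A cofactor of an orthogonal matrix is, up to sign, the corresponding entry. *)
Lemma frame_minor theta Q : dot theta theta = 1 -> orthonormal_frame theta Q ->
  `|\det (col' 0 Q)| = `|theta 0 0|.
Proof.
move=> t1 fQ; have [B BE] : exists B : 'M[R]_n.+1, B = @col_mx R 1 n n.+1 theta Q by eexists.
have BB : B *m B^T = 1%:M by rewrite BE; exact: frame_orthogonal.
have dB : `|\det B| = 1.
  have := congr1 (fun M => \det M) BB; rewrite det_mulmx det_tr det1 -expr2 => dB2.
  by apply/eqP; rewrite -sqrp_eq1// -normrX dB2 normr1.
have adjE : \adj B = \det B *: B^T.
  have := mul_mx_adj B; move=> /(congr1 (mulmx B^T)).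
  by rewrite mulmxA (mulmx1C BB) mul1mx mul_mx_scalar.
have B00 : B 0 0 = theta 0 0.
  by rewrite BE mxE; case: splitP => k //=; rewrite (ord1 k).
have Bminor : row' 0 (col' 0 B) = col' 0 Q.
  apply/matrixP => i j; rewrite BE !mxE; case: splitP => k /=; first by rewrite ord1.
  by rewrite /bump => /eqP; rewrite eqSS => /eqP/val_inj ->.
have minor : (\adj B) 0 0 = \det (col' 0 Q).
  by rewrite mxE /cofactor addn0 expr0 mul1r Bminor.
by rewrite -minor adjE !mxE normrM dB mul1r B00.
Qed.

(** The coordinates of the projection of [x] in the frame [Q] are [x *m Q^T]. *)
Lemma hyperplane_volumeE theta (K : set 'rV[R]_n.+1) : dot theta theta = 1 ->
  exists2 Q, orthonormal_frame theta Q &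
    hyperplane_volume theta (orth_proj theta @` K) = volume [set x *m Q^T | x in K].
Proof.
move=> t1; exists (xget 0 (orthonormal_frame theta)).
  have [Q fQ] := orthonormal_frame_exists t1; exact: xgetI fQ.
have [Q0 fQ0] := orthonormal_frame_exists t1.
have := xgetI 0 fQ0; rewrite /hyperplane_volume; set Q := xget _ _ => fQ.
have QtQ := frame_complete t1 fQ; have [QQ Qt] := fQ.
have tQ : theta *m Q^T = 0 by apply: trmx_inj; rewrite trmx_mul trmxK Qt trmx0.
congr volume; apply/seteqP; split => v /=.
  move=> [x Kx /(congr1 (mulmx^~ Q^T))]; rewrite -mulmxA QQ mulmx1 => <-.
  by exists x => //; rewrite mulmxBl -scalemxAl tQ scaler0 subr0.
move=> [x Kx <-]; exists x => //.
by rewrite -mulmxA QtQ mulmxBr mulmx1 mulmxA mulmx_trE mul_scalar_mx /orth_proj t1 divr1.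
Qed.

(** The map [x |-> x *m Q^T] kills the diagonal, so it is the projection along the
    diagonal followed by a linear map whose determinant is computed by
    [frame_minor]. *)
Lemma vol_proj_lq_ball q : 1 < q ->
  fine (hyperplane_volume (diagonal_dir n)
          (orth_proj (diagonal_dir n) @` @lq_ball R n.+1 q)) =
  (Num.sqrt n.+1%:R)^-1 * vol (sym_zono q (const_mx 1 : 'rV[R]_n)).
Proof.
move=> q1; have t1 := dot_diagonal_dir (R := R) n.
have [Q fQ ->] := hyperplane_volumeE (@lq_ball R n.+1 q) t1.
have s0 : 0 < Num.sqrt n.+1%:R :> R by rewrite sqrtr_gt0 ltr0n.
have oneQ : const_mx 1 *m Q^T = 0 :> 'rV[R]_n.
  have -> : const_mx 1 = Num.sqrt n.+1%:R *: diagonal_dir n :> 'rV[R]_n.+1.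
    by apply/rowP => i; rewrite !mxE divff// gt_eqF.
  have [_ Qt] := fQ; rewrite -scalemxAl -[_ *m _]trmxK trmx_mul trmxK Qt trmx0.
  by rewrite scaler0.
have one0 : (const_mx 1 : 'rV[R]_n.+1) 0 0 != 0 by rewrite mxE oner_neq0.
rewrite (image_dep oneQ one0 (lq_ball_cons_rv q 0)).
have -> : dep_coef (const_mx 1) 0 = const_mx 1 :> 'rV[R]_n.
  by apply/rowP => i; rewrite !mxE invr1 mul1r.
have minor := frame_minor t1 fQ.
have rQ : row' 0 Q^T = (col' 0 Q)^T by rewrite tr_col'.
have tE : `|(diagonal_dir n : 'rV[R]_n.+1) 0 0| = (Num.sqrt n.+1%:R)^-1.
  by rewrite mxE ger0_norm// invr_ge0 ltW.
rewrite volumeE -/(vol _) rQ vol_image_lin ?det_tr ?minor ?tE//.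
  rewrite unitmx_tr unitmxE unitfE -normr_gt0 minor tE invr_gt0//.
exact: compact_sym_zonotope.
Qed.

(** The factors [2^n] and [sqrt (n+1)] cancel by [vol_lq_ball] and
    [vol_zono_oneE]. *)
Lemma left_constantE q : 1 < q ->
  left_constant n q = vol (sym_zono q (const_mx 1 : 'rV[R]_n)) / vol (zono q (const_mx 1 : 'rV[R]_n)).
Proof.
move=> q1; rewrite /left_constant vol_proj_lq_ball// volumeE -/(vol _).
rewrite vol_lq_ball// vol_zono_oneE//.
have b0 := @vol_posball_gt0 R q n q1.
have s0 : 0 < Num.sqrt n.+1%:R :> R by rewrite sqrtr_gt0 ltr0n.
have ss : Num.sqrt n.+1%:R * Num.sqrt n.+1%:R = n.+1%:R :> R by rewrite -expr2 sqr_sqrtr.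
move: (Num.sqrt _) s0 ss => s s0 <-; move: (vol _) (vol _) b0 => A b b0.
have t0 : 0 < 2 ^+ n :> R by rewrite exprn_gt0.
move: (2 ^+ n) t0 => t t0; by field; rewrite !gt_eqF.
Qed.

End LeftConstant.

(** * The two bounds and their sharpness *)

Section Bounds.
Context {R : realType} (n : nat) (p q : R).
Hypotheses (n_gt0 : (0 < n)%N) (p1 : 1 < p) (pq : p^-1 + q^-1 = 1).
Let q1 : 1 < q := conj_exp_gt1 p1 pq.
Local Notation one := (const_mx 1 : 'rV[R]_n).
Implicit Types (u : 'I_n.+1 -> 'rV[R]_n) (Z : set 'rV[R]_n).

Lemma volume_Lp_sum_segments m (u : 'I_m -> 'rV[R]_n) :
  volume (Lp_sum_segments p u) = (vol [set x *m vecs_mx u | x in @posball R q m])%:E.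
Proof. by rewrite (Lp_sum_segmentsE p1 pq) volume_fin//; exact: compact_zonotope. Qed.

Lemma volume_Lp_sum_opp m (u : 'I_m -> 'rV[R]_n) (Z := Lp_sum_segments p u) :
  volume (Lp_sum p Z (-%R @` Z)) = (vol [set x *m vecs_mx u | x in @lq_ball R m q])%:E.
Proof. by rewrite (Lp_sum_oppE p1 pq) volume_fin//; exact: compact_sym_zonotope. Qed.

Lemma vol_zono_one_gt0 : 0 < vol (zono q one).
Proof. by rewrite vol_zono_oneE// mulr_gt0 ?ltr0n//; exact: vol_posball_gt0. Qed.

Lemma zonotope_degenerate m (U : 'M[R]_(m, n)) :
  (forall A : set 'rV[R]_m, in_hyperplane [set x *m U | x in A]) ->
  vol [set x *m U | x in @posball R q m] = 0 /\
  vol [set x *m U | x in @lq_ball R m q] = 0.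
Proof.
move=> hU; split; apply: vol_hyperplane => //.
  exact: compact_zonotope.
exact: compact_sym_zonotope.
Qed.

Lemma left_bound u Z : Z = Lp_sum_segments p u ->
  ((left_constant n q)%:E * volume Z <= volume (Lp_sum p Z (-%R @` Z)))%E.
Proof.
move=> ->; rewrite volume_Lp_sum_opp volume_Lp_sum_segments -EFinM lee_fin left_constantE//.
have [/zonotope_degenerate[-> ->]|[j [w [d [d0 _ -> ->]]]]] :=
  zonotope_cases p1 pq (vecs_mx u); first by rewrite mulr0.
rewrite mulrCA ler_pM2l// mulrAC ler_pdivrMr ?vol_zono_one_gt0//.
exact: vol_sym_zono_ge.
Qed.

Lemma right_bound u Z : Z = Lp_sum_segments p u ->
  (volume (Lp_sum p Z (-%R @` Z)) <= (2 ^+ n)%:E * volume Z)%E.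
Proof.
move=> ->; rewrite volume_Lp_sum_opp volume_Lp_sum_segments -EFinM lee_fin.
have [/zonotope_degenerate[-> ->]|[j [w [d [d0 _ -> ->]]]]] :=
  zonotope_cases p1 pq (vecs_mx u); first by rewrite mulr0.
by rewrite mulrCA ler_pM2l//; exact: vol_sym_zono_le.
Qed.

Lemma right_equality_imp u Z : Z = Lp_sum_segments p u ->
  volume (Lp_sum p Z (-%R @` Z)) = ((2 ^+ n)%:E * volume Z)%E ->
  in_hyperplane Z \/ exists v : 'I_n -> 'rV[R]_n, Z = Lp_sum_segments p v.
Proof.
move=> ->; rewrite volume_Lp_sum_opp volume_Lp_sum_segments -EFinM.
have [h|[j [w [d [d0 uj -> ->]]]]] := zonotope_cases p1 pq (vecs_mx u).
  by move=> _; left; rewrite (Lp_sum_segmentsE p1 pq); exact: h.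
move=> [] /esym; rewrite mulrCA => /esym /(mulfI (lt0r_neq0 d0)) /(vol_sym_zono_eq q1)[w0 w1].
right.
have [i0 hi0] : exists i0, forall i, i != i0 -> w 0 i = 0.
  have [[i wi]|nw] := pselect (exists i, w 0 i < 0).
    exists i => i' ii'; apply/eqP; rewrite eq_le w0/= leNgt; apply/negP => wi'.
    by move: ii'; rewrite (w1 _ _ wi' wi) eqxx.
  exists (Ordinal n_gt0) => i _; apply/eqP; rewrite eq_le w0/= leNgt; apply/negP => wi.
  by apply: nw; exists i.
apply: (Lp_sum_segments_merge (j := j) (i0 := i0) (s := - w 0 i0) p1); first by rewrite oppr_ge0.
apply/rowP => c; have := congr1 (fun v : 'rV[R]_n => v 0 c) uj.
rewrite !mxE => ->; rewrite (bigD1 i0)//= big1 => [|i ii0]; last by rewrite hi0// mul0r.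
by rewrite !mxE addr0 mulNr.
Qed.

(** A linear image of the ball has [2^n] times the volume of the image of its
    positive part. *)
Lemma right_equality_n (v : 'I_n -> 'rV[R]_n) (Z := Lp_sum_segments p v) :
  volume (Lp_sum p Z (-%R @` Z)) = ((2 ^+ n)%:E * volume Z)%E.
Proof.
rewrite volume_Lp_sum_opp volume_Lp_sum_segments -EFinM; congr EFin.
have [uV|/singular_normal[a a0 Va]] := boolP (vecs_mx v \in unitmx).
  rewrite !vol_image_lin//; [|exact: compact_posball|exact: compact_lq_ball].
  by rewrite mulrCA vol_lq_ball.
have [|-> ->] := @zonotope_degenerate _ (vecs_mx v); last by rewrite mulr0.
by move=> A; exact: image_singular a0 Va.
Qed.

(** By the upper bound both sides vanish. *)
Lemma right_equality_hyperplane u Z : Z = Lp_sum_segments p u -> in_hyperplane Z ->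
  volume (Lp_sum p Z (-%R @` Z)) = ((2 ^+ n)%:E * volume Z)%E.
Proof.
move=> ZE hZ; have /= := right_bound ZE.
have [cZ _ _] : convex_body0 Z by rewrite ZE; exact: convex_body0_Lp_sum_segments.
rewrite [volume Z]volume_fin// vol_hyperplane// mule0 => h.
by apply/eqP; rewrite eq_le h measure_ge0.
Qed.

(** Generators of [zono one], the zonotope attaining the lower bound. *)
Definition extremal_vecs (i : 'I_n.+1) : 'rV[R]_n :=
  if unlift 0 i is Some j then delta_mx 0 j else - one.

Lemma extremal_vecsE : vecs_mx extremal_vecs = shadow_mx one.
Proof.
apply/row_matrixP => i; rewrite !rowE !mul_vecs_mx.
rewrite (bigD1 i)//= mxE !eqxx scale1r big1 ?addr0; last first.
  by move=> k ki; rewrite mxE (negbTE ki) andbF scale0r.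
rewrite /extremal_vecs; case: (unliftP 0 i) => [j ->|->].
  have -> : delta_mx 0 (lift 0 j) = cons_rv 0 (delta_mx 0 j) :> 'rV[R]_n.+1.
    rewrite [LHS]cons_rvP mxE /=; congr cons_rv; apply/rowP => c.
    by rewrite !mxE /=.
  by rewrite cons_rv_shadow scale0r subr0.
have -> : delta_mx 0 0 = cons_rv 1 0 :> 'rV[R]_n.+1.
  by rewrite [LHS]cons_rvP mxE /=; congr cons_rv; apply/rowP => c; rewrite !mxE.
by rewrite cons_rv_shadow scale1r sub0r.
Qed.

Lemma left_constant_sharp (c : R) :
  (forall u Z, Z = Lp_sum_segments p u ->
    (c%:E * volume Z <= volume (Lp_sum p Z (-%R @` Z)))%E) ->
  c <= left_constant n q.
Proof.
move=> /(_ extremal_vecs _ erefl).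
rewrite volume_Lp_sum_opp volume_Lp_sum_segments -EFinM lee_fin extremal_vecsE.
by rewrite left_constantE// ler_pdivlMr// vol_zono_one_gt0.
Qed.

End Bounds.

Theorem corollary25 (R : realType) (n : nat) (p q : R)
    (n_gt0 : (0 < n)%N) (p_gt1 : 1 < p) (pq : p^-1 + q^-1 = 1) :
  (forall (u : 'I_n.+1 -> 'rV[R]_n) (Z : set 'rV[R]_n),
    Z = Lp_sum_segments p u ->
    [/\ ((left_constant n q)%:E * volume Z <= volume (Lp_sum p Z (-%R @` Z)))%E,
        (volume (Lp_sum p Z (-%R @` Z)) <= (2 ^+ n)%:E * volume Z)%E
      & (volume (Lp_sum p Z (-%R @` Z)) = (2 ^+ n)%:E * volume Z)%E <->
        in_hyperplane Z \/
        exists v : 'I_n -> 'rV[R]_n, Z = Lp_sum_segments p v])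
  /\
  (forall c : R,
    (forall (u : 'I_n.+1 -> 'rV[R]_n) (Z : set 'rV[R]_n),
      Z = Lp_sum_segments p u ->
      (c%:E * volume Z <= volume (Lp_sum p Z (-%R @` Z)))%E) ->
    c <= left_constant n q).
Proof.
split=> [u Z ZE|c]; last exact: left_constant_sharp.
split; [exact: (left_bound p_gt1 pq ZE)|exact: (right_bound p_gt1 pq ZE)|].
split=> [|[hZ|[v ->]]]; first exact: (right_equality_imp n_gt0 p_gt1 pq ZE).
  exact: (right_equality_hyperplane p_gt1 pq ZE hZ).
exact: (right_equality_n p_gt1 pq).
Qed.
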